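(* Let $q>2^{12}$ be an odd prime power, let $d\in\mathbb{F}_q[T]$ be monic, square-free and of even degree, and let $K=\mathbb{F}_q(T)(\sqrt d)$ be the corresponding real quadratic extension of $k=\mathbb{F}_q(T)$. Assume that $K$ has class number $1$ (i.e. $\mathbb{A}$ is a unique factorization domain). Let $(x_1,x_2)\in k_\infty^2\setminus\sigma(K)$. Then for every $\varepsilon>0$ there exist infinitely many elements $p/\pi\in K$ with $p,\pi\in\mathbb{A}$, $\pi$ a prime element of $\mathbb{A}$, such that $$\left|x_i-\frac{\sigma_i(p)}{\sigma_i(\pi)}\right|\le \mathcal{N}(\pi)^{-\frac12-\frac18+\log_q\sqrt2+\varepsilon}\qquad (i=1,2).$$
   Context: $k_\infty=\mathbb{F}_q((1/T))$ is the completion of $k=\mathbb{F}_q(T)$ at infinity, with absolute value $|\sum_{i\le n}a_iT^i|=q^n$ if $a_n\neq0$. Since $d$ is monic of even degree, $d$ has a square root $\sqrt d\in k_\infty$ (fixed choice). $\mathbb{A}=\{a+b\sqrt d: a,b\in\mathbb{F}_q[T]\}$ is the integral closure of $\mathbb{F}_q[T]$ in $K$. The two embeddings $\sigma_1,\sigma_2:K\to k_\infty$ are $\sigma_1(a+b\sqrt d)=a+b\sqrt d$, $\sigma_2(a+b\sqrt d)=a-b\sqrt d$ ($a,b\in k$), and $\sigma(K)=\{(\sigma_1(f),\sigma_2(f)):f\in K\}$. For $f\in\mathbb{A}$, $\mathcal{N}(f)=|\sigma_1(f)\sigma_2(f)|=|a^2-b^2d|$, which equals $\#(\mathbb{A}/(f))$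 for $f\ne 0$. *)

(* Defs.v *)
From HB Require Import structures.
From mathcomp Require Import all_boot all_order all_algebra.
From mathcomp Require Import boolp reals exp.
Set Implicit Arguments. Unset Strict Implicit. Unset Printing Implicit Defensive.
Import Order.TTheory GRing.Theory Num.Theory.
Local Open Scope ring_scope.

(* k_oo = F((1/T)) : formal Laurent series in 1/T.                           *)
(* The record  Laurent t s  represents  sum_{j >= 0} s j * T^(t - j).        *)
(* Different records may represent the same series; semantic equality is     *)
(* [lequiv] (equality of all coefficients).                                  *)
Section Laurent.
Variable F : fieldType.

Record laurent := Laurent { ltop : int ; lser : nat -> F }.

Definition tcoef (x : laurent) (i : int) : F :=
  match (ltop x - i)%R with Posz j => lser x j | Negz _ => 0 end.

Definition lequiv (x y : laurent) : Prop := forall i : int, tcoef x i = tcoef y i.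

Definition lpoly (p : {poly F}) : laurent :=
  Laurent (size p)%:Z (fun j => if (j <= size p)%N then p`_(size p - j) else 0).

Definition ladd (x y : laurent) : laurent :=
  let m := Num.max (ltop x) (ltop y) in
  Laurent m (fun j => tcoef x (m - j%:Z) + tcoef y (m - j%:Z)).

Definition lneg (x : laurent) : laurent := Laurent (ltop x) (fun j => - lser x j).

Definition lsub (x y : laurent) : laurent := ladd x (lneg y).

Definition lmul (x y : laurent) : laurent :=
  Laurent (ltop x + ltop y) (fun n => \sum_(i < n.+1) lser x i * lser y (n - i)).

(* coefficients of the inverse of  sum_n a n T^(-n)  (with a 0 != 0):       *)
(* r 0 = (a 0)^-1,  r n = - (a 0)^-1 * sum_{i=1}^{n} a i * r (n - i).        *)
Fixpoint invl (a : nat -> F) (n : nat) : seq F :=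
  match n with
  | 0%N => [:: (a 0%N)^-1]
  | n'.+1 => let l := invl a n' in
      rcons l (- (a 0%N)^-1 * \sum_(i < n'.+1) a i.+1 * nth 0 l (n' - i))
  end.

(* multiplicative inverse in k_oo (0 is sent to 0) *)
Definition linv (x : laurent) : laurent :=
  match pselect (exists j, lser x j != 0) with
  | left h => let j0 := ex_minn h in
              let a := fun n => lser x (j0 + n) in
              Laurent (j0%:Z - ltop x) (fun n => nth 0 (invl a n) n)
  | right _ => Laurent 0 (fun _ => 0)
  end.

Definition ldiv (x y : laurent) : laurent := lmul x (linv y).

End Laurent.

(* absolute value on k_oo: |sum_{i<=n} a_i T^i| = q^n if a_n != 0, |0| = 0 *)
Definition absv (R : realType) (F : finFieldType) (x : laurent F) : R :=
  match pselect (exists j, lser x j != 0) with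
  | left h => (#|F|%:R : R) `^ ((ltop x - (ex_minn h)%:Z)%:~R)
  | right _ => 0
  end.

(* The ring A = F[T][sqrt d]: the element a + b sqrt d is the pair (a, b).  *)
Section Aring.
Variable F : fieldType.
Variable d : {poly F}.

Definition Aelt := ({poly F} * {poly F})%type.

Definition Aone : Aelt := (1, 0).
Definition Azero : Aelt := (0, 0).
Definition Amul (x y : Aelt) : Aelt :=
  (x.1 * y.1 + x.2 * y.2 * d, x.1 * y.2 + x.2 * y.1).

Definition Advd (x y : Aelt) : Prop := exists z, y = Amul x z.
Definition Aunit (x : Aelt) : Prop := exists z, Amul x z = Aone.
Definition Aassoc (x y : Aelt) : Prop := exists u, Aunit u /\ y = Amul x u.

Definition Aprime (p : Aelt) : Prop :=
  p <> Azero /\ ~ Aunit p /\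
  forall x y, Advd p (Amul x y) -> Advd p x \/ Advd p y.

Definition Airred (p : Aelt) : Prop :=
  p <> Azero /\ ~ Aunit p /\
  forall x y, p = Amul x y -> Aunit x \/ Aunit y.

Definition Aprod (s : seq Aelt) : Aelt := foldr Amul Aone s.

(* A is a unique factorization domain (<=> class number one) *)
Definition AUFD : Prop :=
  (forall x, x <> Azero -> ~ Aunit x ->
     exists s : seq Aelt, (forall y, y \in s -> Airred y) /\ x = Aprod s) /\
  (forall s t : seq Aelt, (forall y, y \in s -> Airred y) ->
     (forall y, y \in t -> Airred y) -> Aprod s = Aprod t ->
     exists t', perm_eq t t' /\ size s = size t' /\
       forall i, (i < size s)%N -> Aassoc (nth Azero s i) (nth Azero t' i)).

End Aring.

(* the norm  N(a + b sqrt d) = |a^2 - b^2 d|  (= #(A/(f)) for f != 0) *)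
Definition Anorm (R : realType) (F : finFieldType) (d : {poly F}) (x : Aelt F) : R :=
  absv R (lpoly (x.1 ^+ 2 - x.2 ^+ 2 * d)).

Definition squarefree (F : fieldType) (d : {poly F}) : Prop :=
  forall g : {poly F}, g * g %| d -> (size g <= 1)%N.

(* the two embeddings of A into k_oo, given the chosen square root sd of d *)
Definition sigma1 (F : fieldType) (sd : laurent F) (x : Aelt F) : laurent F :=
  ladd (lpoly x.1) (lmul (lpoly x.2) sd).
Definition sigma2 (F : fieldType) (sd : laurent F) (x : Aelt F) : laurent F :=
  lsub (lpoly x.1) (lmul (lpoly x.2) sd).

(* (x1, x2) \in sigma(K): K = { (a + b sqrt d) / c : a, b, c in F[T], c != 0 } *)
Definition inSigmaK (F : fieldType) (sd : laurent F) (x1 x2 : laurent F) : Prop :=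
  exists a b c : {poly F}, [/\ c != 0,
    lequiv x1 (ldiv (sigma1 sd (a, b)) (lpoly c)) &
    lequiv x2 (ldiv (sigma2 sd (a, b)) (lpoly c))].

(* p/pi and p'/pi' are the same element of K *)
Definition Keq (F : fieldType) (d : {poly F}) (f g : Aelt F * Aelt F) : Prop :=
  Amul d f.1 g.2 = Amul d g.1 f.2.

(* Main.v *)
Require Import Defs.
From HB Require Import structures.
From mathcomp Require Import all_boot all_order all_algebra.
From mathcomp Require Import fraction generic_quotient all_fingroup cyclic.
From mathcomp Require Import zify ring lra.
From mathcomp Require Import boolp reals exp.
Set Implicit Arguments. Unset Strict Implicit. Unset Printing Implicit Defensive.
Import Order.TTheory GRing.Theory Num.Theory.
Local Open Scope ring_scope.

(** Write x1 = u + v sqrt d, x2 = u - v sqrt d and let B(a + b sqrt d) be the residue of a v + b u, an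
F_q-linear form on A.  If B(n h) = 0 for all h in a box of length H, then x_i sigma_i(n) is within
q^(O(1) - H) of sigma_i(p) for a single p in A, so it suffices to find a prime n of degree about 8L
for which B(n h) vanishes on a box of length H = (1 - o(1)) L; balancing n by a unit makes both
|sigma_i(n)| about N(n)^(1/2), and the exponent 1/2 + 1/8 appears.

Such primes are detected by summing over h the function eps(B(n h)), where eps(v) = q [v = 0] - 1 is
the sum of the nontrivial characters.  Vaughan's identity splits the sum over primes n into
type I sums (a box average of a linear form) and type II sums (Cauchy-Schwarz), and both are bounded
by the number of k in a box of length X with B(k e) = 0 on a box of length Y.  Since (x1, x2) is not in
sigma(K), there are infinitely many levels R at which no k <> 0 in a box of length R - C annihilates
a box of length R + C: otherwise consecutive approximations l / k would all be equal, hence equal to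
(x1, x2).  Taking L = R / 3 controls all these counts.  Unique factorization enters through Vaughan's
identity and the prime number theorem, the latter being derived from exact counts of elements of
given shape (deg sigma_1, deg sigma_2), which are periodic under a nontrivial unit. *)

(** * Laurent series as a field *)

(** The value 1/8 comes out of three constraints, up to lower order terms. Let the primes have
    degree N, the box length H, and let u, v be the cutoffs in Vaughan's identity. A type I sum over
    multiples of an element of degree j stays below the main term q^N only for j <= N - 2H, and j
    runs up to u + v. After Cauchy-Schwarz, a type II sum over prime powers of degree a gains only
    for 4H <= a <= N - 2H, which asks for u >= 4H and v >= 2H. Hence 8H <= N, with u = 4H and v = 2H
    in the extremal case. There the squared type II bound at level R is q^(2H + N + 2R), against
    q^(2N), whence R = 3H. At these values everything breaks even, so the box is shortened by a
    small multiple of L: the resulting power saving beats the divisor bound and the polynomial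
    factors, and its price is the epsilon in the exponent. The good levels R are only known to be
    infinitely many, so L is derived from R and not chosen. *)

Definition pseries (F : fieldType) : Type := nat -> F.
HB.instance Definition _ (F : fieldType) := gen_eqMixin (pseries F).
HB.instance Definition _ (F : fieldType) := gen_choiceMixin (pseries F).

Section PSeries.
Variable F : fieldType.
Local Notation ps := (pseries F).
Implicit Types f g h : ps.

Definition ps_add f g : ps := fun n => f n + g n.
Definition ps_opp f : ps := fun n => - f n.
Definition ps_mul f g : ps := fun n => \sum_(i < n.+1) f i * g (n - i)%N.
Definition ps_const (c : F) : ps := fun n => if n is 0%N then c else 0.

Lemma ps_addA : associative ps_add.
Proof. by move=> f g h; apply/funext => n; rewrite /ps_add addrA. Qed.
Lemma ps_addC : commutative ps_add.
Proof. by move=> f g; apply/funext => n; rewrite /ps_add addrC. Qed.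
Lemma ps_add0 : left_id (ps_const 0) ps_add.
Proof. by move=> f; apply/funext => -[|n]; rewrite /ps_add add0r. Qed.
Lemma ps_addN : left_inverse (ps_const 0) ps_opp ps_add.
Proof. by move=> f; apply/funext => -[|n]; rewrite /ps_add /ps_opp addNr. Qed.
HB.instance Definition _ :=
  GRing.isZmodule.Build ps ps_addA ps_addC ps_add0 ps_addN.

Definition ps_trunc N f : {poly F} := \poly_(i < N) f i.

Lemma coef_ps_trunc N f i : (i < N)%N -> (ps_trunc N f)`_i = f i.
Proof. by move=> iN; rewrite coef_poly iN. Qed.

Lemma ps_mul_trunc N f g n : (n < N)%N ->
  ps_mul f g n = (ps_trunc N f * ps_trunc N g)`_n.
Proof.
move=> nN; rewrite coefM; apply: eq_bigr => i _.
rewrite !coef_ps_trunc ?(leq_ltn_trans (leq_subr _ _) nN) //.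
by apply: leq_ltn_trans nN; rewrite -ltnS.
Qed.

Lemma ps_mulC : commutative ps_mul.
Proof.
by move=> f g; apply/funext => n; rewrite !(@ps_mul_trunc n.+1) // mulrC.
Qed.

Lemma coefM_eq (p p' r r' : {poly F}) n :
  (forall i, (i <= n)%N -> p`_i = p'`_i) ->
  (forall i, (i <= n)%N -> r`_i = r'`_i) -> (p * r)`_n = (p' * r')`_n.
Proof.
move=> Hp Hr; rewrite !coefM; apply: eq_bigr => i _.
by rewrite Hp ?Hr ?leq_subr // -ltnS.
Qed.

(** Coefficient [n] of a product involves only the terms up to [n], so the identity is read off in
    the polynomial ring after truncation. *)
Lemma ps_mulA : associative ps_mul.
Proof.
move=> f g h; apply/funext => n; rewrite !(@ps_mul_trunc n.+1) //.
transitivity ((ps_trunc n.+1 f * (ps_trunc n.+1 g * ps_trunc n.+1 h))`_n).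
  apply: coefM_eq => // i ni; rewrite coef_ps_trunc //.
  by rewrite (@ps_mul_trunc n.+1).
rewrite mulrA; apply: coefM_eq => // i ni; rewrite coef_ps_trunc //.
by rewrite (@ps_mul_trunc n.+1).
Qed.

Lemma ps_mul1 : left_id (ps_const 1) ps_mul.
Proof.
move=> f; apply/funext => n; rewrite /ps_mul big_ord_recl /= mul1r subn0.
by rewrite big1 ?addr0 // => i _; rewrite mul0r.
Qed.

Lemma ps_mulDl : left_distributive ps_mul ps_add.
Proof.
move=> f g h; apply/funext => n; rewrite /ps_mul /ps_add -big_split.
by apply: eq_bigr => i _; rewrite mulrDl.
Qed.

Lemma ps_1neq0 : ps_const 1 != 0 :> ps.
Proof.
apply/eqP => /(congr1 (fun f : ps => f 0%N)) /= /eqP.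
by rewrite oner_eq0.
Qed.

HB.instance Definition _ := GRing.Zmodule_isComNzRing.Build ps
  ps_mulA ps_mulC ps_mul1 ps_mulDl ps_1neq0.

Definition ps_unit : pred ps := fun f => `[< exists g, g * f = 1 >].
Definition ps_inv f : ps :=
  match pselect (exists g, g * f = 1) with
  | left h => projT1 (cid h)
  | right _ => f
  end.

Lemma ps_mulVx : {in ps_unit, left_inverse 1 ps_inv *%R}.
Proof.
move=> f; rewrite unfold_in => /asboolP H; rewrite /ps_inv.
by case: pselect => // h; case: cid.
Qed.
Lemma ps_unitP f g : g * f = 1 -> ps_unit f.
Proof. by move=> H; apply/asboolP; exists g. Qed.
Lemma ps_inv_out : {in [predC ps_unit], ps_inv =1 id}.
Proof.
move=> f; rewrite inE /= unfold_in => /asboolP H; rewrite /ps_inv.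
by case: pselect.
Qed.
HB.instance Definition _ := GRing.ComNzRing_hasMulInverse.Build ps
  ps_mulVx ps_unitP ps_inv_out.

Lemma psM f g n : (f * g) n = \sum_(i < n.+1) f i * g (n - i)%N.
Proof. by []. Qed.
Lemma ps0 n : (0 : ps) n = 0. Proof. by case: n. Qed.

Lemma ps_neq0 f : f != 0 -> exists n, f n != 0.
Proof.
apply: contra_neqP => /forallNP H; apply/funext => n; rewrite ps0.
by apply/eqP/negPn/negP; apply: H.
Qed.

Lemma psM_low f g i j : (forall k, (k < i)%N -> f k = 0) ->
  (forall k, (k < j)%N -> g k = 0) -> (f * g) (i + j)%N = f i * g j.
Proof.
move=> Hf Hg; have ilt : (i < (i + j).+1)%N by rewrite ltnS leq_addr.
rewrite psM (bigD1 (Ordinal ilt)) //= addKn big1 ?addr0 // => k Hk.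
case: (ltngtP k i) => [ki|ki|ki]; first by rewrite Hf ?mul0r.
  by rewrite Hg ?mulr0 //; have := ltn_ord k; lia.
by case/eqP: Hk; apply: val_inj.
Qed.

Lemma ps_idomain (f g : ps) : f * g = 0 -> (f == 0) || (g == 0).
Proof.
move=> fg0; apply/norP => -[/ps_neq0 Hf /ps_neq0 Hg].
case: (ex_minnP Hf) => i fi Hi; case: (ex_minnP Hg) => j gj Hj.
have := @psM_low f g i j.
rewrite fg0 ps0 => /(_ _ _)/esym/eqP; rewrite mulf_eq0 (negPf fi) (negPf gj) => H.
suff: false by [].
apply: H => k Hk; apply/eqP; apply: contraTT Hk; rewrite -leqNgt; by [apply: Hi|apply: Hj].
Qed.
HB.instance Definition _ := GRing.ComUnitRing_isIntegral.Build ps ps_idomain.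

Definition psX : ps := fun n => (n == 1%N)%:R.

Lemma psXnM k f n : (psX ^+ k * f) n = if (n < k)%N then 0 else f (n - k)%N.
Proof.
elim: k n => [|k IH] n; first by rewrite mul1r subn0.
rewrite exprS -mulrA psM.
case: n => [|n].
  by rewrite big_ord1 /= mul0r.
rewrite big_ord_recl mul0r add0r big_ord_recl /= mul1r big1 ?addr0.
  by rewrite subn1 IH.
by move=> i _; rewrite mul0r.
Qed.

Lemma psX_neq0 : psX != 0.
Proof.
apply/eqP => /(congr1 (fun f : ps => f 1%N)) /= /eqP; by rewrite oner_eq0.
Qed.

Lemma ps_invl f : f 0%N != 0 -> f * (fun n => nth 0 (invl f n) n : F) = 1 :> ps.
Proof.
move=> f0.
have sr m : size (invl f m) = m.+1 by elim: m => //= m IH; rewrite size_rcons IH.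
(* Each list [invl f m] extends the earlier ones, so coefficient [j] may be read in any later
   list. *)
have nr m j : (j <= m)%N -> nth 0 (invl f m) j = nth 0 (invl f j) j.
  elim: m => [|m IH]; first by case: j.
  rewrite leq_eqVlt => /orP[/eqP->//|]; rewrite ltnS => jm.
  by rewrite /= nth_rcons sr ltnS jm IH.
apply/funext => -[|m].
  by rewrite psM big_ord1 /= mulfV.
rewrite psM big_ord_recl subn0 /= nth_rcons sr ltnn eqxx mulrA mulrN mulfV // mulN1r.
apply/eqP; rewrite addrC subr_eq0; apply/eqP/eq_bigr => i _ /=.
by rewrite /bump /= subSS [in RHS]nr // leq_subr.
Qed.

End PSeries.

(** * The field k_oo as fractions of power series *)

Lemma tofrac_div (D : idomainType) (z : {fraction D}) :
  exists f g : D, g != 0 /\ z = tofrac f / tofrac g.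
Proof.
elim/quotW: z => -[[f g] /= g0]; exists f, g; split=> //.
apply: (canRL (mulfK _)); first by rewrite tofrac_eq0.
apply/eqP; rewrite !piE /FracField.equivf /FracField.mulf.
have H1 := oner_neq0 D; have Hg : g * 1 != 0 by rewrite mulf_neq0.
by rewrite !numden_Ratio //= !mulr1 mulrC.
Qed.

(* Fractions of power series in 1/T; [l2k] below maps the series of the statement onto this field. *)
Definition kinf (F : fieldType) : Type := {fraction (pseries F)}.
HB.instance Definition _ (F : fieldType) := GRing.Field.on (kinf F).

Section Kinf.
Variable F : fieldType.
Local Notation ps := (pseries F).
Local Notation K := (kinf F).

Definition ps2k (f : ps) : K := tofrac f.
HB.instance Definition _ := GRing.RMorphism.copy ps2k (@tofrac ps).

Lemma ps2k_inj : injective ps2k.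
Proof. by move=> f g /eqP; rewrite /ps2k tofrac_eq => /eqP. Qed.

Definition kT : K := (ps2k (psX F))^-1.

Lemma kT_neq0 : kT != 0.
Proof. by rewrite invr_eq0 /ps2k tofrac_eq0 psX_neq0. Qed.

Definition l2k (x : laurent F) : K := kT ^ (ltop x) * ps2k (lser x).

Lemma kT_shift (k : nat) f : ps2k f = kT ^ k%:Z * ps2k (psX F ^+ k * f).
Proof.
rewrite rmorphM rmorphXn mulrA /kT -exprnP exprVn mulVf ?mul1r //.
by rewrite expf_neq0 // /ps2k tofrac_eq0 psX_neq0.
Qed.

Lemma l2k_shift (x : laurent F) (M : int) : ltop x <= M ->
  l2k x = kT ^ M * ps2k (fun j => tcoef x (M - j%:Z)).
Proof.
case: x => t s /= tM; rewrite /l2k /=.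
have [k ->] : exists k : nat, M = t + k%:Z by exists `|M - t|%N; lia.
rewrite expfzDr ?kT_neq0 // -mulrA; congr (_ * _).
rewrite (kT_shift k); congr (_ * ps2k _); apply/funext => j.
rewrite psXnM /tcoef /=; case: ltnP => jk.
  by have -> : t - (t + k%:Z - j%:Z) = Negz (k - j).-1 by lia.
by have -> : t - (t + k%:Z - j%:Z) = Posz (j - k) by lia.
Qed.

(** With the common leading exponent [M] the power series coefficients of both records are values of
    [tcoef]. Equality of coefficients thus becomes equality in the field. *)
Lemma l2kP x y : l2k x = l2k y <-> lequiv x y.
Proof.
pose M := Num.max (ltop x) (ltop y).
have xM : ltop x <= M by rewrite le_max lexx.
have yM : ltop y <= M by rewrite le_max lexx orbT.
rewrite (l2k_shift xM) (l2k_shift yM); split=> [/mulfI H i|H].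
  have /ps2k_inj/(congr1 (fun f : ps => f `|M - i|%N)) := H (expfz_neq0 _ kT_neq0).
  case: (lerP i M) => iM; first by rewrite gez0_abs ?subr_ge0 // subKr.
  move=> _; rewrite /tcoef.
  have -> : ltop x - i = Negz (`|ltop x - i|.-1) by lia.
  by have -> : ltop y - i = Negz (`|ltop y - i|.-1) by lia.
by congr (_ * ps2k _); apply/funext => j; rewrite H.
Qed.

(** A nonzero denominator is a power of [psX] times a series with nonzero constant term, and the
    latter is invertible by [ps_invl]. *)
Lemma krep_ex (z : K) : exists x, l2k x = z.
Proof.
have [-> |z0] := eqVneq z 0.
  by exists (Laurent 0 (0 : ps)); rewrite /l2k /= rmorph0 mulr0.
have lowfac (f : ps) : f != 0 -> exists n (g : ps), f = psX F ^+ n * g /\ g 0%N != 0.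
  move=> /ps_neq0 H; case: (ex_minnP H) => n fn Hn.
  exists n, (fun j => f (n + j)%N); split; last by rewrite addn0.
  apply/funext => j; rewrite psXnM; case: ltnP => jn; last by rewrite subnKC.
  by apply/eqP; apply: contraTT jn; rewrite -leqNgt; apply: Hn.
have [f [g [g0 Hz]]] : exists f g : ps, g != 0 /\ z = ps2k f / ps2k g by exact: tofrac_div.
have [n [g' [Hg g'0]]] := lowfac _ g0.
pose h : ps := fun n => nth 0 (invl g' n) n; have hg := ps_invl g'0.
exists (Laurent n%:Z (f * h)); rewrite /l2k /= Hz Hg !rmorphM rmorphXn invfM.
have -> : (ps2k g')^-1 = ps2k h.
  apply: (@mulfI _ (ps2k g')); first by rewrite /ps2k tofrac_eq0; apply: contraNneq g'0 => ->.
  by rewrite -rmorphM hg rmorph1 mulfV // /ps2k tofrac_eq0; apply: contraNneq g'0 => ->.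
by rewrite /kT -exprnP exprVn mulrCA.
Qed.

Definition krep z : laurent F := projT1 (cid (krep_ex z)).
Lemma krepK z : l2k (krep z) = z. Proof. by rewrite /krep; case: cid. Qed.

Definition kcoef (z : K) (i : int) : F := tcoef (krep z) i.

Lemma kcoef_l2k x i : kcoef (l2k x) i = tcoef x i.
Proof. by apply: (l2kP _ _).1; rewrite krepK. Qed.

Lemma kcoef_inj z w : (forall i, kcoef z i = kcoef w i) -> z = w.
Proof.
by rewrite -(krepK z) -(krepK w) => H; apply/l2kP => i; have := H i; rewrite !kcoef_l2k.
Qed.

Lemma l2kM x y : l2k (lmul x y) = l2k x * l2k y.
Proof.
rewrite /l2k /= expfzDr ?kT_neq0 // mulrACA -rmorphM; congr (_ * ps2k _).
Qed.

Lemma l2kD x y : l2k (ladd x y) = l2k x + l2k y.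
Proof.
have xM : ltop x <= Num.max (ltop x) (ltop y) by rewrite le_max lexx.
have yM : ltop y <= Num.max (ltop x) (ltop y) by rewrite le_max lexx orbT.
by rewrite (l2k_shift xM) (l2k_shift yM) -mulrDr -rmorphD.
Qed.

Lemma l2kN x : l2k (lneg x) = - l2k x.
Proof. by rewrite /l2k /= -mulrN -rmorphN. Qed.

Lemma l2kB x y : l2k (lsub x y) = l2k x - l2k y.
Proof. by rewrite l2kD l2kN. Qed.

Lemma tcoef_top (t : int) s (i : nat) : tcoef (@Laurent F t s) (t - i%:Z) = s i.
Proof. by rewrite /tcoef /= subKr. Qed.
Lemma tcoef_gt (x : laurent F) i : ltop x < i -> tcoef x i = 0.
Proof. by move=> H; rewrite /tcoef; have -> : ltop x - i = Negz (`|ltop x - i|.-1) by lia. Qed.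

Lemma kcoefD z w i : kcoef (z + w) i = kcoef z i + kcoef w i.
Proof.
rewrite -{1}(krepK z) -{1}(krepK w) -l2kD kcoef_l2k /kcoef.
set x := krep z; set y := krep w; rewrite /ladd.
case: (lerP i (Num.max (ltop x) (ltop y))) => iM.
  rewrite -{1}(subKr (Num.max (ltop x) (ltop y)) i).
  have -> : Num.max (ltop x) (ltop y) - i = `|Num.max (ltop x) (ltop y) - i|%N%:Z by lia.
  by rewrite tcoef_top !gez0_abs ?subr_ge0 // subKr.
rewrite tcoef_gt //.
by move: iM; rewrite gt_max => /andP[? ?]; rewrite !tcoef_gt // addr0.
Qed.

Lemma kcoef0 i : kcoef 0 i = 0.
Proof. by have /eqP := kcoefD 0 0 i; rewrite addr0 -subr_eq0 opprD addrA addrN sub0r oppr_eq0 => /eqP. Qed.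

Lemma kcoefN z i : kcoef (- z) i = - kcoef z i.
Proof. by apply/eqP; rewrite -addr_eq0 addrC -kcoefD subrr kcoef0. Qed.

Lemma kcoefB z w i : kcoef (z - w) i = kcoef z i - kcoef w i.
Proof. by rewrite kcoefD kcoefN. Qed.

Lemma kcoefTM z i (n : int) : kcoef (kT ^ n * z) i = kcoef z (i - n).
Proof.
rewrite -{1}(krepK z) /l2k mulrA -expfzDr ?kT_neq0 //.
rewrite -[_ * _]/(l2k (Laurent (n + ltop (krep z)) (lser (krep z)))) kcoef_l2k.
by rewrite /kcoef /tcoef /=; have -> : n + ltop (krep z) - i = ltop (krep z) - (i - n) by lia.
Qed.

(* |z| <= q^N and |z| = q^N. *)
Definition kdle (z : K) (N : int) : Prop := forall i, N < i -> kcoef z i = 0.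
Definition kdeq (z : K) (N : int) : Prop := kdle z N /\ kcoef z N != 0.

Lemma kdle_ser z N : kdle z N -> z = kT ^ N * ps2k (fun j => kcoef z (N - j%:Z)).
Proof.
move=> H; rewrite -[RHS]/(l2k (Laurent N _)); apply: kcoef_inj => i.
rewrite kcoef_l2k; case: (lerP i N) => iN; last by rewrite H ?tcoef_gt.
rewrite -{2}(subKr N i); have -> : N - i = `|N - i|%N%:Z by lia.
by rewrite tcoef_top; congr (kcoef _ _); lia.
Qed.

Lemma kdleM z w N M : kdle z N -> kdle w M -> kdle (z * w) (N + M) /\
  kcoef (z * w) (N + M) = kcoef z N * kcoef w M.
Proof.
move=> Hz Hw; rewrite {1 2}(kdle_ser Hz) {1 2}(kdle_ser Hw).
rewrite mulrACA -expfzDr ?kT_neq0 // -rmorphM /=.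
set f : ps := (X in ps2k X).
have -> : kT ^ (N + M) * ps2k f = l2k (Laurent (N + M) f) by [].
split.
  by move=> i Hi; rewrite kcoef_l2k tcoef_gt.
rewrite kcoef_l2k -{2}[N + M]subr0 (tcoef_top _ _ 0) /f psM big_ord1 /= subn0.
by rewrite !subr0.
Qed.

Lemma kdle_le z N M : N <= M -> kdle z N -> kdle z M.
Proof. by move=> NM H i Mi; apply: H; apply: le_lt_trans Mi. Qed.
Lemma kdleD z w N : kdle z N -> kdle w N -> kdle (z + w) N.
Proof. by move=> Hz Hw i Hi; rewrite kcoefD Hz ?Hw ?addr0. Qed.
Lemma kdleN z N : kdle z N -> kdle (- z) N.
Proof. by move=> Hz i Hi; rewrite kcoefN Hz ?oppr0. Qed.
Lemma kdleB z w N : kdle z N -> kdle w N -> kdle (z - w) N.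
Proof. by move=> Hz Hw; apply: kdleD => //; apply: kdleN. Qed.
Lemma kdle0 N : kdle 0 N. Proof. by move=> i _; rewrite kcoef0. Qed.

Lemma kdeq_ex z : z != 0 -> exists N, kdeq z N.
Proof.
move=> z0; have /ps_neq0 H : lser (krep z) != 0 :> ps.
  by apply: contraNneq z0 => H; rewrite -(krepK z) /l2k H rmorph0 mulr0.
case: (ex_minnP H) => n fn Hn; exists (ltop (krep z) - n%:Z); split.
  move=> i Hi; rewrite /kcoef /tcoef; case E: (ltop (krep z) - i) => [k|//].
  have kn : (k < n)%N by lia.
  by apply/eqP; apply: contraTT kn; rewrite -leqNgt; apply: Hn.
by rewrite /kcoef; case: (krep z) fn {H Hn} => t s; rewrite tcoef_top.
Qed.

Lemma kdeq_neq0 z N : kdeq z N -> z != 0.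
Proof. by case=> _; apply: contraNneq => ->; rewrite kcoef0. Qed.

Lemma kdeq_dle z N M : kdeq z N -> kdle z M -> N <= M.
Proof.
case=> _ zN Hz; rewrite leNgt; apply/negP => NM.
by rewrite Hz ?eqxx in zN.
Qed.

Lemma kdeq_inj z N M : kdeq z N -> kdeq z M -> N = M.
Proof.
move=> HN HM; apply/eqP; rewrite eq_le.
by rewrite (kdeq_dle HN HM.1) (kdeq_dle HM HN.1).
Qed.

Lemma kdeqM z w N M : kdeq z N -> kdeq w M -> kdeq (z * w) (N + M).
Proof.
move=> [Hz z0] [Hw w0]; have [H1 H2] := kdleM Hz Hw.
by split=> //; rewrite H2 mulf_neq0.
Qed.

Lemma kdle_all0 z : (forall N : nat, kdle z (- N%:Z)) -> z = 0.
Proof.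
move=> H; apply/eqP; apply/negPn/negP => /kdeq_ex[N HN].
by have := kdeq_dle HN (H `|N|.+1); lia.
Qed.

Lemma kdle_mulI z w N M : kdeq w M -> kdle (z * w) (N + M) -> kdle z N.
Proof.
move=> Hw Hzw; have [-> |z0] := eqVneq z 0; first exact: kdle0.
have [P HP] := kdeq_ex z0.
apply: kdle_le HP.1; have := kdeq_dle (kdeqM HP Hw) Hzw; lia.
Qed.

Definition kconst (c : F) : K := ps2k (ps_const c).
Lemma kcoef_const c i : kcoef (kconst c) i = if i == 0 then c else 0.
Proof.
have -> : kconst c = l2k (Laurent 0 (ps_const c)) by rewrite /l2k /= expr0z mul1r.
rewrite kcoef_l2k /tcoef /= sub0r.
by case: i => [[|n]|n].
Qed.

Lemma kcoef_constM c z i : kcoef (kconst c * z) i = c * kcoef z i.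
Proof.
have [-> |c0] := eqVneq c 0.
  have E : kconst 0 = 0 by rewrite -(rmorph0 (@ps2k)); congr ps2k; apply/funext => -[].
  by rewrite E !mul0r kcoef0.
rewrite -{1}(krepK z) /l2k mulrCA -rmorphM.
rewrite -[_ * _]/(l2k (Laurent (ltop (krep z)) (ps_const c * (lser (krep z) : ps)))) kcoef_l2k.
rewrite /kcoef /tcoef /=; case: (ltop (krep z) - i) => [n|n]; last by rewrite mulr0.
rewrite psM big_ord_recl /= subn0 big1 ?addr0 // => j _.
by rewrite mul0r.
Qed.

Lemma kconst_additive : zmod_morphism kconst.
Proof.
by move=> a b; apply: kcoef_inj => i; rewrite kcoefB !kcoef_const; case: eqP => // _; rewrite subr0.
Qed.
Lemma kconst_monoid : monoid_morphism kconst.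
Proof.
split; first by rewrite /kconst; apply: rmorph1.
move=> a b; apply: kcoef_inj => i; rewrite kcoef_constM !kcoef_const.
by case: eqP => // _; rewrite mulr0.
Qed.
HB.instance Definition _ := GRing.isZmodMorphism.Build F K kconst kconst_additive.
HB.instance Definition _ := GRing.isMonoidMorphism.Build F K kconst kconst_monoid.

Lemma kT_comm : commr_rmorph kconst kT.
Proof. by move=> c; apply: mulrC. Qed.
Definition p2k : {poly F} -> K := horner_morph kT_comm.
HB.instance Definition _ := GRing.RMorphism.copy p2k (horner_morph kT_comm).

Lemma p2kC c : p2k c%:P = kconst c. Proof. exact: horner_morphC. Qed.
Lemma p2kX : p2k 'X = kT. Proof. exact: horner_morphX. Qed.

Lemma kcoef_p2k p (i : int) : kcoef (p2k p) i = if i is Posz n then p`_n else 0.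
Proof.
elim/poly_ind: p i => [|p c IH] i.
  by rewrite rmorph0 kcoef0; case: i => // n; rewrite coef0.
rewrite rmorphD rmorphM /= p2kC p2kX kcoefD kcoef_const mulrC -(expr1z kT) kcoefTM IH.
case: i => [[|n]|n] /=; last by rewrite addr0.
  by rewrite coefD coefMX coefC /= add0r.
by rewrite coefD coefMX coefC /= subn1 /= addr0.
Qed.

Lemma l2k_lpoly p : l2k (lpoly p) = p2k p.
Proof.
apply: kcoef_inj => i; rewrite kcoef_l2k kcoef_p2k /tcoef /=.
case: i => [n|n]; last first.
  have -> : (size p)%:Z - Negz n = Posz (size p + n.+1) by lia.
  by rewrite leqNgt -addSnnS ltn_addr.
case: (leqP n (size p)) => np.
  have -> : (size p)%:Z - n%:Z = (size p - n)%N%:Z by lia.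
  by rewrite leq_subr subKn.
have -> : (size p)%:Z - n%:Z = Negz (n - size p).-1 by lia.
by rewrite nth_default // ltnW.
Qed.

Lemma kdle_p2k p (N : nat) : kdle (p2k p) (N%:Z - 1) <-> (size p <= N)%N.
Proof.
split=> [H|H].
  apply/leq_sizeP => j Hj; have := H j; rewrite kcoef_p2k; apply; lia.
move=> [n|n] Hn; rewrite kcoef_p2k //.
have Hs : (size p <= n)%N by apply: leq_trans H _; lia.
by rewrite nth_default.
Qed.

Lemma kdle_p2k_neg p : kdle (p2k p) (-1) -> p = 0.
Proof. by move=> /(@kdle_p2k p 0)/[!leqn0]; rewrite size_poly_eq0 => /eqP. Qed.

Lemma kdeq_p2k p : p != 0 -> kdeq (p2k p) (size p).-1%:Z.
Proof.
move=> p0; split; last by rewrite kcoef_p2k -lead_coefE lead_coef_eq0.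
have sp : (0 < size p)%N by rewrite size_poly_gt0.
have -> : (size p).-1%:Z = (size p)%:Z - 1 by lia.
exact/kdle_p2k.
Qed.

Lemma p2k_inj : injective p2k.
Proof.
move=> p r H; apply/polyP => i.
have := kcoef_p2k p i%:Z; rewrite H kcoef_p2k => ->//.
Qed.

Lemma kfloor_ex z : exists p, kdle (z - p2k p) (-1).
Proof.
have [N HN] : exists N : nat, kdle z N%:Z.
  have [-> |/kdeq_ex[N [H _]]] := eqVneq z 0; first by exists 0%N; apply: kdle0.
  by exists `|N|%N; apply: kdle_le H; lia.
exists (\poly_(i < N.+1) kcoef z i%:Z) => i Hi.
have [n ->] : exists n : nat, i = n by exists `|i|%N; lia.
rewrite kcoefB kcoef_p2k coef_poly; case: ltnP => nN; first by rewrite subrr.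
by rewrite HN ?subr0.
Qed.

Definition kfloor z : {poly F} := projT1 (cid (kfloor_ex z)).
Lemma kfloorP z : kdle (z - p2k (kfloor z)) (-1).
Proof. by rewrite /kfloor; case: cid. Qed.

Definition kres z : F := kcoef z (-1).

(** The residue of [T^i z] is the coefficient of [T^(-1-i)] in [z], so the hypothesis kills the
    first [m] coefficients of the fractional part. *)
Lemma kdle_res z (m : nat) : (forall i, (i < m)%N -> kres (p2k 'X^i * z) = 0) ->
  kdle (z - p2k (kfloor z)) (- m%:Z - 1).
Proof.
move=> H i Hi; case: (ltP (-1) i) => i1; first exact: kfloorP.
rewrite kcoefB kcoef_p2k.
have [j Ej] : exists j : nat, i = - 1 - j%:Z by exists `|(i + 1)%R|%N; lia.
have := H j; rewrite rmorphXn /= p2kX exprnP /kres kcoefTM -Ej => -> //; last lia.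
rewrite Ej; have -> : - 1 - j%:Z = Negz j by lia.
by rewrite subr0.
Qed.

Lemma l2kV x : l2k (linv x) = (l2k x)^-1.
Proof.
rewrite /linv; case: pselect => [h|h]; last first.
  have s0 : lser x = 0 :> ps.
    apply/funext => n; rewrite ps0; apply/eqP/negPn/negP => H.
    by apply: h; exists n.
  rewrite /l2k /= s0 rmorph0 mulr0 invr0.
  have -> : (fun=> 0) = 0 :> ps by apply/funext => n; rewrite ps0.
  by rewrite rmorph0 mulr0.
set j0 := ex_minn h; case: (ex_minnP h) @j0 => j0 fj Hj.
set a : ps := fun n => lser x (j0 + n)%N.
have a0 : a 0%N != 0 by rewrite /a addn0.
have xE : lser x = psX F ^+ j0 * a :> ps.
  apply/funext => j; rewrite psXnM; case: ltnP => jn; last by rewrite /a subnKC.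
  by apply/eqP; apply: contraTT jn; rewrite -leqNgt; apply: Hj.
have Ha := ps_invl a0.
apply: (@mulIf _ (l2k x)).
  rewrite /l2k mulf_neq0 ?expfz_neq0 ?kT_neq0 // xE rmorphM rmorphXn.
  rewrite mulf_neq0 // /ps2k ?expf_neq0 ?tofrac_eq0 ?psX_neq0 //.
  by apply: contraNneq a0 => ->; rewrite ps0.
rewrite mulVf; last first.
  rewrite /l2k mulf_neq0 ?expfz_neq0 ?kT_neq0 // xE rmorphM rmorphXn.
  rewrite mulf_neq0 // /ps2k ?expf_neq0 ?tofrac_eq0 ?psX_neq0 //.
  by apply: contraNneq a0 => ->; rewrite ps0.
rewrite /l2k /= -/a mulrACA -expfzDr ?kT_neq0 // subrK -rmorphM xE.
rewrite mulrCA (mulrC _ a).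
transitivity (kT ^ j0%:Z * ps2k (psX F ^+ j0 * 1)); first by congr (_ * ps2k (_ * _)); exact: Ha.
rewrite mulr1 rmorphXn /kT -exprnP exprVn mulVf //.
by rewrite expf_neq0 // /ps2k tofrac_eq0 psX_neq0.
Qed.

Lemma l2k_div x y : l2k (ldiv x y) = l2k x / l2k y.
Proof. by rewrite l2kM l2kV. Qed.

End Kinf.

Lemma absv_le (R : realType) (F : finFieldType) (x : laurent F) (N : int) :
  kdle (l2k x) N -> absv R x <= (#|F|%:R : R) `^ (N%:~R).
Proof.
move=> H; rewrite /absv; case: pselect => [h|_]; last exact: powR_ge0.
case: ex_minnP => j fj _.
apply: ler_powR; first by rewrite ler1n (ltnW (card_finNzRing_gt1 F)).
rewrite ler_int leNgt; apply/negP => NM; move: fj.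
have := H _ NM; rewrite kcoef_l2k; case: x {H h NM} => t s /=; rewrite tcoef_top => ->.
by rewrite eqxx.
Qed.

Lemma absv_deq (R : realType) (F : finFieldType) (x : laurent F) (N : int) :
  kdeq (l2k x) N -> absv R x = (#|F|%:R : R) `^ (N%:~R).
Proof.
move=> [H1 H2]; have H3 : forall i, (N < i)%R -> tcoef x i = 0.
  by move=> i /H1; rewrite kcoef_l2k.
move: H2; rewrite kcoef_l2k => H2.
have Ex : exists j, lser x j != 0 /\ ltop x - j%:Z = N.
  move: H2; rewrite /tcoef; case E: (ltop x - N) => [j|j]; last by rewrite eqxx.
  by move=> Hj; exists j; split=> //; rewrite -E; lia.
rewrite /absv; case: pselect => [h|[]]; last by case: Ex => j [? _]; exists j.
case: ex_minnP => j fj Hj; congr (_ `^ (_ %:~R)).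
case: Ex => k [fk Ek]; have jk := Hj _ fk.
apply/eqP; rewrite eq_le; apply/andP; split; last lia.
rewrite leNgt; apply/negP => /H3; case: x fj {H1 H2 H3 h Hj fk Ek} => t s /=.
by rewrite tcoef_top => fj0 /eqP; rewrite (negPf fj0).
Qed.

(** * The quadratic ring *)

(** The phantom argument [d] lets the product type carry a different multiplication for each [d]. *)
Definition quad (F : fieldType) (d : {poly F}) : Type := ({poly F} * {poly F})%type.

Section QuadRing.
Variables (F : fieldType) (d : {poly F}).
Local Notation A := (quad d).

HB.instance Definition _ := GRing.Zmodule.copy A ({poly F} * {poly F})%type.

Definition quad_one : A := (1, 0).
Definition quad_mul (x y : A) : A := Amul d x y.

Lemma quad_eqP (x y : A) : x.1 = y.1 -> x.2 = y.2 -> x = y.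
Proof. by case: x => a b; case: y => a' b' /= -> ->. Qed.

Lemma quad_mulA : associative quad_mul.
Proof. by move=> x y z; apply: quad_eqP => /=; ring. Qed.
Lemma quad_mulC : commutative quad_mul.
Proof. by move=> x y; apply: quad_eqP => /=; ring. Qed.
Lemma quad_mul1 : left_id quad_one quad_mul.
Proof. by move=> x; apply: quad_eqP => /=; ring. Qed.
Lemma quad_mulDl : left_distributive quad_mul +%R.
Proof.
by move=> x y z; apply: quad_eqP => /=; ring.
Qed.
Lemma quad_1neq0 : quad_one != 0.
Proof. by apply/eqP => -[] /eqP; rewrite oner_eq0. Qed.

HB.instance Definition _ := GRing.Zmodule_isComNzRing.Build A
  quad_mulA quad_mulC quad_mul1 quad_mulDl quad_1neq0.

Lemma quadM (x y : A) : x * y = (x.1 * y.1 + x.2 * y.2 * d, x.1 * y.2 + x.2 * y.1).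
Proof. by []. Qed.

Definition qC (c : F) : A := (c%:P, 0).
Lemma qC_zmod : zmod_morphism qC.
Proof. by move=> a b; apply: quad_eqP => /=; rewrite ?rmorphB ?subr0. Qed.
Lemma qC_monoid : monoid_morphism qC.
Proof. by split=> // a b; apply: quad_eqP => /=; rewrite ?rmorphM /=; ring. Qed.
HB.instance Definition _ := GRing.isZmodMorphism.Build F A qC qC_zmod.
HB.instance Definition _ := GRing.isMonoidMorphism.Build F A qC qC_monoid.

Lemma qCM c x : qC c * x = (c *: x.1, c *: x.2).
Proof. by apply: quad_eqP => /=; rewrite -?mul_polyC; ring. Qed.
End QuadRing.

(** Bundles the hypotheses; [rqD], half the degree of [d], is the degree of the square root
    [rqS]. *)
Record realquad := RealQuad {
  rqF : finFieldType;
  rqd : {poly rqF};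
  rqS : kinf rqF;
  rqD : nat;
  rq_odd : odd #|rqF|;
  rqD_gt0 : (0 < rqD)%N;
  rq_size : size rqd = rqD.*2.+1;
  rq_sqf : squarefree rqd;
  rq_sq : rqS * rqS = p2k rqd;
  rq_ufd : AUFD rqd }.

Section Quad.
Variable Q : realquad.
Local Notation F := (rqF Q).
Local Notation d := (rqd Q).
Local Notation S := (rqS Q).
Local Notation D := (rqD Q).
Local Notation A := (quad d).
Local Notation K := (kinf F).
Implicit Types n m : A.

Definition sg1 n : K := p2k n.1 + p2k n.2 * S.
Definition sg2 n : K := p2k n.1 - p2k n.2 * S.

Lemma sg1_zmod : zmod_morphism sg1.
Proof. by move=> x y; rewrite /sg1 /= !rmorphB; ring. Qed.
Lemma sg1_monoid : monoid_morphism sg1.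
Proof.
split; first by rewrite /sg1 /= rmorph1 rmorph0 mul0r addr0.
move=> x y; rewrite /sg1 quadM /= !rmorphD !rmorphM /= -rq_sq; ring.
Qed.
HB.instance Definition _ := GRing.isZmodMorphism.Build A K sg1 sg1_zmod.
HB.instance Definition _ := GRing.isMonoidMorphism.Build A K sg1 sg1_monoid.
Lemma sg2_zmod : zmod_morphism sg2.
Proof. by move=> x y; rewrite /sg2 /= !rmorphB; ring. Qed.
Lemma sg2_monoid : monoid_morphism sg2.
Proof.
split; first by rewrite /sg2 /= rmorph1 rmorph0 mul0r subr0.
move=> x y; rewrite /sg2 quadM /= !rmorphD !rmorphM /= -rq_sq; ring.
Qed.
HB.instance Definition _ := GRing.isZmodMorphism.Build A K sg2 sg2_zmod.
HB.instance Definition _ := GRing.isMonoidMorphism.Build A K sg2 sg2_monoid.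

Definition qconj n : A := (n.1, - n.2).
Definition nrm n : {poly F} := n.1 ^+ 2 - n.2 ^+ 2 * d.

Lemma sg1_conj n : sg1 (qconj n) = sg2 n.
Proof. by rewrite /sg1 /sg2 /= rmorphN mulNr. Qed.
Lemma sg2_conj n : sg2 (qconj n) = sg1 n.
Proof. by rewrite /sg1 /sg2 /= rmorphN mulNr opprK. Qed.
Lemma qconjK : involutive qconj.
Proof. by move=> n; apply: quad_eqP => //=; rewrite opprK. Qed.

Lemma mul_conj n : n * qconj n = (nrm n, 0).
Proof. by apply: quad_eqP => /=; rewrite /nrm; ring. Qed.

Lemma sg12 n : sg1 n * sg2 n = p2k (nrm n).
Proof. by rewrite /sg1 /sg2 /nrm !expr2 rmorphB !rmorphM /= -rq_sq; ring. Qed.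

Lemma nrmM n m : nrm (n * m) = nrm n * nrm m.
Proof. by apply: p2k_inj; rewrite [RHS]rmorphM /= -!sg12 !rmorphM /= mulrACA. Qed.

(** [d] is not a square in [k]: after removing the gcd, [a'^2 = b'^2 d] with [a'], [b'] coprime
    makes [a'^2] divide [d], so [a'] is constant by squarefreeness, which contradicts the positive
    degree of [d]. *)
Lemma nrm_neq0 n : n != 0 -> nrm n != 0.
Proof.
apply: contra_neq => /eqP; rewrite /nrm subr_eq0 => /eqP.
case: n => a b /= H.
have [b0|b0] := eqVneq b 0.
  by move: H; rewrite b0 expr0n mul0r => /eqP; rewrite expf_eq0 => /eqP ->.
exfalso; pose g := gcdp a b.
have g0 : g != 0 by rewrite gcdp_eq0 negb_and b0 orbT.
have Ha : a = a %/ g * g by rewrite divpK ?dvdp_gcdl.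
have Hb : b = b %/ g * g by rewrite divpK ?dvdp_gcdr.
have cop : coprimep (a %/ g) (b %/ g) by rewrite coprimep_div_gcd ?b0 ?orbT.
set a' : {poly F} := a %/ g in Ha cop; set b' : {poly F} := b %/ g in Hb cop.
have E : a' ^+ 2 = b' ^+ 2 * d.
  apply: (@mulIf _ (g ^+ 2)); first by rewrite expf_neq0.
  by rewrite -exprMn -Ha H {1}Hb; ring.
have b'0 : b' != 0 by apply: contraNneq b0 => b'0; rewrite Hb b'0 mul0r.
have dv : a' * a' %| d.
  rewrite -(@Gauss_dvdpr _ _ (b' ^+ 2)); first by rewrite -E expr2.
  by rewrite -expr2 coprimep_expr // coprimep_expl.
have sa := rq_sqf dv.
have : (size (b' ^+ 2 * d)%R <= 1)%N.
  rewrite -E expr2; apply: leq_trans (size_polyMleq _ _) _; move: sa; case: (size a') => [|[|?]] //.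
have d0 : d != 0 by rewrite -size_poly_eq0 rq_size.
rewrite size_mul ?expf_neq0 // rq_size.
have : (0 < size (b' ^+ 2)%R)%N by rewrite size_poly_gt0 expf_neq0.
have := rqD_gt0 Q; lia.
Qed.

Lemma nrm0 : nrm 0 = 0. Proof. by rewrite /nrm /= expr0n mul0r subr0. Qed.

Lemma quad_mulf_neq0 n m : n != 0 -> m != 0 -> n * m != 0.
Proof.
move=> /nrm_neq0 n0 /nrm_neq0 m0; have := mulf_neq0 n0 m0.
by rewrite -nrmM; apply: contra_neq => ->; rewrite nrm0.
Qed.

Lemma quad_mulfI n m m' : n != 0 -> n * m = n * m' -> m = m'.
Proof.
move=> n0 /eqP; rewrite -subr_eq0 -mulrBr => /eqP H; apply/eqP; rewrite -subr_eq0.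
by apply/negPn/negP => /(quad_mulf_neq0 n0); rewrite H eqxx.
Qed.

Lemma sg1_neq0 n : n != 0 -> sg1 n != 0.
Proof.
move=> /nrm_neq0; apply: contraNneq => H.
by apply/eqP/p2k_inj; rewrite -sg12 H mul0r rmorph0.
Qed.
Lemma sg2_neq0 n : n != 0 -> sg2 n != 0.
Proof.
move=> /nrm_neq0; apply: contraNneq => H.
by apply/eqP/p2k_inj; rewrite -sg12 H mulr0 rmorph0.
Qed.

(* The degree, with the junk value 0 at 0. *)
Definition kdeg (z : K) : int :=
  match pselect (z != 0) with left h => projT1 (cid (kdeq_ex h)) | right _ => 0 end.
Lemma kdegP z : z != 0 -> kdeq z (kdeg z).
Proof. by move=> z0; rewrite /kdeg; case: pselect => // h; case: cid. Qed.
Lemma kdegE z N : kdeq z N -> kdeg z = N.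
Proof. by move=> H; have H0 := kdeq_neq0 H; exact: (kdeq_inj (kdegP H0) H). Qed.

Definition v1 n := kdeg (sg1 n).
Definition v2 n := kdeg (sg2 n).
Definition dg n : nat := (size (nrm n)).-1.

Lemma v1E n N : kdeq (sg1 n) N -> v1 n = N. Proof. exact: kdegE. Qed.
Lemma v2E n N : kdeq (sg2 n) N -> v2 n = N. Proof. exact: kdegE. Qed.
Lemma v1P n : n != 0 -> kdeq (sg1 n) (v1 n).
Proof. by move/sg1_neq0/kdegP. Qed.
Lemma v2P n : n != 0 -> kdeq (sg2 n) (v2 n).
Proof. by move/sg2_neq0/kdegP. Qed.
Lemma v1M n m : n != 0 -> m != 0 -> v1 (n * m) = v1 n + v1 m.
Proof.
move=> Hn Hm; have H := kdeqM (v1P Hn) (v1P Hm).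
by apply: kdegE; rewrite -rmorphM in H.
Qed.
Lemma v2M n m : n != 0 -> m != 0 -> v2 (n * m) = v2 n + v2 m.
Proof.
move=> Hn Hm; have H := kdeqM (v2P Hn) (v2P Hm).
by apply: kdegE; rewrite -rmorphM in H.
Qed.
Lemma v12 n : n != 0 -> v1 n + v2 n = dg n.
Proof.
move=> n0; have := kdeqM (v1P n0) (v2P n0); rewrite sg12 => H.
exact: kdeq_inj H (kdeq_p2k (nrm_neq0 n0)).
Qed.

Lemma dgM n m : n != 0 -> m != 0 -> dg (n * m) = (dg n + dg m)%N.
Proof.
move=> n0 m0; have := v12 (quad_mulf_neq0 n0 m0); rewrite v1M ?v2M //.
have := v12 n0; have := v12 m0; lia.
Qed.

(** The norm of a nonzero element is a nonzero polynomial, hence of degree at least 0. This is the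
    discreteness of [A] in [k_oo^2], on which counting and the comparison of approximations rest. *)
Lemma kdle_small n N M : kdle (sg1 n) N -> kdle (sg2 n) M -> N + M < 0 -> n = 0.
Proof.
move=> H1 H2 NM; apply/eqP/negPn/negP => n0.
have := kdeq_dle (v1P n0) H1; have := kdeq_dle (v2P n0) H2; have := v12 n0; lia.
Qed.

(** Otherwise 1 would have additive order 2, which cannot divide the odd number [#|F|]. *)
Lemma twoF_neq0 : (2%:R : F) != 0.
Proof.
apply/eqP => two0; suff: ~~ odd #|F| by rewrite rq_odd.
rewrite -dvdn2 -cardsT.
have o2 : (#[1%R : F]%g %| 2)%N by rewrite order_dvdn FinRing.zmodXgE two0.
have : #[1%R : F]%g != 1%N by rewrite order_eq1; apply/eqP => /eqP; rewrite oner_eq0.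
move=> o1; have <- : #[1%R : F]%g = 2%N.
  by have := dvdn_leq (ltn0Sn 1) o2; have := order_gt0 (1%R : F); case: #[_]%g o1 => [|[|[]]].
by rewrite (@order_dvdG _ [set: F]%G) ?inE.
Qed.

Lemma nrm_size n : n != 0 -> size (nrm n) = (dg n).+1.
Proof. by move=> /nrm_neq0; rewrite -size_poly_gt0 /dg; case: size. Qed.

Lemma qS_deq : kdeq S D%:Z.
Proof.
have d0 : d != 0 by rewrite -size_poly_eq0 rq_size.
have := kdeq_p2k d0; rewrite rq_size -rq_sq => Hd.
have S0 : S != 0 by apply: contraTneq (kdeq_neq0 Hd) => ->; rewrite mul0r eqxx.
have [N HN] := kdeq_ex S0; have := kdeq_inj (kdeqM HN HN) Hd => E.
suff -> : D%:Z = N by [].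
move: E => /=; lia.
Qed.
End Quad.
#[global] Opaque v1 v2 kdeg dg.

(** * Boxes and shapes *)

Section Boxes.
Variable Q : realquad.
Local Notation F := (rqF Q).
Local Notation d := (rqd Q).
Local Notation S := (rqS Q).
Local Notation D := (rqD Q).
Local Notation A := (quad d).
Local Notation K := (kinf F).
Local Notation q := #|F|.
Implicit Types n m : A.

Lemma sg1M n m : sg1 (n * m) = sg1 n * sg1 m. Proof. exact: (rmorphM (@sg1 Q)). Qed.
Lemma sg2M n m : sg2 (n * m) = sg2 n * sg2 m. Proof. exact: (rmorphM (@sg2 Q)). Qed.
Lemma sg1D n m : sg1 (n + m) = sg1 n + sg1 m. Proof. exact: (rmorphD (@sg1 Q)). Qed.
Lemma sg2D n m : sg2 (n + m) = sg2 n + sg2 m. Proof. exact: (rmorphD (@sg2 Q)). Qed.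
Lemma sg1B n m : sg1 (n - m) = sg1 n - sg1 m. Proof. exact: (rmorphB (@sg1 Q)). Qed.
Lemma sg2B n m : sg2 (n - m) = sg2 n - sg2 m. Proof. exact: (rmorphB (@sg2 Q)). Qed.
Lemma sg1_0 : sg1 (0 : A) = 0. Proof. exact: (rmorph0 (@sg1 Q)). Qed.
Lemma sg2_0 : sg2 (0 : A) = 0. Proof. exact: (rmorph0 (@sg2 Q)). Qed.
Lemma sg1_C c : sg1 (qC d c) = kconst c.
Proof. by rewrite /sg1 /= rmorph0 mul0r addr0 p2kC. Qed.
Lemma sg2_C c : sg2 (qC d c) = kconst c.
Proof. by rewrite /sg2 /= rmorph0 mul0r subr0 p2kC. Qed.

Lemma kdle_scale (c : F) (z : K) N : kdle z N -> kdle (kconst c * z) N.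
Proof. by move=> H i Hi; rewrite kcoef_constM H ?mulr0. Qed.

(* Both |sigma_i n| < q^X; for X <= D the subtraction truncates, which forces n.2 = 0. *)
Definition inV (X : nat) n : bool := (size n.1 <= X)%N && (size n.2 <= X - D)%N.

(** [a] and [b sqrt d] are half the sum and half the difference of the conjugates, so in odd
    characteristic bounds on both conjugates bound both coordinates. *)
Lemma inV_dle X n : inV X n <-> kdle (sg1 n) (X%:Z - 1) /\ kdle (sg2 n) (X%:Z - 1).
Proof.
split=> [/andP[/kdle_p2k H1 H2]|[H1 H2]].
  have H3 : kdle (p2k n.2 * S) (X%:Z - 1).
    case: (leqP X D) => XD.
      have -> : n.2 = 0 by apply/eqP; rewrite -size_poly_eq0; lia.
      by rewrite rmorph0 mul0r; apply: kdle0.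
    have /kdle_p2k H4 := H2.
    by apply: kdle_le (kdleM H4 (qS_deq Q).1).1; lia.
  by split; [apply: kdleD|apply: kdleB].
have half (z : K) : kdle (z + z) (X%:Z - 1) -> kdle z (X%:Z - 1).
  move=> H i /H; rewrite kcoefD => /eqP; rewrite -mulr2n -mulr_natl mulf_eq0.
  by case/orP=> /eqP // E; case/eqP: (twoF_neq0 Q).
have /kdle_p2k Ha : kdle (p2k n.1) (X%:Z - 1).
  apply: half; have -> : p2k n.1 + p2k n.1 = sg1 n + sg2 n by rewrite /sg1 /sg2; ring.
  exact: kdleD.
have Hb : kdle (p2k n.2 * S) (X%:Z - 1).
  apply: half; have -> : p2k n.2 * S + p2k n.2 * S = sg1 n - sg2 n.
    by rewrite /sg1 /sg2; ring.
  exact: kdleB.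
rewrite /inV Ha /=; case: (leqP X D) => XD.
  have -> : n.2 = 0; last by rewrite size_poly0.
  apply: kdle_p2k_neg; apply: kdle_mulI (qS_deq Q) _; apply: kdle_le Hb; lia.
apply/kdle_p2k; apply: kdle_mulI (qS_deq Q) _; apply: kdle_le Hb; lia.
Qed.

Lemma inV_v X n : n != 0 -> inV X n <-> (v1 n < X%:Z) /\ (v2 n < X%:Z).
Proof.
move=> n0; rewrite inV_dle; split=> [[H1 H2]|[H1 H2]].
  have := kdeq_dle (v1P n0) H1; have := kdeq_dle (v2P n0) H2; lia.
split; [apply: kdle_le (v1P n0).1|apply: kdle_le (v2P n0).1]; lia.
Qed.

Lemma inV0 X : inV X 0. Proof. by rewrite /inV size_poly0. Qed.
Lemma inVD X n m : inV X n -> inV X m -> inV X (n + m).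
Proof.
move=> /andP[a b] /andP[a' b']; apply/andP; split;
apply: leq_trans (size_polyD _ _) _; rewrite geq_max; exact/andP.
Qed.
Lemma inVC X c n : inV X n -> inV X (qC d c * n).
Proof.
move=> /andP[a b]; rewrite qCM; apply/andP; split;
exact: leq_trans (size_scale_leq _ _) _.
Qed.
Lemma inVN X n : inV X n -> inV X (- n).
Proof. by rewrite /inV /= !size_polyN. Qed.
Lemma inVB X n m : inV X n -> inV X m -> inV X (n - m).
Proof. by move=> H1 H2; apply: inVD => //; apply: inVN. Qed.
Lemma inV_le X Y n : (X <= Y)%N -> inV X n -> inV Y n.
Proof. by move=> XY /andP[a b]; apply/andP; split; lia. Qed.
Lemma inVM X Y n m : inV X n -> inV Y m -> inV (X + Y) (n * m).
Proof.
move=> /inV_dle[a b] /inV_dle[a' b']; apply/inV_dle; rewrite sg1M sg2M.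
split; [apply: kdle_le (kdleM a a').1|apply: kdle_le (kdleM b b').1]; lia.
Qed.
Lemma inV_0 n : inV 0 n -> n = 0.
Proof. by move=> /andP[a b]; apply: quad_eqP; apply/eqP; rewrite -size_poly_eq0; lia. Qed.

Lemma unit_dg n : n != 0 -> dg n = 0%N -> exists z, n * z = 1.
Proof.
move=> n0 dn; have N0 := nrm_neq0 n0.
have /size_poly1P[c c0 Hc] : size (nrm n) == 1%N.
  by rewrite nrm_size // dn.
exists (qconj n * qC d c^-1); rewrite mulrA mul_conj Hc -[(c%:P, 0)]/(qC d c).
by rewrite -(rmorphM (@qC F d)) mulfV // rmorph1.
Qed.

Lemma dg1 : dg (1 : A) = 0%N.
Proof.
have := nrm_size (oner_neq0 A); rewrite /nrm /= expr0n mul0r subr0 expr1n size_poly1.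
by case.
Qed.

Lemma unit_neq0 n z : n * z = 1 -> n != 0.
Proof. by move=> H; apply/eqP => n0; move: H; rewrite n0 mul0r => /eqP; rewrite eq_sym oner_eq0. Qed.

Lemma dg_unit n z : n * z = 1 -> dg n = 0%N.
Proof.
move=> H; have n0 := unit_neq0 H; have z0 : z != 0 by apply: (@unit_neq0 z n); rewrite mulrC.
by have := dgM n0 z0; rewrite H dg1; lia.
Qed.

Lemma v_unitC n : n != 0 -> v1 n = 0 -> v2 n = 0 -> exists2 c, c != 0 & n = qC d c.
Proof.
move=> n0 h1 h2; have /andP[a b] : inV 1 n by apply/(inV_v _ n0); rewrite h1 h2.
have n2 : n.2 = 0 by apply/eqP; rewrite -size_poly_eq0; have := rqD_gt0 Q; lia.
have /size_poly1P[c c0 Hc] : size n.1 == 1%N.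
  rewrite eqn_leq a lt0n size_poly_eq0; apply: contra_neq n0 => n1.
  exact: quad_eqP.
by exists c => //; apply: quad_eqP.
Qed.

Lemma kdeq_const (c : F) : c != 0 -> kdeq (kconst c) 0.
Proof.
move=> c0; split; last by rewrite kcoef_const.
by move=> i i0; rewrite kcoef_const; case: eqP => // E; rewrite E ltxx in i0.
Qed.
Lemma v1C c : c != 0 -> v1 (qC d c) = 0.
Proof. by move=> c0; apply: v1E; rewrite sg1_C; apply: kdeq_const. Qed.

(* Empty if P has infinitely many solutions. *)
Definition fsv (P : A -> Prop) : seq A :=
  match pselect (exists s : seq A, uniq s /\ forall x, x \in s <-> P x) with
  | left h => projT1 (cid h) | right _ => [::] end.

Definition bdd (P : A -> Prop) := exists X, forall n, P n -> inV X n.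

Definition Vseq (X : nat) : seq A :=
  [seq ((rVpoly x.1, rVpoly x.2) : A) | x : 'rV[F]_X * 'rV[F]_(X - D)].

Lemma mem_Vseq X n : (n \in Vseq X) = inV X n.
Proof.
apply/imageP/idP => [[[x y] _ ->]|/andP[a b]].
  by rewrite /inV /= !size_poly.
exists (poly_rV n.1, poly_rV n.2) => //=; rewrite !poly_rV_K //.
exact: quad_eqP.
Qed.

Lemma uniq_Vseq X : uniq (Vseq X).
Proof.
rewrite map_inj_uniq ?enum_uniq // => -[x y] [x' y'] [] /= H1 H2.
by rewrite -(rVpolyK x) -(rVpolyK y) H1 H2 !rVpolyK.
Qed.

Lemma size_Vseq X : size (Vseq X) = (q ^ (X + (X - D)))%N.
Proof. by rewrite size_map -cardE card_prod !card_mx !mul1n expnD. Qed.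

Lemma fsv_spec P : bdd P -> uniq (fsv P) /\ forall x, x \in fsv P <-> P x.
Proof.
move=> [X HX]; rewrite /fsv; case: pselect => [h|[]]; first by case: cid.
exists [seq x <- Vseq X | `[< P x >]]; split; first exact/filter_uniq/uniq_Vseq.
move=> x; rewrite mem_filter mem_Vseq; split=> [/andP[/asboolP]//|Px].
by rewrite HX // andbT; apply/asboolP.
Qed.

Lemma fsv_uniq P : uniq (fsv P).
Proof.
by rewrite /fsv; case: pselect => // h; case: cid => s [].
Qed.
Lemma mem_fsv P x : bdd P -> x \in fsv P <-> P x.
Proof. by move=> /fsv_spec[_]. Qed.

Lemma eq_fsv P P' : (forall x, P x <-> P' x) -> fsv P = fsv P'.
Proof. by move=> H; congr fsv; apply/funext => x; apply/propext. Qed.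

Lemma bdd_sub P P' : (forall x, P' x -> P x) -> bdd P -> bdd P'.
Proof. by move=> H [X HX]; exists X => n /H/HX. Qed.

Lemma sum_fsv_sub (V : nmodType) P P' (f : A -> V) : (forall x, P' x -> P x) -> bdd P ->
  \sum_(n <- fsv P') f n = \sum_(n <- fsv P) (if `[< P' n >] then f n else 0).
Proof.
move=> H bP; rewrite -big_mkcond -big_filter; apply: perm_big.
apply: uniq_perm; rewrite ?filter_uniq ?fsv_uniq // => x.
have bP' := bdd_sub H bP; rewrite mem_filter.
apply/idP/andP => [/(mem_fsv _ bP') Px|[/asboolP Px _]]; last exact/mem_fsv.
by split; [exact/asboolP|apply/mem_fsv/H].
Qed.

Lemma sum_fsv_map (V : nmodType) P P' (g : A -> A) (f : A -> V) : bdd P -> bdd P' ->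
  (forall x y, P x -> P y -> g x = g y -> x = y) ->
  (forall y, P' y <-> exists2 x, P x & y = g x) ->
  \sum_(n <- fsv P') f n = \sum_(e <- fsv P) f (g e).
Proof.
move=> bP bP' gi H; rewrite -(big_map g xpredT f); apply: perm_big.
apply: uniq_perm; first exact: fsv_uniq.
  rewrite map_inj_in_uniq ?fsv_uniq // => x y /(mem_fsv _ bP) Px /(mem_fsv _ bP) Py.
  exact: gi.
move=> y; apply/idP/mapP => [/(mem_fsv _ bP')/H[x Px ->]|[x /(mem_fsv _ bP) Px ->]].
  by exists x => //; apply/mem_fsv.
by apply/(mem_fsv _ bP')/H; exists x.
Qed.

Lemma size_fsv_sum P : size (fsv P) = (\sum_(n <- fsv P) 1)%N.
Proof. by rewrite sum1_size. Qed.

Lemma size_fsv_inj (T : finType) (g : A -> T) P : bdd P ->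
  (forall x y, P x -> P y -> g x = g y -> x = y) -> (size (fsv P) <= #|T|)%N.
Proof.
move=> bP gi; rewrite -(size_map g).
have /card_uniqP <- : uniq (map g (fsv P)); last exact: max_card.
rewrite map_inj_in_uniq ?fsv_uniq // => x y /(mem_fsv _ bP) Px /(mem_fsv _ bP) Py.
exact: gi.
Qed.

Lemma size_fsv_le P P' : (forall x, P' x -> P x) -> bdd P ->
  (size (fsv P') <= size (fsv P))%N.
Proof.
move=> H bP; apply: uniq_leq_size; first exact: fsv_uniq.
by move=> x /(mem_fsv _ (bdd_sub H bP))/H Px; apply/mem_fsv.
Qed.

Lemma size_fsv_inV X : size (fsv (inV X)) = (q ^ (X + (X - D)))%N.
Proof.
rewrite -size_Vseq; apply: perm_size; apply: uniq_perm.
- exact: fsv_uniq.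
- exact: uniq_Vseq.
by move=> x; rewrite mem_Vseq; apply/idP/idP; [move/mem_fsv=> H; apply: H|move=> H; apply/mem_fsv => //]; exists X.
Qed.

Lemma q_gt1 : (1 < q)%N. Proof. exact: card_finNzRing_gt1. Qed.
Lemma q_gt0 : (0 < q)%N. Proof. exact: ltnW q_gt1. Qed.

Definition subsp (P : A -> Prop) := P 0 /\ forall c x y, P x -> P y -> P (qC d c * x + y).

Lemma subspB P x y : subsp P -> P x -> P y -> P (x - y).
Proof.
move=> [_ H] Px Py; have := H (-1) _ _ Py Px.
by rewrite rmorphN rmorph1 mulN1r addrC.
Qed.
Lemma subspD P x y : subsp P -> P x -> P y -> P (x + y).
Proof. by move=> [_ H] Px Py; have := H 1 _ _ Px Py; rewrite rmorph1 mul1r. Qed.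
Lemma subspC P c x : subsp P -> P x -> P (qC d c * x).
Proof. by move=> [H0 H] Px; have := H c _ _ Px H0; rewrite addr0. Qed.

Definition lin (l : A -> F) := forall c x y, l (qC d c * x + y) = c * l x + l y.
Lemma linB l x y : lin l -> l (x - y) = l x - l y.
Proof.
move=> H; have := H (-1) y x; rewrite rmorphN rmorph1 mulN1r addrC => ->.
by rewrite mulN1r addrC.
Qed.
Lemma lin0 l : lin l -> l 0 = 0.
Proof. by move=> H; rewrite -(subrr (0 : A)) linB // subrr. Qed.
Lemma linD l x y : lin l -> l (x + y) = l x + l y.
Proof. by move=> H; have := H 1 x y; rewrite rmorph1 !mul1r. Qed.
Lemma linC l c x : lin l -> l (qC d c * x) = c * l x.
Proof. by move=> H; have := H c x 0; rewrite addr0 lin0 // addr0. Qed.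

(** The functionals embed [P] into [F^J]; this replaces dimension counts for subspaces given only as
    predicates. *)
Lemma subsp_card (P : A -> Prop) (J : finType) (l : J -> A -> F) : bdd P -> subsp P ->
  (forall j, lin (l j)) -> (forall x, P x -> (forall j, l j x = 0) -> x = 0) ->
  (size (fsv P) <= q ^ #|J|)%N.
Proof.
move=> bP sP ll H; rewrite -card_ffun.
apply: (@size_fsv_inj _ (fun x => [ffun j => l j x])) => // x y Px Py E.
apply/eqP; rewrite -subr_eq0; apply/eqP; apply: H; first exact: subspB.
move=> j; rewrite linB //; have /ffunP/(_ j) := E; rewrite !ffunE => ->.
by rewrite subrr.
Qed.

Definition Bx (s t : int) n : Prop := kdle (sg1 n) s /\ kdle (sg2 n) t.
Definition Ex (s t : int) n : Prop := [/\ n != 0, v1 n = s & v2 n = t].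

Lemma Bx_inV s t (X : nat) n : s < X%:Z -> t < X%:Z -> Bx s t n -> inV X n.
Proof.
move=> sX tX [H1 H2]; apply/inV_dle; split; [apply: kdle_le H1|apply: kdle_le H2]; lia.
Qed.
Lemma inV_Bx s t (X : nat) n : X%:Z <= s + 1 -> X%:Z <= t + 1 -> inV X n -> Bx s t n.
Proof.
move=> sX tX /inV_dle[H1 H2]; split; [apply: kdle_le H1|apply: kdle_le H2]; lia.
Qed.
Lemma Bx_bdd s t : bdd (Bx s t).
Proof. exists (`|s| + `|t|).+1 => n; apply: Bx_inV; lia. Qed.
Lemma Ex_Bx s t n : Ex s t n -> Bx s t n.
Proof. by move=> [n0 <- <-]; split; [case: (v1P n0)|case: (v2P n0)]. Qed.
Lemma Ex_bdd s t : bdd (Ex s t).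
Proof. exact: bdd_sub (@Ex_Bx s t) (Bx_bdd s t). Qed.
Lemma Bx_subsp s t : subsp (Bx s t).
Proof.
split; first by split; rewrite ?sg1_0 ?sg2_0; apply: kdle0.
move=> c x y [a b] [a' b']; split.
  by rewrite sg1D sg1M sg1_C; apply: kdleD => //; apply: kdle_scale.
by rewrite sg2D sg2M sg2_C; apply: kdleD => //; apply: kdle_scale.
Qed.
Lemma inV_subsp X : subsp (inV X).
Proof. by split; [exact: inV0|move=> c x y Hx Hy; apply: inVD => //; apply: inVC]. Qed.
Lemma inV_bdd X : bdd (inV X). Proof. by exists X. Qed.

(** The top [k] coefficients of [sigma_1] separate points: if they vanish, the two degree bounds add
    up to a negative number and [kdle_small] applies. *)
Lemma size_Bx (s t : int) (k : nat) : s + t < k%:Z -> (size (fsv (Bx s t)) <= q ^ k)%N.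
Proof.
move=> stk; have -> : (q ^ k = q ^ #|'I_k|)%N by rewrite card_ord.
apply: (@subsp_card _ _ (fun (j : 'I_k) x => kcoef (sg1 x) (s - (j : nat)%:Z))).
- exact: Bx_bdd.
- exact: Bx_subsp.
- by move=> j c x y; rewrite sg1D sg1M sg1_C kcoefD kcoef_constM.
move=> x [H1 H2] H; apply: (@kdle_small _ _ (s - k%:Z) t) => //; last lia.
move=> i Hi; case: (ltP s i) => si; first exact: H1.
have ltk : (`|s - i|%N < k)%N by lia.
by have := H (Ordinal ltk); rewrite /= => <-; congr kcoef; lia.
Qed.

Lemma kdeq_dleS (z : K) N : kdeq z N <-> kdle z N /\ ~ kdle z (N - 1).
Proof.
split=> [[H1 H2]|[H1 H2]].
  split=> // H; move/negP: H2; apply; apply/eqP/H; lia.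
split=> //; apply/eqP => H; apply: H2 => i Hi.
have [->//|iN] := eqVneq i N; apply: H1; lia.
Qed.

(** Inclusion-exclusion on the two exactness conditions. It reduces sums over a shape to sums over
    subspaces, where [eps] of a linear form can be summed. *)
Lemma sum_Ex (f : A -> int) s t : \sum_(n <- fsv (Ex s t)) f n =
  \sum_(n <- fsv (Bx s t)) f n - \sum_(n <- fsv (Bx (s - 1) t)) f n
  - \sum_(n <- fsv (Bx s (t - 1))) f n + \sum_(n <- fsv (Bx (s - 1) (t - 1))) f n.
Proof.
have E P' H := @sum_fsv_sub int (Bx s t) P' f H (Bx_bdd s t).
rewrite (E (Bx (s - 1) t)); last by move=> n [H1 H2]; split=> //; apply: kdle_le H1; lia.
rewrite (E (Bx s (t - 1))); last by move=> n [H1 H2]; split=> //; apply: kdle_le H2; lia.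
rewrite (E (Bx (s - 1) (t - 1))); last first.
  by move=> n [H1 H2]; split; [apply: kdle_le H1|apply: kdle_le H2]; lia.
rewrite (E (Ex s t) (@Ex_Bx s t)) {E}.
rewrite -!sumrB -big_split /=; apply: eq_big_seq => n /(mem_fsv _ (Bx_bdd s t))[H1 H2].
have B1 : `[< Bx (s - 1) t n >] = `[< kdle (sg1 n) (s - 1) >].
  by apply: asbool_equiv_eq; split=> [[]|].
have B2 : `[< Bx s (t - 1) n >] = `[< kdle (sg2 n) (t - 1) >].
  by apply: asbool_equiv_eq; split=> [[]|].
have B3 : `[< Bx (s - 1) (t - 1) n >] = `[< kdle (sg1 n) (s - 1) >] && `[< kdle (sg2 n) (t - 1) >].
  by rewrite -asbool_and; apply: asbool_equiv_eq.
have B0 : `[< Bx s t n >] by apply/asboolP.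
have BE : `[< Ex s t n >] = ~~ `[< kdle (sg1 n) (s - 1) >] && ~~ `[< kdle (sg2 n) (t - 1) >].
  rewrite -!asbool_neg -asbool_and; apply: asbool_equiv_eq; split.
    by move=> [n0 <- <-]; split; [case/kdeq_dleS: (v1P n0)|case/kdeq_dleS: (v2P n0)].
  move=> [N1 N2]; have n0 : n != 0.
    by apply: contra_notN N1 => /eqP ->; rewrite sg1_0; apply: kdle0.
  by split; [|apply: v1E|apply: v2E] => //; apply/kdeq_dleS.
rewrite B1 B2 B3 BE; do 2 case: `[< _ >] => /=; ring.
Qed.

(** The coordinate [b] is free of size [N - D]. Then a small [sigma_2] forces [a] to be the
    polynomial part of [b sqrt d] up to a polynomial of size [M], and [sigma_1], which differs from
    [sigma_2] by [2 b sqrt d], is bounded because [M <= N]. *)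
Lemma size_Bx_exact (N M : nat) : (M <= N)%N -> (D <= N)%N ->
  size (fsv (Bx (N%:Z - 1) (M%:Z - 1))) = (q ^ (M + (N - D)))%N.
Proof.
move=> MN DN.
pose g (x : 'rV[F]_M * 'rV[F]_(N - D)) : A :=
  (rVpoly x.1 + kfloor (p2k (rVpoly x.2) * S), rVpoly x.2).
have gi : injective g.
  move=> [x y] [x' y'] [] /= H1 H2; move: H1; rewrite H2 => /addIr H1.
  by rewrite -(rVpolyK x) -(rVpolyK y) H1 H2 !rVpolyK.
have bE := Bx_bdd (N%:Z - 1) (M%:Z - 1).
have -> : (q ^ (M + (N - D)))%N = size [seq g x | x : 'rV[F]_M * 'rV[F]_(N - D)].
  by rewrite size_map -cardE card_prod !card_mx !mul1n expnD.
apply: perm_size; apply: uniq_perm; first exact: fsv_uniq.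
  by rewrite map_inj_uniq ?enum_uniq.
move=> n; apply/idP/imageP => [/(mem_fsv _ bE)[H1 H2]|[[x y] _ ->]].
  have /andP[Ha Hb] : inV N n by apply: Bx_inV (conj H1 H2); lia.
  exists (poly_rV (n.1 - kfloor (p2k n.2 * S)), poly_rV n.2) => //.
  have Hs : (size (n.1 - kfloor (p2k n.2 * S))%R <= M)%N.
    apply/kdle_p2k; rewrite rmorphB /=.
    have -> : p2k n.1 - p2k (kfloor (p2k n.2 * S)) =
       sg2 n + (p2k n.2 * S - p2k (kfloor (p2k n.2 * S))) by rewrite /sg2; ring.
    by apply: kdleD => //; apply: kdle_le (kfloorP _); lia.
  by rewrite /g /= !poly_rV_K //; apply: quad_eqP => //=; rewrite subrK.
apply/(mem_fsv _ bE).
set r := rVpoly x; set b := rVpoly y.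
have Hr : kdle (p2k r) (M%:Z - 1) by apply/kdle_p2k; rewrite size_poly.
have Hb : kdle (p2k b) ((N - D)%N%:Z - 1) by apply/kdle_p2k; rewrite size_poly.
have H2 : kdle (sg2 (g (x, y))) (M%:Z - 1).
  rewrite /sg2 /g /= -/r -/b rmorphD /=.
  have -> : p2k r + p2k (kfloor (p2k b * S)) - p2k b * S =
    p2k r - (p2k b * S - p2k (kfloor (p2k b * S))) by ring.
  by apply: kdleB => //; apply: kdle_le (kfloorP _); lia.
split=> //.
have -> : sg1 (g (x, y)) = sg2 (g (x, y)) + (p2k b * S + p2k b * S).
  by rewrite /sg1 /sg2 /g /=; ring.
have HbS : kdle (p2k b * S) (N%:Z - 1).
  apply: kdle_le (kdleM Hb (qS_deq Q).1).1; lia.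
apply: kdleD; first by apply: kdle_le H2; lia.
exact: kdleD.
Qed.

Lemma size_Bx_conj s t : size (fsv (Bx s t)) = size (fsv (Bx t s)).
Proof.
rewrite !size_fsv_sum; apply: (@sum_fsv_map _ _ _ (@qconj Q)); try exact: Bx_bdd.
  by move=> x y _ _ /(congr1 (@qconj Q)); rewrite !qconjK.
move=> y; split=> [[H1 H2]|[x [H1 H2] ->]].
  by exists (qconj y); rewrite ?qconjK //; split; rewrite ?sg1_conj ?sg2_conj.
by split; rewrite ?sg1_conj ?sg2_conj.
Qed.

Lemma size_Bx_int (s t : int) : D%:Z <= s -> D%:Z <= t ->
  size (fsv (Bx s t)) = (q ^ absz (s + t + 2 - D%:Z)%R)%N.
Proof.
wlog: s t / t <= s.
  move=> H sD tD; case: (lerP t s) => st; first exact: H.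
  by rewrite size_Bx_conj H ?(ltW st) // [s + t]addrC.
move=> ts sD tD; have := @size_Bx_exact (absz (s + 1)%R) (absz (t + 1)%R).
have -> : (absz (s + 1)%R)%:Z - 1 = s by lia.
have -> : (absz (t + 1)%R)%:Z - 1 = t by lia.
move=> -> //; try lia.
by congr (_ ^ _)%N; lia.
Qed.

Lemma size_Ex (s t : int) : D%:Z < s -> D%:Z < t ->
  size (fsv (Ex s t)) = ((q - 1) ^ 2 * q ^ absz (s + t - D%:Z)%R)%N.
Proof.
move=> sD tD; have := sum_Ex (fun=> 1) s t.
have E P : \sum_(n <- fsv P) (1 : int) = (size (fsv P))%:Z.
  by rewrite -sum1_size (big_morph Posz (id1 := 0) (op1 := +%R)).
rewrite !E !size_Bx_int; try lia.
set k := absz (s + t - D%:Z)%R.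
have -> : absz (s + t + 2 - D%:Z)%R = k.+2 by lia.
have -> : absz (s - 1 + t + 2 - D%:Z)%R = k.+1 by lia.
have -> : absz (s + (t - 1) + 2 - D%:Z)%R = k.+1 by lia.
have -> : absz (s - 1 + (t - 1) + 2 - D%:Z)%R = k by lia.
rewrite !expnS; have := q_gt1; case: q => // -[//|p] _.
rewrite subn1 /=; nia.
Qed.

End Boxes.
#[global] Opaque fsv.

(** * Units, primes and factorization *)

Section Arith.
Variable Q : realquad.
Local Notation F := (rqF Q).
Local Notation d := (rqd Q).
Local Notation S := (rqS Q).
Local Notation D := (rqD Q).
Local Notation A := (quad d).
Local Notation K := (kinf F).
Local Notation q := #|F|.
Implicit Types n m : A.

(* Dirichlet's box principle for the multiples of sqrt d. *)
Lemma small_conj_ex (M : nat) : exists n, [/\ n != 0, kdle (sg2 n) (- M%:Z - 1) & (dg n < D)%N].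
Proof.
pose g (x : 'rV[F]_M.+1) := [ffun j : 'I_M => kcoef (p2k (rVpoly x) * S) (- (j : nat)%:Z - 1)].
have /injectivePn[x [y xy gxy]] : ~~ injectiveb g.
  apply/injectiveP => /leq_card; rewrite card_mx card_ffun card_ord mul1n leqNgt.
  by rewrite ltn_exp2l ?ltnSn ?q_gt1.
pose b := rVpoly x - rVpoly y.
have b0 : b != 0.
  by apply: contra_neq xy => /eqP; rewrite subr_eq0 => /eqP/(can_inj (@rVpolyK _ _)).
have sb : (size b <= M.+1)%N.
  by apply: leq_trans (size_polyD _ _) _; rewrite geq_max size_polyN !size_poly.
pose n : A := (kfloor (p2k b * S), b).
have n0 : n != 0 by apply: contra_neq b0 => /(congr1 (fun z : A => z.2)).
have H2 : kdle (sg2 n) (- M%:Z - 1).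
  have -> : sg2 n = - (p2k b * S - p2k (kfloor (p2k b * S))) by rewrite /sg2 /=; ring.
  apply: kdleN => i Hi; case: (ltP (-1) i) => i1; first exact: kfloorP.
  rewrite kcoefB kcoef_p2k; have [j Ej] : exists j : nat, i = - j%:Z - 1 by exists `|(i + 1)%R|%N; lia.
  have jM : (j < M)%N by lia.
  have := congr1 (fun f : {ffun _} => f (Ordinal jM)) gxy; rewrite !ffunE /= -Ej => E.
  rewrite /b rmorphB mulrBl kcoefB E subrr.
  have -> : i = Negz j by lia.
  by rewrite subr0.
have Hb : kdle (p2k b * S) (M%:Z + D%:Z).
  have /kdle_p2k Hb := sb; apply: kdle_le (kdleM Hb (qS_deq Q).1).1; lia.
have H1 : kdle (sg1 n) (M%:Z + D%:Z).
  have -> : sg1 n = sg2 n + (p2k b * S + p2k b * S) by rewrite /sg1 /sg2 /=; ring.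
  apply: kdleD; last exact: kdleD.
  by apply: kdle_le H2; lia.
exists n; split=> //.
have := kdeq_dle (v1P n0) H1; have := kdeq_dle (v2P n0) H2; have := v12 n0; lia.
Qed.

Lemma nrm_small n : n != 0 -> (dg n < D)%N -> (size (nrm n) <= D)%N.
Proof. by move=> /nrm_size ->. Qed.

Definition qP (p : {poly F}) : A := (p, 0).

Lemma divp_key (a b g : {poly F}) : a %% g = b %% g ->
  a - b = g * (a %/ g - b %/ g).
Proof.
move=> E; have e1 := divp_eq a g; have e2 := divp_eq b g; rewrite E in e1.
transitivity ((a %/ g * g + b %% g) - (b %/ g * g + b %% g)); first by congr (_ - _).
by ring.
Qed.

(** The norm of [m] is [m * qconj m], so a congruence modulo the norm is one modulo [m]. Used in
    both directions, it shows that the two elements are associate. *)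
Lemma cong_unit (n m : A) w : n != 0 -> m != 0 -> nrm n = nrm m ->
  n - m = qP (nrm m) * w -> exists z, n = m * z.
Proof.
move=> n0 m0 E Hw; exists (1 + w * qconj m).
have g0 : qP (nrm m) != 0.
  by apply: contra_neq (nrm_neq0 m0) => /(congr1 (fun z : A => z.1)).
apply: (quad_mulfI g0).
have -> : n = m + qP (nrm m) * w by rewrite -Hw addrC subrK.
have -> : qP (nrm m) = m * qconj m by rewrite mul_conj.
ring.
Qed.

(** Each element comes from [small_conj_ex] with a bound beyond the second degree of its
    predecessor. *)
Lemma small_norm_seq : exists h : nat -> A,
  [/\ forall i, h i != 0, forall i, (size (nrm (h i)) <= D)%N &
      forall i j, (i < j)%N -> v2 (h j) < v2 (h i)].
Proof.
have [f Hf] := choice small_conj_ex.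
have [M HM] : exists M : nat -> nat, forall i, M i.+1 = absz (v2 (f (M i))).
  by exists (fix M (i : nat) : nat := if i is i'.+1 then absz (v2 (f (M i'))) else 0%N).
have f0 i : f i != 0 by case: (Hf i).
exists (fun i => f (M i)); split=> [i|i|i j].
- exact: f0.
- by case: (Hf (M i)) => *; apply: nrm_small.
have hdec k : v2 (f (M k.+1)) < v2 (f (M k)).
  have [_ H _] := Hf (M k.+1); have := kdeq_dle (v2P (f0 _)) H.
  rewrite HM; lia.
elim: j => [|j IH]; first by rewrite ltn0.
rewrite ltnS leq_eqVlt => /orP[/eqP->|/IH]; first exact: hdec.
by apply: lt_trans; apply: hdec.
Qed.

Lemma cong_dvd n m : n != 0 -> m != 0 -> nrm n = nrm m ->
  n.1 %% nrm n = m.1 %% nrm m -> n.2 %% nrm n = m.2 %% nrm m -> exists z, n = m * z.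
Proof.
move=> n0 m0 H; rewrite H => H1 H2.
apply: (@cong_unit n m (n.1 %/ nrm m - m.1 %/ nrm m, n.2 %/ nrm m - m.2 %/ nrm m)).
- exact: n0.
- exact: m0.
- exact: H.
by apply: quad_eqP => /=; rewrite ?(divp_key H1) ?(divp_key H2); ring.
Qed.

Lemma unit_v n m z z' : n != 0 -> m != 0 -> n = m * z -> m = n * z' -> z * z' = 1 /\
  [/\ v1 z = - v2 z, v1 z' = v2 z & v2 z = v2 n - v2 m].
Proof.
move=> n0 m0 Hz Hz'.
have zz' : z * z' = 1 by apply: (quad_mulfI m0); rewrite mulr1 mulrA -Hz -Hz'.
have z0 := unit_neq0 zz'; have z'0 : z' != 0 by apply: (@unit_neq0 _ z' z); rewrite mulrC.
have V := v2M m0 z0; rewrite -Hz in V.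
have d1 := v12 z0; rewrite (dg_unit zz') in d1.
have V' := v1M z0 z'0.
have E1 : v1 (1 : A) = 0 by rewrite -(rmorph1 (@qC F d)) v1C ?oner_neq0.
rewrite zz' E1 in V'; split; [exact: zz'|split; lia].
Qed.

(** There are more elements of bounded norm than keys (the norm and the residues modulo it), so two
    of them share a key and are associate. Their second degrees differ, so the quotient or its
    inverse has positive first degree. *)
Lemma unit_ex : exists z z' : A, z * z' = 1 /\ 0 < v1 z.
Proof.
have [h [h0 hs hlt]] := small_norm_seq.
pose T : finType := ('rV[F]_D * 'rV[F]_D * 'rV[F]_D)%type.
pose key i : T := (poly_rV (nrm (h i)), poly_rV ((h i).1 %% nrm (h i)),
                  poly_rV ((h i).2 %% nrm (h i))).
have /injectivePn[x [y xy kxy]] : ~~ injectiveb (fun i : 'I_#|T|.+1 => key i).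
  by apply/injectiveP => /leq_card; rewrite card_ord ltnn.
have sm p i : (size (p %% nrm (h i))%R <= D)%N.
  have : (size (p %% nrm (h i))%R < size (nrm (h i)))%N by rewrite ltn_modp nrm_neq0.
  by have := hs i; lia.
case: kxy => /(congr1 rVpoly) En /(congr1 rVpoly) E1 /(congr1 rVpoly) E2.
rewrite !poly_rV_K // in En E1 E2.
have [z Hz] := cong_dvd (h0 x) (h0 y) En E1 E2.
have [z' Hz'] := cong_dvd (h0 y) (h0 x) (esym En) (esym E1) (esym E2).
have [zz' [e1 e2 e3]] := unit_v (h0 x) (h0 y) Hz Hz'.
have vneq : v2 (h x) <> v2 (h y).
  case: (ltngtP x y) => [/hlt|/hlt|/val_inj E]; [lia|lia|].
  by case/eqP: xy.
have [vz|vz] : 0 < v1 z \/ 0 < v1 z' by lia.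
  exact: (ex_intro _ z (ex_intro _ z' (conj zz' vz))).
exists z', z; split; [rewrite mulrC; exact: zz'|exact: vz].
Qed.

(** Some unit of infinite order, not necessarily a fundamental one. *)
Definition qunit : A := projT1 (cid unit_ex).
Definition qunitV : A := projT1 (cid (projT2 (cid unit_ex))).
Lemma qunit_inv : qunit * qunitV = 1. Proof. exact: (proj1 (projT2 (cid (projT2 (cid unit_ex))))). Qed.
Lemma v1_qunit_gt0 : 0 < v1 qunit. Proof. exact: (proj2 (projT2 (cid (projT2 (cid unit_ex))))). Qed.
Definition rho : nat := `|v1 qunit|%N.
Lemma rho_gt0 : (0 < rho)%N. Proof. by have := v1_qunit_gt0; rewrite /rho; lia. Qed.
Lemma qunit_neq0 : qunit != 0. Proof. exact: unit_neq0 qunit_inv. Qed.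
Lemma qunitV_neq0 : qunitV != 0. Proof. by apply: (@unit_neq0 _ _ qunit); rewrite mulrC qunit_inv. Qed.
Lemma v1_qunit : v1 qunit = rho. Proof. by have := v1_qunit_gt0; rewrite /rho; lia. Qed.
Lemma v2_qunit : v2 qunit = - rho%:Z.
Proof. by have := v12 qunit_neq0; rewrite (dg_unit qunit_inv) v1_qunit; lia. Qed.
Lemma v1_1 : v1 (1 : A) = 0. Proof. by rewrite -(rmorph1 (@qC F d)) v1C ?oner_neq0. Qed.
Lemma v1_qunitV : v1 qunitV = - rho%:Z.
Proof. by have := v1M qunit_neq0 qunitV_neq0; rewrite qunit_inv v1_1 v1_qunit; lia. Qed.

Lemma unitX (z z' : A) k : z * z' = 1 -> z ^+ k * z' ^+ k = 1.
Proof. by move=> H; rewrite -exprMn H expr1n. Qed.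

Lemma quad_expf_neq0 n k : n != 0 -> n ^+ k != 0.
Proof.
move=> n0; elim: k => [|k IH]; first by rewrite expr0 oner_neq0.
by rewrite exprS quad_mulf_neq0.
Qed.

Lemma v1X n k : n != 0 -> v1 (n ^+ k) = v1 n * k%:Z.
Proof.
move=> n0; elim: k => [|k IH]; first by rewrite expr0 v1_1 mulr0.
by rewrite exprS v1M ?quad_expf_neq0 // IH; lia.
Qed.
Lemma dgX n k : n != 0 -> dg (n ^+ k) = (dg n * k)%N.
Proof.
move=> n0; elim: k => [|k IH]; first by rewrite expr0 dg1 muln0.
by rewrite exprS dgM ?quad_expf_neq0 // IH; lia.
Qed.

(** * Associates and balanced representatives *)

Definition unitq n := exists z, n * z = 1.
Definition assoc n m := exists2 z, unitq z & m = n * z.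
Definition dvdq n m := exists z, m = n * z.

Lemma unitqP n : unitq n <-> n != 0 /\ dg n = 0%N.
Proof.
split=> [[z H]|[n0 d0]]; last exact: unit_dg.
by split; [exact: unit_neq0 H|exact: dg_unit H].
Qed.

Lemma unitqM n m : unitq n -> unitq m -> unitq (n * m).
Proof. by move=> [z Hz] [w Hw]; exists (z * w); rewrite mulrACA Hz Hw mulr1. Qed.
Lemma unitq1 : unitq 1. Proof. by exists 1; rewrite mulr1. Qed.

Lemma assoc_refl n : assoc n n. Proof. by exists 1; [exact: unitq1|rewrite mulr1]. Qed.
Lemma assoc_sym n m : assoc n m -> assoc m n.
Proof.
move=> [z [w Hw] ->]; exists w; first by exists z; rewrite mulrC.
by rewrite -mulrA Hw mulr1.
Qed.
Lemma assoc_trans n m k : assoc n m -> assoc m k -> assoc n k.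
Proof.
move=> [z Hz ->] [w Hw ->]; exists (z * w); first exact: unitqM.
by rewrite mulrA.
Qed.
Lemma assocM n m n' m' : assoc n n' -> assoc m m' -> assoc (n * m) (n' * m').
Proof.
move=> [z Hz ->] [w Hw ->]; exists (z * w); first exact: unitqM.
by rewrite mulrACA.
Qed.
Lemma assoc_dvd n m : assoc n m -> dvdq n m. Proof. by move=> [z _ ->]; exists z. Qed.
Lemma dvdq_trans n m k : dvdq n m -> dvdq m k -> dvdq n k.
Proof. by move=> [z ->] [w ->]; exists (z * w); rewrite mulrA. Qed.
Lemma assoc_neq0 n m : assoc n m -> n != 0 -> m != 0.
Proof. by move=> [z /unitqP[z0 _] ->] n0; apply: quad_mulf_neq0. Qed.
Lemma assoc_dg n m : assoc n m -> n != 0 -> dg m = dg n.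
Proof. by move=> [z /unitqP[z0 dz] ->] n0; rewrite dgM // dz addn0. Qed.

Lemma dvdq_assoc n m : n != 0 -> m != 0 -> dvdq n m -> dg n = dg m -> assoc n m.
Proof.
move=> n0 m0 [z E] dd; have z0 : z != 0 by apply: contra_neq m0; rewrite E => ->; rewrite mulr0.
exists z => //; apply/unitqP; split=> //.
by move: dd; rewrite E dgM //; lia.
Qed.

Lemma window_ex n s : n != 0 -> exists2 m, assoc n m & s <= v1 m < s + rho%:Z.
Proof.
move=> n0; pose k := ((v1 n - s) %/ rho%:Z)%Z.
have r0 : (rho%:Z != 0) by have := rho_gt0; lia.
have E := divz_eq (v1 n - s) rho%:Z; have E1 := modz_ge0 (v1 n - s) r0.
have E2 : ((v1 n - s) %% rho%:Z)%Z < rho%:Z by apply: ltz_pmod; have := rho_gt0; lia.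
rewrite -/k in E; case: (ltP k 0) => k0.
  exists (n * qunit ^+ `|k|%N).
    by exists (qunit ^+ `|k|%N) => //; exists (qunitV ^+ `|k|%N); apply/unitX/qunit_inv.
  rewrite v1M ?quad_expf_neq0 ?qunit_neq0 // v1X ?qunit_neq0 // v1_qunit.
  have -> : `|k|%N%:Z = - k by lia.
  by rewrite mulrN [rho%:Z * k]mulrC; lia.
exists (n * qunitV ^+ `|k|%N).
  exists (qunitV ^+ `|k|%N) => //; exists (qunit ^+ `|k|%N); apply: unitX.
  by rewrite mulrC qunit_inv.
rewrite v1M ?quad_expf_neq0 ?qunitV_neq0 // v1X ?qunitV_neq0 // v1_qunitV.
have -> : `|k|%N%:Z = k by lia.
by rewrite mulNr [rho%:Z * k]mulrC; lia.
Qed.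

(** Multiplication by [qunit] changes [v1 - v2] by [2 rho], so each class of associates meets this
    window; there both conjugates have half the degree of the norm up to [rho]. *)
Definition balanced n := 0 <= v1 n - v2 n < (rho.*2)%:Z.

(** The choice is made from a predicate depending only on the class, so associates get literally the
    same representative. *)
Definition rep n : A :=
  match pselect (exists m, assoc n m /\ balanced m) with
  | left h => projT1 (cid h) | right _ => 0 end.

Lemma rep_spec n : n != 0 -> assoc n (rep n) /\ balanced (rep n).
Proof.
move=> n0; rewrite /rep; case: pselect => [h|[]]; first by case: cid.
(* Starting at half the degree rounded up puts [v1 - v2 = 2 v1 - dg] between 0 and [2 rho - 1]. *)
have [m Hm Hw] := window_ex ((dg n).+1./2)%:Z n0.
exists m; split=> //; rewrite /balanced.
have m0 := assoc_neq0 Hm n0; have := v12 m0; rewrite (assoc_dg Hm n0).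
have := odd_double_half (dg n).+1; case: odd; lia.
Qed.

Lemma rep_eq n m : assoc n m -> rep n = rep m.
Proof.
move=> H; rewrite /rep.
have -> : (fun k => assoc n k /\ balanced k) = (fun k => assoc m k /\ balanced k) => //.
apply/funext => k; apply/propext; split=> -[H1 H2]; split=> //.
  exact: assoc_trans (assoc_sym H) H1.
exact: assoc_trans H H1.
Qed.

Lemma rep_assoc n : n != 0 -> assoc n (rep n). Proof. by case/rep_spec. Qed.
Lemma rep_neq0 n : n != 0 -> rep n != 0.
Proof. by move=> n0; apply: assoc_neq0 (rep_assoc n0) n0. Qed.
Lemma rep_id n : n != 0 -> rep (rep n) = rep n.
Proof. by move=> n0; rewrite -(rep_eq (rep_assoc n0)). Qed.
Lemma dg_rep n : n != 0 -> dg (rep n) = dg n.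
Proof. by move=> n0; apply: assoc_dg (rep_assoc n0) n0. Qed.

(** * Primes and unique factorization *)

Definition primeq p := [/\ p != 0, (0 < dg p)%N &
  forall x y, dvdq p (x * y) -> dvdq p x \/ dvdq p y].

Lemma primeq_Aprime p : primeq p -> Aprime d p.
Proof.
move=> [p0 dp Hp]; split; first exact/eqP.
split; first by move=> /unitqP[_ E]; rewrite E in dp.
exact: Hp.
Qed.

Lemma Aprod_cons (x : A) (s : seq A) : Aprod d (x :: s) = x * (Aprod d s : A) :> A.
Proof. by []. Qed.
Lemma Aprod_cat (s t : seq A) : Aprod d (s ++ t) = (Aprod d s : A) * Aprod d t :> A.
Proof.
elim: s => [|x s IH]; first by rewrite -[Aprod d [::]]/(1 : A) mul1r.
by rewrite cat_cons !Aprod_cons IH mulrA.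
Qed.
Lemma Aprod_dvd (x : A) (s : seq A) : x \in s -> dvdq x (Aprod d s).
Proof.
elim: s => // y s IH; rewrite in_cons => /orP[/eqP<-|/IH[z Hz]].
  by exists (Aprod d s).
by exists (y * z); rewrite Aprod_cons Hz mulrCA.
Qed.

(** Factorizations are compared through [x y = p z]: uniqueness puts a multiple of [p] among the
    irreducible factors of [x] or of [y]. *)
Lemma irred_prime (p : A) : Airred d p -> primeq p.
Proof.
move=> irp; have [p0' [pu pirr]] := irp; have p0 : p != 0 by apply/eqP.
have dp : (0 < dg p)%N.
  by rewrite lt0n; apply/eqP => E; apply: pu; apply/unitqP.
split=> // x y [z E].
have [x0|x0] := eqVneq x 0; first by left; exists 0; rewrite x0 mulr0.
have [y0|y0] := eqVneq y 0; first by right; exists 0; rewrite y0 mulr0.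
have z0 : z != 0.
  by apply: contra_neq (quad_mulf_neq0 x0 y0) => z0; rewrite E z0 mulr0.
have [[x' Hx]|xu] := pselect (unitq x).
  right; exists (z * x'); rewrite mulrA -E -mulrA [y * x']mulrC mulrA Hx mul1r //.
have [[y' Hy]|yu] := pselect (unitq y).
  left; exists (z * y'); rewrite mulrA -E -mulrA Hy mulr1 //.
have [ufd1 ufd2] := rq_ufd Q.
have [sx [ix Ex]] := ufd1 x (elimN eqP x0) xu.
have [sy [iy Ey]] := ufd1 y (elimN eqP y0) yu.
have it w : w \in sx ++ sy -> Airred d w by rewrite mem_cat => /orP[/ix|/iy].
(* Factorizations are given for nonunits only, so a unit [z] is absorbed into the irreducible
   [p]. *)
have [h [s [is_ Es ph]]] : exists h s, [/\ (forall w, w \in h :: s -> Airred d w),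
    Aprod d (h :: s) = Aprod d (sx ++ sy) & dvdq p h].
  have [[z' Hz]|zu] := pselect (unitq z).
    exists (p * z), [::]; split; last by exists z.
      move=> w; rewrite inE => /eqP ->; split; first exact/eqP/quad_mulf_neq0.
      split.
        by move=> /unitqP[_]; rewrite dgM //; lia.
      move=> a b Hab.
      have Ep : p = Amul d a ((b : A) * z').
        by rewrite -[RHS]/((a : A) * ((b : A) * z')) mulrA -[X in _ = X * _]/(Amul d a b) -Hab -mulrA Hz mulr1.
      case: (pirr _ _ Ep) => [|[w' Hw]]; [by left|right].
      by exists (z' * w'); rewrite -[Amul _ _ _]/((b : A) * (z' * w')) mulrA.
    by rewrite Aprod_cons Aprod_cat -Ex -Ey -[Aprod d [::]]/(1 : A) mulr1 E.
  have [sz [iz Ez]] := ufd1 z (elimN eqP z0) zu.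
  exists p, sz; split; last exact/assoc_dvd/assoc_refl.
    by move=> w; rewrite inE => /orP[/eqP->|/iz].
  by rewrite Aprod_cons Aprod_cat -Ex -Ey -Ez E.
have [t' [pt [st Ht]]] := ufd2 _ _ is_ it Es.
have [u [uu Hu]] := Ht 0%N (ltn0Sn _).
have : nth (Azero F) t' 0 \in sx ++ sy by rewrite (perm_mem pt) mem_nth // -st.
have pw : dvdq p (nth (Azero F) t' 0).
  by apply: dvdq_trans ph _; rewrite Hu; exists u.
rewrite mem_cat => /orP[] /Aprod_dvd Hd; [left|right]; apply: dvdq_trans pw _.
  by rewrite Ex.
by rewrite Ey.
Qed.

Lemma prime_divisor n : n != 0 -> (0 < dg n)%N -> exists2 p, primeq p & dvdq p n.
Proof.
move=> n0 dn; have [ufd1 _] := rq_ufd Q.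
have nu : ~ unitq n by move=> /unitqP[_ E]; rewrite E in dn.
have [[|p s] [is_ Es]] := ufd1 n (elimN eqP n0) nu.
  by case: nu; rewrite Es; apply: unitq1.
exists p; first by apply: irred_prime; apply: is_; rewrite mem_head.
by rewrite Es; exists (Aprod d s).
Qed.

(** A normalization under which distinct primes are never associate. *)
Definition prep p := primeq p /\ rep p = p.

Lemma prime_assoc p r : primeq p -> assoc p r -> primeq r.
Proof.
move=> [p0 dp Hp] H; split; first exact: assoc_neq0 H p0.
  by rewrite (assoc_dg H).
move=> x y rxy; have := Hp x y (dvdq_trans (assoc_dvd H) rxy).
by case=> Hd; [left|right]; apply: dvdq_trans (assoc_dvd (assoc_sym H)) Hd.
Qed.

Lemma prime_prep p : primeq p -> prep (rep p).
Proof.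
move=> Hp; have [p0 _ _] := Hp; split; last exact: rep_id.
exact: prime_assoc Hp (rep_assoc p0).
Qed.

Lemma quad_ind (P : A -> Prop) : (forall u, unitq u -> P u) ->
  (forall p n, prep p -> n != 0 -> P n -> P (p * n)) -> forall n, n != 0 -> P n.
Proof.
move=> Hu Hp n; have [k] := ubnP (dg n); elim: k n => // k IH n nk n0.
have [d0|dn] := posnP (dg n); first by apply/Hu/unitqP.
have [p pp pn] := prime_divisor n0 dn.
have [p0 dp _] := pp.
have [z Hz] := dvdq_trans (assoc_dvd (assoc_sym (rep_assoc p0))) pn.
have z0 : z != 0 by apply: contra_neq n0; rewrite Hz => ->; rewrite mulr0.
rewrite Hz; apply: Hp => //; first exact: prime_prep.
apply: IH => //; move: nk; rewrite Hz dgM ?rep_neq0 // dg_rep //; lia.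
Qed.

Lemma dvdq_dg n m : m != 0 -> dvdq n m -> (dg n <= dg m)%N.
Proof.
move=> m0 [z E]; rewrite E in m0 *.
have n0 : n != 0 by apply: contra_neq m0 => ->; rewrite mul0r.
have z0 : z != 0 by apply: contra_neq m0 => ->; rewrite mulr0.
by rewrite dgM // leq_addr.
Qed.
Lemma dvdq_neq0 n m : m != 0 -> dvdq n m -> n != 0.
Proof. by move=> m0 [z E]; apply: contra_neq m0; rewrite E => ->; rewrite mul0r. Qed.

(** * Valuations at primes *)

Definition vp p n : nat := \max_(j < (dg n).+1 | `[< dvdq (p ^+ j) n >]) j.

Lemma vpP p n j : primeq p -> n != 0 -> dvdq (p ^+ j) n <-> (j <= vp p n)%N.
Proof.
move=> [p0 dp _] n0.
have bnd i : dvdq (p ^+ i) n -> (i < (dg n).+1)%N.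
  move/(dvdq_dg n0); rewrite dgX // ltnS; apply: leq_trans; exact: leq_pmull.
split=> [H|H].
  rewrite /vp; apply: (@leq_bigmax_cond _ (fun i : 'I_(dg n).+1 => `[< dvdq (p ^+ i) n >])
    (fun i => i : nat) (Ordinal (bnd _ H))).
  exact/asboolP.
have : dvdq (p ^+ vp p n) n.
  rewrite /vp; have [|i /asboolP Hi ->] :=
    @eq_bigmax_cond _ (fun i : 'I_(dg n).+1 => `[< dvdq (p ^+ i) n >]) (fun i => i : nat) => //.
  apply/card_gt0P; exists ord0; rewrite unfold_in; apply/asboolP.
  by rewrite expr0; exists n; rewrite mul1r.
apply: dvdq_trans; exists (p ^+ (vp p n - j)); rewrite -exprD subnKC //.
Qed.

Lemma vp_cofactor p n : primeq p -> n != 0 ->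
  exists2 m, n = p ^+ vp p n * m & ~ dvdq p m.
Proof.
move=> pp n0; have [m Hm] := (vpP _ pp n0).2 (leqnn _).
exists m => // -[z Hz]; have := (vpP (vp p n).+1 pp n0).1.
rewrite ltnn => H; suff: false by [].
by apply: H; exists z; rewrite {1}Hm Hz exprSr mulrA.
Qed.

Lemma vpE p n j m : primeq p -> n != 0 -> n = p ^+ j * m -> ~ dvdq p m -> vp p n = j.
Proof.
move=> pp n0 E Hm; apply/eqP; rewrite eqn_leq; apply/andP; split; last first.
  by apply/(vpP _ pp n0); exists m.
rewrite leqNgt; apply/negP => /(vpP _ pp n0)[z Hz]; apply: Hm; exists z.
have [p0 _ _] := pp; apply: (quad_mulfI (quad_expf_neq0 j p0)).
by rewrite -E Hz exprSr mulrA.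
Qed.

Lemma vpM p n m : primeq p -> n != 0 -> m != 0 -> vp p (n * m) = (vp p n + vp p m)%N.
Proof.
move=> pp n0 m0; have [a Ea Ha] := vp_cofactor pp n0; have [b Eb Hb] := vp_cofactor pp m0.
apply: (@vpE _ _ _ (a * b)) => //; first exact: quad_mulf_neq0.
  by rewrite {1}Ea {1}Eb exprD mulrACA.
by have [_ _ H] := pp; case/H.
Qed.

Lemma vp_unit p n : primeq p -> unitq n -> vp p n = 0%N.
Proof.
move=> pp /unitqP[n0 dn]; apply: (@vpE _ _ _ n) => //; first by rewrite mul1r.
by have [_ dp _] := pp; move/(dvdq_dg n0); rewrite dn; lia.
Qed.

Lemma vp_assoc p n m : primeq p -> n != 0 -> assoc n m -> vp p m = vp p n.
Proof.
move=> pp n0 [z zu ->]; have [z0 _] := (unitqP _).1 zu.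
by rewrite vpM // (vp_unit pp zu) addn0.
Qed.

Lemma prep_dvd_eq p r : prep p -> prep r -> dvdq p r -> p = r.
Proof.
move=> [pp Ep] [pr Er] [z Ez].
have [p0 dp _] := pp; have [r0 dr Hr] := pr.
have z0 : z != 0 by apply: contra_neq r0; rewrite Ez => ->; rewrite mulr0.
have [rp|/(dvdq_dg z0)] : dvdq r p \/ dvdq r z.
  by apply: Hr; rewrite -Ez; apply/assoc_dvd/assoc_refl.
  rewrite -Ep -Er; apply: rep_eq; apply: dvdq_assoc => //; first by exists z.
  apply/eqP; rewrite eqn_leq; apply/andP; split; apply: dvdq_dg => //.
  by exists z.
by rewrite Ez dgM //; lia.
Qed.

Lemma vp_prep p r : prep p -> prep r -> vp p r = (p == r).
Proof.
move=> pp pr; have [[p0 dp _] _] := pp; have [[r0 dr _] _] := pr.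
have [<-|pr'] := eqVneq p r.
  apply: (@vpE _ _ _ 1); rewrite ?expr1 ?mulr1 //; first by case: pp.
  move/(dvdq_dg (oner_neq0 _)); rewrite dg1; lia.
apply: (@vpE _ _ _ r); rewrite ?expr0 ?mul1r //; first by case: pp.
by move/(prep_dvd_eq pp pr)/eqP; rewrite (negPf pr').
Qed.

Lemma dvdq_vp n m : n != 0 -> m != 0 ->
  dvdq n m <-> (forall p, prep p -> (vp p n <= vp p m)%N).
Proof.
move=> n0 m0; split=> [[z E] p [pp _]|].
  have z0 : z != 0 by apply: contra_neq m0; rewrite E => ->; rewrite mulr0.
  by rewrite E vpM // leq_addr.
move: n n0 m m0; apply: quad_ind => [u [z uz] m m0 _|p n pp n0 IH m m0 H].
  by exists (z * m); rewrite mulrA uz mul1r.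
have [p' Ep] := pp; have [p0 _ _] := p'.
have : dvdq (p ^+ 1) m.
  apply/vpP => //; have := H p pp; rewrite vpM // vp_prep // eqxx; lia.
rewrite expr1 => -[w Ew]; have w0 : w != 0 by apply: contra_neq m0; rewrite Ew => ->; rewrite mulr0.
have [|z Ez] := IH w w0.
  move=> r pr; have [r' _] := pr; have := H r pr; rewrite Ew !vpM //; lia.
by exists z; rewrite Ew Ez mulrA.
Qed.

Definition PR (m : nat) : seq A := fsv (fun p => prep p /\ (dg p <= m)%N).

Lemma balanced_inV n (m : nat) : n != 0 -> balanced n -> (dg n <= m)%N ->
  inV (m./2 + rho + 1) n.
Proof.
move=> n0; rewrite /balanced => Hb dm; apply/(inV_v _ n0); have := v12 n0.
have := odd_double_half m; lia.
Qed.

Lemma prep_balanced p : prep p -> balanced p.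
Proof. by move=> [[p0 _ _] <-]; case: (rep_spec p0). Qed.

Lemma PR_bdd (m : nat) : bdd (fun p => prep p /\ (dg p <= m)%N).
Proof.
exists (m./2 + rho + 1)%N => p [pp pm]; have [[p0 _ _] _] := pp.
exact/balanced_inV/pm/prep_balanced.
Qed.

Lemma mem_PR (m : nat) p : p \in PR m <-> prep p /\ (dg p <= m)%N.
Proof. exact/mem_fsv/PR_bdd. Qed.

Lemma uniq_PR (m : nat) : uniq (PR m). Proof. exact: fsv_uniq. Qed.

Lemma vp_big p n (m : nat) : prep p -> n != 0 -> (dg n <= m)%N -> (0 < vp p n)%N -> p \in PR m.
Proof.
move=> pp n0 nm /vpP-/(_ pp.1 n0)/(dvdq_dg n0); rewrite expr1 => pn.
by apply/mem_PR; split=> //; apply: leq_trans nm.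
Qed.

Lemma sum_vp_dg n (m : nat) : n != 0 -> (dg n <= m)%N ->
  (\sum_(p <- PR m) vp p n * dg p = dg n)%N.
Proof.
move: n; apply: quad_ind => [u uu|p n pp n0 IH] dm.
  have [_ ->] := (unitqP _).1 uu; rewrite big_seq big1 // => p /mem_PR[[pp _] _].
  by rewrite vp_unit.
have [p' _] := pp; have [p0 _ _] := p'; rewrite dgM // in dm *.
rewrite -IH; last by apply: leq_trans dm; rewrite leq_addl.
have pin : p \in PR m by apply/mem_PR; split=> //; apply: leq_trans dm; rewrite leq_addr.
transitivity (\sum_(r <- PR m) ((r == p) * dg p + vp r n * dg r))%N.
  rewrite big_seq [RHS]big_seq; apply: eq_bigr => r /mem_PR[pr _].
  have [pr1 _] := pr; rewrite (vpM pr1 p0 n0) (vp_prep pr pp) mulnDl; congr (_ + _)%N.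
  by case: eqP => // ->.
rewrite big_split; congr (_ + _)%N.
rewrite (bigD1_seq p) ?uniq_PR //= eqxx mul1n big1_seq ?addn0 // => r /andP[/negPf -> _].
by rewrite mul0n.
Qed.

Lemma vpX p n k : primeq p -> n != 0 -> vp p (n ^+ k) = (vp p n * k)%N.
Proof.
move=> pp n0; elim: k => [|k IH]; first by rewrite expr0 (vp_unit pp unitq1) muln0.
by rewrite exprS vpM ?quad_expf_neq0 // IH mulnS.
Qed.

End Arith.
#[global] Opaque vp rep PR qunit qunitV rho.

(** With [E = (C + 1) k] and [s = m %/ E], the power [(m + 1)^C] is at most [E^C 2^(s C)], and for
    large [m] the constant [B E^C] is at most [s < 2^s]; the product is at most [2^(s (C + 1))]. *)
Lemma poly_le_exp (B C k : nat) : (0 < k)%N ->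
  exists m0, forall m, (m0 <= m)%N -> (B * m.+1 ^ C <= 2 ^ (m %/ k))%N.
Proof.
move=> k0; pose E := (C.+1 * k)%N; have E0 : (0 < E)%N by rewrite muln_gt0.
exists (E * (B * E ^ C))%N => m Hm; pose s := (m %/ E)%N.
have Hs : (B * E ^ C <= s)%N by rewrite leq_divRL // mulnC.
have H1 : (m.+1 <= E * s.+1)%N.
  by rewrite {1}(divn_eq m E) -/s mulnS mulnC -addnS addnC leq_add2r ltn_pmod.
have H2 : (m.+1 ^ C <= E ^ C * 2 ^ (s * C))%N.
  apply: leq_trans (_ : (E * s.+1) ^ C <= _)%N; first by case: (C) => // C'; rewrite leq_exp2r.
  rewrite expnMn leq_mul2l expnM; apply/orP; right.
  by case: (C) => // C'; rewrite leq_exp2r // ltn_expl.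
apply: leq_trans (_ : B * (E ^ C * 2 ^ (s * C)) <= _)%N; first by rewrite leq_mul2l H2 orbT.
rewrite mulnA; apply: leq_trans (_ : 2 ^ s * 2 ^ (s * C) <= _)%N.
  by rewrite leq_mul2r (leq_trans Hs) ?orbT // ltnW // ltn_expl.
rewrite -expnD leq_exp2l // -mulnS leq_divRL // -mulnA; exact: leq_trunc_div.
Qed.

(** * Vaughan's identity *)

Section Vaughan.
Variable Q : realquad.
Local Notation F := (rqF Q).
Local Notation d := (rqd Q).
Local Notation A := (quad d).
Local Notation q := #|F|.
Implicit Types n : A.

Definition ind (P : Prop) : int := if `[< P >] then 1 else 0.
Lemma ind1 (P : Prop) : P -> ind P = 1. Proof. by move=> H; rewrite /ind asboolT. Qed.
Lemma ind0 (P : Prop) : ~ P -> ind P = 0. Proof. by move=> H; rewrite /ind asboolF. Qed.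
Lemma ind_eq (P P' : Prop) : (P <-> P') -> ind P = ind P'.
Proof. by move=> H; rewrite /ind (asbool_equiv_eq H). Qed.

Variable m : nat.
Local Notation r := (size (PR Q m)).

Definition pr (i : 'I_r) : A := nth 0 (PR Q m) i.
Lemma pr_in i : pr i \in PR Q m. Proof. exact: mem_nth. Qed.
Lemma pr_prep i : prep (pr i). Proof. by have /mem_PR[] := pr_in i. Qed.
Lemma pr_prime i : primeq (pr i). Proof. by case: (pr_prep i). Qed.
Lemma pr_neq0 i : pr i != 0. Proof. by case: (pr_prime i). Qed.
Lemma pr_dg i : (0 < dg (pr i) <= m)%N.
Proof. by have /mem_PR[_ ->] := pr_in i; case: (pr_prime i) => _ ->. Qed.
Lemma pr_inj : injective pr.
Proof.
move=> i j H; apply: val_inj; apply/eqP.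
by rewrite -(nth_uniq 0 (ltn_ord i) (ltn_ord j) (uniq_PR Q m)); apply/eqP.
Qed.

Lemma sum_PR (V : nmodType) (f : A -> V) :
  \sum_(p <- PR Q m) f p = \sum_(i < r) f (pr i).
Proof. by rewrite (big_nth 0) big_mkord. Qed.

(** The squarefree elements, indexed by their sets of primes; the Moebius function of [bS X] is
    [(-1) ^+ #|X|]. *)
Definition bS (X : {set 'I_r}) : A := \prod_(i in X) pr i.
(** The index [j] stands for the exponent [j + 1]; the value of von Mangoldt's function at
    [cpow (i, j)] is [dg (pr i)]. *)
Definition cpow (ij : 'I_r * 'I_m) : A := pr ij.1 ^+ ij.2.+1.
Definition dgp (ij : 'I_r * 'I_m) : nat := (ij.2.+1 * dg (pr ij.1))%N.

Lemma prod_neq0 (I : finType) (P : pred I) (f : I -> A) :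
  (forall i, f i != 0) -> \prod_(i | P i) f i != 0.
Proof.
move=> H; elim/big_rec: _ => [|i x _ x0]; first exact: oner_neq0.
exact: quad_mulf_neq0.
Qed.
Lemma bS_neq0 X : bS X != 0. Proof. exact/prod_neq0/pr_neq0. Qed.
Lemma cpow_neq0 ij : cpow ij != 0. Proof. exact/quad_expf_neq0/pr_neq0. Qed.
Lemma dg_cpow ij : dg (cpow ij) = dgp ij.
Proof. by rewrite /cpow dgX ?pr_neq0 // mulnC. Qed.

Lemma vp_bS p (X : {set 'I_r}) : prep p -> vp p (bS X) = (\sum_(i in X) (p == pr i))%N.
Proof.
move=> pp; have [pp1 _] := pp; rewrite /bS.
suff [] : vp p (\prod_(i in X) pr i) = (\sum_(i in X) (p == pr i))%N /\ \prod_(i in X) pr i != 0 by [].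
elim/big_rec2: _ => [|i y x _ [IH x0]].
  by split; [exact: vp_unit (unitq1 _)|exact: oner_neq0].
by split; [rewrite vpM ?pr_neq0 // IH vp_prep //; exact: pr_prep|apply: quad_mulf_neq0; rewrite ?pr_neq0].
Qed.

Definition supp n : {set 'I_r} := [set i | (0 < vp (pr i) n)%N].

Lemma bS_dvd X n : n != 0 -> dvdq (bS X) n <-> X \subset supp n.
Proof.
move=> n0; rewrite dvdq_vp ?bS_neq0 //; split=> [H|H p pp].
  apply/subsetP => i iX; rewrite inE; apply: leq_trans (H _ (pr_prep i)).
  rewrite (vp_bS _ (pr_prep i)) (bigD1 i iX) /= eqxx; exact: leq_addr.
rewrite vp_bS //; case: (pickP [pred i in X | p == pr i]) => [i /andP[iX /eqP ->]|H0].
  rewrite (bigD1 i) //= eqxx big1 ?addn0; last first.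
    move=> j /andP[_ ji]; case: eqP => // /pr_inj E; by rewrite E eqxx in ji.
  by have := subsetP H i iX; rewrite inE.
by rewrite big1 // => i iX; have := H0 i; rewrite /= iX /= => ->.
Qed.

(** Expansion of the product over [i] of [1 - [i in X]]. *)
Lemma sum_sg_sub (X : {set 'I_r}) :
  \sum_(S : {set 'I_r}) (-1) ^+ #|S| * (if S \subset X then 1 else 0) =
  (if X == finset.set0 then 1 else 0) :> int.
Proof.
have := @bigA_distr int 0 1 *%R +%R 'I_r (fun i => - (if i \in X then 1 else 0)) (fun=> 1).
have -> : \prod_i (- (if i \in X then 1 else 0) + 1) = (if X == finset.set0 then 1 else 0) :> int.
  case: (set_0Vmem X) => [->|[i iX]].
    by rewrite eqxx big1 // => i _; rewrite inE oppr0 add0r.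
  rewrite (bigD1 i) //= iX addNr mul0r; case: eqP => // X0.
  by rewrite X0 inE in iX.
move=> ->; apply: eq_bigr => S _.
have [SX|/subsetPn[i iS iX]] := boolP (S \subset X).
  rewrite mulr1 -prodr_const big_mkcond /=; apply: eq_bigr => i _.
  by case: ifP => // iS; rewrite (subsetP SX).
by rewrite mulr0 (bigD1 i) //= iS (negPf iX) oppr0 mul0r.
Qed.

Lemma supp_eq0 n : n != 0 -> (dg n <= m)%N -> (supp n == finset.set0) = (dg n == 0%N).
Proof.
move=> n0 nm; have E := sum_vp_dg n0 nm; apply/eqP/eqP => H.
  rewrite -E big_seq big1 // => p pin.
  have [i Hi] : exists i : 'I_r, p = pr i.
    have ip : (index p (PR Q m) < r)%N by rewrite index_mem.
    by exists (Ordinal ip); rewrite /pr nth_index.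
  have : i \notin supp n by rewrite H inE.
  by rewrite inE -leqNgt leqn0 Hi => /eqP ->.
apply/setP => i; rewrite !inE; apply/negbTE; rewrite -leqNgt leqn0.
by rewrite (vp_unit (pr_prime i)) //; apply/unitqP; split.
Qed.

Lemma mobius n : n != 0 -> (dg n <= m)%N ->
  \sum_(S : {set 'I_r}) (-1) ^+ #|S| * ind (dvdq (bS S) n) = ind (dg n = 0%N).
Proof.
move=> n0 nm; transitivity (if supp n == finset.set0 then 1 else 0 : int).
  rewrite -sum_sg_sub; apply: eq_bigr => S _; congr (_ * _).
  by rewrite (ind_eq (bS_dvd S n0)) /ind asboolb.
by rewrite supp_eq0 // /ind -(asboolb (_ == _)); congr (if _ then _ else _); apply: asbool_equiv_eq; split=> /eqP.
Qed.

Lemma sum_ind_le (k v : nat) : (v <= k)%N -> (\sum_(j < k) (j < v))%N = v.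
Proof.
elim: k v => [|k IH] v vk; first by rewrite big_ord0; case: v vk.
rewrite big_ord_recr /=; case: (ltnP k v) => kv.
  have -> : v = k.+1 by lia.
  rewrite -[nat_of_bool true]/1%N addn1 (eq_bigr (fun=> 1%N)); last by move=> i _; rewrite ltnS (ltnW (ltn_ord i)).
  by rewrite sum_nat_const card_ord muln1.
by rewrite addn0 IH.
Qed.

Lemma cpow_dvd ij n : n != 0 -> dvdq (cpow ij) n <-> (ij.2 < vp (pr ij.1) n)%N.
Proof. by move=> n0; apply: vpP => //; apply: pr_prime. Qed.

Lemma vp_le n i : n != 0 -> (vp (pr i) n <= dg n)%N.
Proof.
move=> n0; have := (vpP (vp (pr i) n) (pr_prime i) n0).2 (leqnn _).
move=> /(dvdq_dg n0); rewrite dgX ?pr_neq0 //; apply: leq_trans; apply: leq_pmull.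
by case/andP: (pr_dg i).
Qed.

(** The convolution identity [Lambda * 1 = log], with the degree as logarithm: each prime
    contributes its degree once for every exponent up to its valuation. *)
Lemma sum_mangoldt n : n != 0 -> (dg n <= m)%N ->
  \sum_ij (dg (pr ij.1))%:Z * ind (dvdq (cpow ij) n) = (dg n)%:Z.
Proof.
move=> n0 nm; rewrite -[in RHS](sum_vp_dg n0 nm) sum_PR /=.
rewrite (big_morph Posz PoszD (erefl _)) -(pair_bigA _ (fun i j => (dg (pr i))%:Z * ind (dvdq (cpow (i, j)) n))) /=.
apply: eq_bigr => i _; rewrite PoszM -mulr_sumr [LHS]mulrC; congr (_ * _).
rewrite -[in RHS](@sum_ind_le m (vp (pr i) n)); last exact: leq_trans (vp_le i n0) nm.
rewrite (big_morph Posz PoszD (erefl _)); apply: eq_bigr => j _.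
by rewrite (ind_eq (cpow_dvd (i, j) n0)) /ind asboolb /=; case: ifP.
Qed.

(* Von Mangoldt's function, restricted to the prime powers of degree > u. *)
Definition mang (u : nat) n : int :=
  \sum_(ij | (u < dgp ij)%N) (dg (pr ij.1))%:Z * ind (assoc n (cpow ij)).

Lemma dvdq_mulI (x y z : A) : x != 0 -> dvdq (x * y) (x * z) <-> dvdq y z.
Proof.
move=> x0; split=> [[w]|[w ->]]; last by exists w; rewrite mulrA.
by rewrite -mulrA => /(quad_mulfI x0) ->; exists w.
Qed.

(** Moebius inversion at the cofactor [n / c]: the sum detects that it is a unit. *)
Lemma cofactor_mobius c n : c != 0 -> n != 0 -> (dg n <= m)%N ->
  \sum_(S : {set 'I_r}) (-1) ^+ #|S| * ind (dvdq (c * bS S) n) = ind (assoc n c).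
Proof.
move=> c0 n0 nm; have [[k Ek]|nc] := pselect (dvdq c n); last first.
  rewrite big1 ?ind0 //; first by move=> H; apply/nc/assoc_dvd/assoc_sym.
  move=> S _; rewrite ind0 ?mulr0 // => -[w Ew]; apply: nc; exists (bS S * w).
  by rewrite mulrA.
have k0 : k != 0 by apply: contra_neq n0; rewrite Ek => ->; rewrite mulr0.
have dn : dg n = (dg c + dg k)%N by rewrite Ek dgM.
transitivity (\sum_(S : {set 'I_r}) (-1) ^+ #|S| * ind (dvdq (bS S) k)).
  by apply: eq_bigr => S _; rewrite Ek (ind_eq (dvdq_mulI _ _ c0)).
rewrite mobius //; last by lia.
apply: ind_eq; split=> [dk|H].
  apply: assoc_sym; exists k => //; exact/unitqP.
have := assoc_dg H n0; lia.
Qed.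

(* Vaughan's identity at a single element: the last two sums are the type I remainder and the type II part. *)
Lemma vaughan_pt (u v : nat) n : n != 0 -> (dg n <= m)%N ->
  mang u n =
  \sum_(S : {set 'I_r} | (dg (bS S) <= v)%N)
     (-1) ^+ #|S| * ((dg n)%:Z - (dg (bS S))%:Z) * ind (dvdq (bS S) n)
  - \sum_(S : {set 'I_r} | (dg (bS S) <= v)%N) \sum_(ij | (dgp ij <= u)%N)
     (-1) ^+ #|S| * (dg (pr ij.1))%:Z * ind (dvdq (cpow ij * bS S) n)
  + \sum_(S : {set 'I_r} | (v < dg (bS S))%N) \sum_(ij | (u < dgp ij)%N)
     (-1) ^+ #|S| * (dg (pr ij.1))%:Z * ind (dvdq (cpow ij * bS S) n).
Proof.
move=> n0 nm; pose f (S : {set 'I_r}) ij : int := (-1) ^+ #|S| * (dg (pr ij.1))%:Z * ind (dvdq (cpow ij * bS S) n).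
have H1 : mang u n = \sum_(S : {set 'I_r}) \sum_(ij | (u < dgp ij)%N) f S ij.
  rewrite exchange_big; apply: eq_bigr => ij _ /=.
  rewrite -(cofactor_mobius (cpow_neq0 ij) n0 nm) mulr_sumr; apply: eq_bigr => S _.
  by rewrite /f mulrCA mulrA.
(* For [b = bS S] dividing [n], von Mangoldt's function summed over all prime powers dividing
   [n / b] gives [dg n - dg b]; the powers of degree at most [u] are then subtracted. *)
have H2 S : \sum_(ij | (u < dgp ij)%N) f S ij =
    (-1) ^+ #|S| * ((dg n)%:Z - (dg (bS S))%:Z) * ind (dvdq (bS S) n)
    - \sum_(ij | (dgp ij <= u)%N) f S ij.
  apply/eqP; rewrite -subr_eq opprK; apply/eqP.
  transitivity (\sum_ij f S ij).
    rewrite [RHS](bigID (fun ij => u < dgp ij)%N) /=; congr (_ + _).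
    by apply: eq_bigl => ij; rewrite -leqNgt.
  have [[k Ek]|nb] := pselect (dvdq (bS S) n); last first.
    rewrite ind0 // mulr0 big1 // => ij _; rewrite /f ind0 ?mulr0 // => -[w Ew].
    by apply: nb; exists (cpow ij * w); rewrite Ew -mulrA mulrCA.
  have k0 : k != 0 by apply: contra_neq n0; rewrite Ek => ->; rewrite mulr0.
  have dn : dg n = (dg (bS S) + dg k)%N by rewrite Ek dgM ?bS_neq0.
  rewrite ind1 ?mulr1; last by exists k.
  have -> : (dg n)%:Z - (dg (bS S))%:Z = (dg k)%:Z by lia.
  rewrite -sum_mangoldt //; last by lia.
  rewrite mulr_sumr; apply: eq_bigr => ij _; rewrite /f -mulrA; congr (_ * (_ * _)).
  by apply: ind_eq; rewrite Ek [cpow _ * _]mulrC; apply: dvdq_mulI; apply: bS_neq0.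
rewrite H1 (bigID (fun S => (dg (bS S) <= v)%N)) /= -sumrB; congr (_ + _).
  by apply: eq_bigr => S _; rewrite H2.
by apply: eq_bigl => S; rewrite -ltnNge.
Qed.

(** The number of divisors of [n] up to units, for [n] of degree at most [m]. *)
Definition tau n : nat := \prod_(i < r) (vp (pr i) n).+1.

Lemma tau_gt0 n : (0 < tau n)%N. Proof. by rewrite prodn_gt0. Qed.

Lemma card_bS_dvd n : n != 0 -> (#|[set X : {set 'I_r} | `[< dvdq (bS X) n >]]| <= tau n)%N.
Proof.
move=> n0; have -> : [set X : {set 'I_r} | `[< dvdq (bS X) n >]] = powerset (supp n).
  by apply/setP => X; rewrite !inE -(asboolb (X \subset _)); apply: asbool_equiv_eq; exact: bS_dvd.
rewrite card_powerset /tau (bigID (mem (supp n))) /= -prod_nat_const.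
rewrite -[X in (X <= _)%N]muln1; apply: leq_mul; last by rewrite prodn_gt0.
by apply: leq_prod => i; rewrite inE.
Qed.

(** Each such prime power has weight at least 1 in [sum_mangoldt], whose total is [dg n]. *)
Lemma card_cpow_dvd n : n != 0 -> (dg n <= m)%N ->
  (#|[set ij : 'I_r * 'I_m | `[< dvdq (cpow ij) n >]]| <= m)%N.
Proof.
move=> n0 nm; apply: leq_trans (nm); rewrite -lez_nat -(sum_mangoldt n0 nm).
rewrite -sum1_card (big_morph Posz PoszD (erefl _)) big_mkcond /=.
apply: ler_sum => ij _; rewrite inE /ind; case: ifP => _; last by rewrite mulr0.
by rewrite mulr1 lez_nat; case/andP: (pr_dg ij.1).
Qed.

Lemma vp_dvdq_le n e i : n != 0 -> dvdq e n -> (vp (pr i) e <= vp (pr i) n)%N.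
Proof. by move=> n0 en; apply: (dvdq_vp (dvdq_neq0 n0 en) n0).1 (pr_prep i). Qed.

Lemma tau_dvd n e : n != 0 -> dvdq e n -> (tau e <= tau n)%N.
Proof. by move=> n0 en; apply: leq_prod => i _; rewrite ltnS vp_dvdq_le. Qed.

Lemma assoc_vp n e : n != 0 -> e != 0 -> (dg n <= m)%N -> (dg e <= m)%N ->
  (forall i, vp (pr i) n = vp (pr i) e) -> assoc n e.
Proof.
move=> n0 e0 nm em H.
have key p : prep p -> vp p n = vp p e.
  move=> pp; have [pin|pn] := boolP (p \in PR Q m).
    have ip : (index p (PR Q m) < size (PR Q m))%N by rewrite index_mem.
    by have := H (Ordinal ip); rewrite /pr nth_index.
  have z x : x != 0 -> (dg x <= m)%N -> vp p x = 0%N.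
    move=> x0 xm; apply/eqP; rewrite -leqn0 leqNgt; apply: contra pn; exact: vp_big.
  by rewrite !z.
apply: dvdq_assoc => //; first by apply/dvdq_vp => // p pp; rewrite key.
by rewrite -(sum_vp_dg n0 nm) -(sum_vp_dg e0 em) !sum_PR; apply: eq_bigr => i _; rewrite H.
Qed.

Lemma assoc_same_shape e e' s t : Ex s t e -> Ex s t e' -> assoc e e' ->
  exists2 c, c != 0 & e' = qC d c * e.
Proof.
move=> [e0 a b] [e'0 a' b'] [z /unitqP[z0 _] E].
have := v1M e0 z0; have := v2M e0 z0; rewrite -E => h2 h1.
have [c c0 Hc] : exists2 c, c != 0 & z = qC d c by apply: v_unitC => //; lia.
by exists c => //; rewrite E Hc mulrC.
Qed.

(* A divisor of given shape is determined by its prime exponents up to a constant. *)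
Lemma size_div_shape n s t : n != 0 -> (dg n <= m)%N ->
  (size (fsv (fun e => Ex s t e /\ dvdq e n)) <= q * tau n)%N.
Proof.
move=> n0 nm; pose P e := Ex s t e /\ dvdq e n.
have bP : bdd P by apply: bdd_sub (@Ex_bdd Q s t) => x [].
pose T := {dffun forall i : 'I_r, 'I_(vp (pr i) n).+1}.
pose g (e : A) : T := [ffun i => inord (vp (pr i) e)].
have vg e i : P e -> g e i = vp (pr i) e :> nat.
  by move=> [_ en]; rewrite ffunE inordK // ltnS vp_dvdq_le.
(* [rp f] is one fixed divisor with exponent vector [f]; the others of this shape are constant
   multiples of it, and [cc] records the constant. *)
pose rp (f : T) : A := nth 0 [seq e <- fsv P | g e == f] 0.
have Prp e : P e -> P (rp (g e)) /\ g (rp (g e)) = g e.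
  move=> Pe; have : e \in [seq x <- fsv P | g x == g e].
    by rewrite mem_filter eqxx; apply/mem_fsv.
  rewrite /rp; case E : [seq x <- fsv P | g x == g e] => [//|x w] _ /=.
  have : x \in [seq x <- fsv P | g x == g e] by rewrite E mem_head.
  by rewrite mem_filter => /andP[/eqP -> /(mem_fsv _ bP)].
have ex_c e : P e -> exists c, e = qC d c * rp (g e).
  move=> Pe; have [Pr Er] := Prp _ Pe.
  have [[e0 _ _] en] := Pe; have [[r0 _ _] rn] := Pr.
  have [c _ Hc] : exists2 c, c != 0 & e = qC d c * rp (g e).
    apply: (assoc_same_shape Pr.1 Pe.1); apply: assoc_vp => //.
    - exact: leq_trans (dvdq_dg n0 rn) nm.
    - exact: leq_trans (dvdq_dg n0 en) nm.
    by move=> i; rewrite -(vg _ i Pr) -(vg _ i Pe) Er.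
  by exists c.
pose cc e : F := if pselect (P e) is left h then projT1 (cid (ex_c e h)) else 0.
have Hcc e : P e -> e = qC d (cc e) * rp (g e).
  by move=> Pe; rewrite /cc; case: pselect => // h; case: cid.
have -> : (q * tau n)%N = #|{: F * T}|.
  rewrite card_prod card_dep_ffun foldrE big_map big_enum /tau; congr (_ * _)%N.
  by apply: eq_bigr => i _; rewrite card_ord.
apply: (@size_fsv_inj _ _ (fun e => (cc e, g e))) => // x y Px Py [Ec Eg].
by rewrite (Hcc x Px) (Hcc y Py) Ec Eg.
Qed.

End Vaughan.

(** The finitely many primes of degree at most [2k] contribute a polynomial in [m]. The valuations
    at the larger ones sum to at most [m / (2k)], and [v + 1 <= 2^v]. Either part is at most
    [2^(m / (2k))]. *)
Lemma tau_bound (Q : realquad) (k : nat) : (0 < k)%N -> exists m0, forall m, (m0 <= m)%N ->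
  forall n : quad (rqd Q), n != 0 -> (dg n <= m)%N -> (tau m n <= 2 ^ (m %/ k))%N.
Proof.
move=> k0; pose D' := (2 * k)%N; have D0 : (0 < D')%N by rewrite muln_gt0.
pose C := size (PR Q D').
have [m0 Hm0] := poly_le_exp 1 C D0; exists m0 => m mm n n0 nm.
have -> : tau m n = (\prod_(p <- PR Q m) (vp p n).+1)%N.
  by rewrite (big_nth 0) big_mkord.
rewrite (bigID (fun p : quad (rqd Q) => dg p <= D')%N) /=.
apply: leq_trans (_ : 2 ^ (m %/ D') * 2 ^ (m %/ D') <= _)%N; last first.
  by rewrite -expnD leq_exp2l // addnn -mul2n leq_divRL // mulnAC mulnC leq_trunc_div.
apply: leq_mul.
  apply: leq_trans (Hm0 m mm); rewrite mul1n.
  rewrite -big_filter; set l := filter _ _.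
  apply: leq_trans (_ : \prod_(p <- l) m.+1 <= _)%N.
    rewrite big_seq [X in (_ <= X)%N]big_seq; apply: leq_prod => p.
    rewrite mem_filter => /andP[_ /mem_PR[[pp _] _]]; rewrite ltnS.
    have [p0 dp _] := pp; apply: leq_trans nm.
    have := (vpP (vp p n) pp n0).2 (leqnn _) => /(dvdq_dg n0); rewrite dgX //.
    by apply: leq_trans; apply: leq_pmull.
  rewrite big_const_seq count_predT iter_muln_1 leq_pexp2l //.
  apply: uniq_leq_size; first exact/filter_uniq/uniq_PR.
  by move=> p; rewrite mem_filter => /andP[pD /mem_PR[pp _]]; apply/mem_PR.
pose w := (\sum_(p <- PR Q m | ~~ (dg p <= D')%N) vp p n)%N.
apply: leq_trans (_ : 2 ^ w <= _)%N.
  rewrite /w expn_sum; apply: leq_prod => p _; exact: ltn_expl.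
rewrite leq_exp2l // leq_divRL //; apply: leq_trans (nm).
rewrite -(sum_vp_dg n0 nm) /w big_distrl /= big_mkcond; apply: leq_sum => p _.
by case: (leqP (dg p) D') => //= pD; rewrite leq_mul2l (ltnW pD) orbT.
Qed.

(** * The prime number theorem *)

Section PNT.
Variable Q : realquad.
Local Notation F := (rqF Q).
Local Notation d := (rqd Q).
Local Notation D := (rqD Q).
Local Notation A := (quad d).
Local Notation q := #|F|.
Local Notation rho := (rho Q).
Implicit Types n : A.

Lemma Ex_dg s (k : int) n : Ex s (k - s) n -> (dg n)%:Z = k.
Proof. by move=> [n0 h1 h2]; rewrite -v12 // h1 h2; lia. Qed.

Lemma Ex_mul s t n c : c != 0 -> Ex s t (c * n) <-> Ex (s - v1 c) (t - v2 c) n.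
Proof.
move=> c0; split=> [[cn0 h1 h2]|[n0 h1 h2]].
  have n0 : n != 0 by apply: contra_neq cn0 => ->; rewrite mulr0.
  by move: h1 h2; rewrite v1M // v2M // => h1 h2; split=> //; lia.
by split; [exact: quad_mulf_neq0|rewrite v1M // h1; lia|rewrite v2M // h2; lia].
Qed.

Lemma sum_Ex_dvd (V : nmodType) (f : A -> V) s t c : c != 0 ->
  \sum_(n <- fsv (fun n => Ex s t n /\ dvdq c n)) f n =
  \sum_(e <- fsv (Ex (s - v1 c) (t - v2 c))) f (c * e).
Proof.
move=> c0; apply: sum_fsv_map.
- exact: Ex_bdd.
- by apply: bdd_sub (@Ex_bdd Q s t) => x [].
- by move=> x y _ _ /(quad_mulfI c0).
move=> y; split=> [[Ey [z Ez]]|[x Hx ->]].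
  by exists z => //; apply/(Ex_mul _ _ _ c0); rewrite -Ez.
by split; [exact/Ex_mul|exists x].
Qed.

Lemma size_Ex_unit s t (z : A) : unitq z ->
  size (fsv (Ex (Q := Q) (s - v1 z) (t - v2 z))) = size (fsv (Ex (Q := Q) s t)).
Proof.
move=> uz; have [z0 _] := (unitqP z).1 uz; have [w zw] := uz.
rewrite !size_fsv_sum -(sum_Ex_dvd (fun=> 1%N) s t z0); congr (\sum_(i <- _) _)%N.
apply: eq_fsv => x; split=> [[]|] // Hx; split=> //.
by exists (w * x); rewrite mulrA zw mul1r.
Qed.

Definition fcnt (k s : int) : nat := size (fsv (Ex (Q := Q) s (k - s))).

Lemma fcnt_period k s : fcnt k (s + rho%:Z) = fcnt k s.
Proof.
have ue : unitq (qunit Q) by exists (qunitV Q); apply: qunit_inv.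
rewrite /fcnt -(size_Ex_unit (s + rho%:Z) (k - (s + rho%:Z)) ue) v1_qunit v2_qunit.
by congr (size (fsv (Ex _ _))); lia.
Qed.

(* Multiplication by the unit moves the shape (s, k - s) by (rho, - rho), so this counts the elements of
   degree k modulo powers of the unit. *)
Definition Fcnt (k s0 : int) : nat := (\sum_(i < rho) fcnt k (s0 + (i : nat)%:Z))%N.

Lemma Fcnt_shift1 k s0 : Fcnt k (s0 + 1) = Fcnt k s0.
Proof.
rewrite /Fcnt; have := fcnt_period k s0; case: (rho) (rho_gt0 Q) => // p _ E.
rewrite big_ord_recr [RHS]big_ord_recl [RHS]addnC; congr (_ + _)%N.
  by apply: eq_bigr => i _; congr (fcnt _ _); rewrite /= /bump; lia.
transitivity (fcnt k (s0 + p.+1%:Z)); first by congr (fcnt _ _); rewrite /=; lia.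
by rewrite E; congr (fcnt _ _); rewrite /=; lia.
Qed.

Lemma Fcnt_shift k s0 s1 : Fcnt k s1 = Fcnt k s0.
Proof.
have H j s : Fcnt k (s + (j : nat)%:Z) = Fcnt k s.
  elim: j => [|j IH]; first by rewrite addr0.
  by rewrite -IH -[RHS]Fcnt_shift1; congr (Fcnt _ _); lia.
case: (lerP s0 s1) => Hs.
  by rewrite -(H `|s1 - s0|%N s0); congr (Fcnt _ _); lia.
by rewrite -(H `|s0 - s1|%N s1); congr (Fcnt _ _); lia.
Qed.

Lemma Ex_neg (s t : int) : s + t < 0 -> fsv (Ex (Q := Q) s t) = [::].
Proof.
move=> st; apply/nilP; rewrite /nilp -leqn0 leqNgt -has_predT.
apply/hasPn => x /(mem_fsv _ (@Ex_bdd Q s t))[x0 h1 h2].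
by have := v12 x0; lia.
Qed.

Lemma Fcnt_neg k s0 : k < 0 -> Fcnt k s0 = 0%N.
Proof. by move=> k0; rewrite /Fcnt big1 // => i _; rewrite /fcnt Ex_neg //; lia. Qed.

(** The logarithmic derivative of the zeta function, read on coefficients: the degree [k] of each
    element is expanded by [sum_mangoldt], and then the cofactors of each prime power are
    counted. *)
Lemma Fcnt_rec (m k : nat) : (k <= m)%N ->
  (k * Fcnt k%:Z 0 = \sum_ij dg (@pr Q m ij.1) * Fcnt (k%:Z - (dgp ij)%:Z) 0)%N.
Proof.
move=> km; transitivity (\sum_(i < rho) \sum_ij dg (@pr Q m ij.1) *
    fcnt (k%:Z - (dgp ij)%:Z) ((i : nat)%:Z - v1 (cpow ij)))%N; last first.
  rewrite exchange_big; apply: eq_bigr => ij _ /=; rewrite -big_distrr /=; congr (_ * _)%N.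
  (* Division by a prime power moves the window of shapes by its [v1], which leaves the count
     unchanged. *)
  rewrite -(Fcnt_shift _ 0 (- v1 (cpow ij))) /Fcnt; apply: eq_bigr => i _.
  by congr (fcnt _ _); lia.
rewrite /Fcnt big_distrr /=; apply: eq_bigr => i _; rewrite add0r.
set s := (i : nat)%:Z; apply/eqP; rewrite -eqz_nat; apply/eqP.
transitivity (\sum_(n <- fsv (Ex (Q := Q) s (k%:Z - s)))
    \sum_ij (dg (@pr Q m ij.1))%:Z * ind (dvdq (cpow ij) n)).
  rewrite /fcnt mulnC PoszM -sum1_size (big_morph Posz PoszD (erefl _)) big_distrl /=.
  apply: eq_big_seq => n /(mem_fsv _ (@Ex_bdd Q _ _)) Hn.
  have dn := Ex_dg Hn; have [n0 _ _] := Hn.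
  by rewrite mul1r sum_mangoldt // ?dn //; lia.
rewrite exchange_big /= (big_morph Posz PoszD (erefl _)); apply: eq_bigr => ij _.
rewrite -mulr_sumr PoszM; congr (_ * _).
have c0 := cpow_neq0 ij.
rewrite /fcnt -sum1_size (big_morph Posz PoszD (erefl _)).
have -> : k%:Z - (dgp ij)%:Z - (s - v1 (cpow ij)) = k%:Z - s - v2 (cpow ij).
  by rewrite -dg_cpow -(v12 c0); lia.
rewrite -(sum_Ex_dvd (fun=> 1) s (k%:Z - s) c0).
rewrite [RHS](@sum_fsv_sub _ _ (Ex s (k%:Z - s))).
- apply: eq_big_seq => n /(mem_fsv _ (@Ex_bdd Q _ _)) Hn.
  by rewrite /ind; congr (if _ then _ else _); apply: asbool_equiv_eq; split=> [|[]].
- by move=> x [].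
exact: Ex_bdd.
Qed.

(** From this degree on, the [rho] shapes starting at the middle have both degrees beyond [D], as
    [size_Ex] requires. *)
Definition k0 : nat := (2 * (D + rho + 2))%N.

Lemma Fcnt_large (k : nat) : (k0 <= k)%N ->
  Fcnt k%:Z 0 = (rho * (q - 1) ^ 2 * q ^ (k - D))%N.
Proof.
move=> kk; rewrite -(Fcnt_shift _ _ (k./2)%:Z) /Fcnt.
rewrite (eq_bigr (fun=> (q - 1) ^ 2 * q ^ (k - D))%N).
  by rewrite sum_nat_const card_ord mulnA.
move=> i _; rewrite /fcnt size_Ex; try (have := odd_double_half k; have := ltn_ord i; move: kk; rewrite /k0; lia).
by congr (_ * _ ^ _)%N; move: kk; rewrite /k0; lia.
Qed.

(** * Normalized counts and a lower bound of Chebyshev type *)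

Local Notation qr := (q%:R : rat).

Lemma qr_gt0 : 0 < qr. Proof. by rewrite ltr0n; exact: (q_gt0 Q). Qed.

Definition gcnt (k : nat) : rat := (Fcnt k%:Z 0)%:R / qr ^+ k.
Definition kappa : rat := (rho * (q - 1) ^ 2)%:R / qr ^+ D.

Lemma kappa_gt0 : 0 < kappa.
Proof.
rewrite divr_gt0 ?exprn_gt0 ?qr_gt0 // ltr0n muln_gt0 rho_gt0 expn_gt0 subn_gt0.
by have := q_gt1 Q => ->.
Qed.

Lemma gcnt_ge0 k : 0 <= gcnt k.
Proof. by rewrite divr_ge0 // exprn_ge0 // ltW // qr_gt0. Qed.

Lemma gcnt_large k : (k0 <= k)%N -> gcnt k = kappa.
Proof.
move=> kk; rewrite /gcnt Fcnt_large // /kappa natrM natrX.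
have -> : qr ^+ k = qr ^+ (k - D) * qr ^+ D.
  by rewrite -exprD subnK //; move: kk; rewrite /k0; lia.
have q0 : qr != 0 by rewrite gt_eqF ?qr_gt0.
by rewrite invfM mulrA mulfK ?expf_neq0.
Qed.

Lemma k0_ge : (2 * rho + 4 <= k0)%N.
Proof. by rewrite /k0; lia. Qed.
Opaque k0.

Lemma gcnt_bounded : exists2 B : rat, 0 < B & forall k, gcnt k <= B.
Proof.
exists (kappa + \sum_(i < k0) gcnt i).
  by apply: ltr_pwDl; [exact: kappa_gt0|apply: sumr_ge0 => i _; exact: gcnt_ge0].
move=> k; case: (leqP k0 k) => kk.
  by rewrite gcnt_large // lerDl sumr_ge0 // => i _; exact: gcnt_ge0.
rewrite (bigD1 (Ordinal kk)) //= addrCA lerDl; apply: addr_ge0; first exact: ltW kappa_gt0.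
by apply: sumr_ge0 => i _; exact: gcnt_ge0.
Qed.

Definition ywt m (ij : 'I_(size (PR Q m)) * 'I_m) : rat := (dg (pr ij.1))%:R / qr ^+ dgp ij.

Lemma ywt_ge0 m ij : 0 <= @ywt m ij.
Proof. by rewrite divr_ge0 // exprn_ge0 // ltW // qr_gt0. Qed.

Lemma gcnt_rec m k : (k <= m)%N ->
  k%:R * gcnt k = \sum_(ij | (dgp ij <= k)%N) @ywt m ij * gcnt (k - dgp ij).
Proof.
move=> km; rewrite /gcnt mulrA -natrM (Fcnt_rec km) natr_sum mulr_suml.
rewrite (bigID (fun ij => dgp ij <= k)%N) /= [X in _ + X]big1 ?addr0; last first.
  by move=> ij kij; rewrite Fcnt_neg ?muln0 ?mul0r //; lia.
apply: eq_bigr => ij kij; rewrite natrM /ywt.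
have -> : k%:Z - (dgp ij)%:Z = (k - dgp ij)%N%:Z by lia.
have -> : qr ^+ k = qr ^+ dgp ij * qr ^+ (k - dgp ij) by rewrite -exprD subnKC.
by rewrite invfM mulrACA.
Qed.

Definition psicnt m l : nat := (\sum_(ij | dgp ij == l) dg (@pr Q m ij.1))%N.

(** The recursion is compared at degrees [J + k0] and [m = J + k0 + 1]. Prime powers of degree at
    most [J] leave a cofactor of degree at least [k0], so they carry the same weight in both, at
    most [(J + k0) kappa] by the first. The second then leaves at least [kappa] for the degrees in
    [(J, m]], so one of these [k0 + 1] degrees has positive density. *)
Lemma psicnt_window : exists2 C : nat, (0 < C)%N & forall J, exists l,
  (J < l <= J + k0 + 1)%N /\ (q ^ l <= C * psicnt (J + k0 + 1) l)%N.
Proof.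
have [B B0 HB] := gcnt_bounded; have K0 := kappa_gt0.
pose x := B * (k0.+1)%:R / kappa.
have x0 : 0 < x by rewrite divr_gt0 // mulr_gt0 // ltr0n.
have Cx := archi_boundP (ltW x0); set C := Num.bound x in Cx.
exists C; first by rewrite -(ltr0n rat); exact: lt_trans x0 Cx.
move=> J; set m := (J + k0 + 1)%N; have Em : m = (J + k0 + 1)%N by [].
apply: contrapT => /forallNP Hno.
have Hl l : (J < l <= m)%N -> (C * psicnt m l < q ^ l)%N.
  by move=> Hl; rewrite ltnNge; apply/negP => H; exact: (Hno l (conj Hl H)).
pose Y := \sum_(ij | (dgp ij <= J)%N) @ywt m ij.
pose Z := \sum_(ij | (J < dgp ij <= m)%N) @ywt m ij.
have HY : kappa * Y <= (J + k0)%:R * kappa.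
  have km : (J + k0 <= m)%N by rewrite /m leq_addr.
  rewrite -{2}(gcnt_large (leq_addl J k0)) (gcnt_rec km) /Y mulr_sumr.
  rewrite [leRHS](bigID (fun ij => dgp ij <= J)%N) /= -[leLHS]addr0 lerD //; last first.
    by apply: sumr_ge0 => ij _; rewrite mulr_ge0 ?ywt_ge0 ?gcnt_ge0.
  rewrite le_eqVlt; apply/orP; left; apply/eqP; apply: eq_big => ij.
    by apply/idP/andP => [H|[]//]; split=> //; lia.
  move=> H; have kd : (k0 <= J + k0 - dgp ij)%N by lia.
  by rewrite (gcnt_large kd) [RHS]mulrC.
have HM : m%:R * kappa <= kappa * Y + B * Z.
  rewrite -{1}(@gcnt_large m) ?(gcnt_rec (leqnn m)); last by rewrite /m; lia.
  rewrite (bigID (fun ij => dgp ij <= J)%N) /= lerD //.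
    rewrite /Y mulr_sumr le_eqVlt; apply/orP; left; apply/eqP; apply: eq_big => ij.
      by apply/andP/idP => [[_ ->]//|H]; split; [apply: leq_trans H _; rewrite /m -addnA leq_addr|exact: H].
    case/andP=> _ H; have kd : (k0 <= m - dgp ij)%N by lia.
    by rewrite (gcnt_large kd) [RHS]mulrC.
  rewrite /Z mulr_sumr [leRHS](eq_bigl (fun ij => (dgp ij <= m) && ~~ (dgp ij <= J))%N); last first.
    by move=> ij; rewrite -ltnNge andbC.
  by apply: ler_sum => ij _; rewrite mulrC ler_wpM2r ?ywt_ge0.
have HZ : Z * C%:R <= (k0.+1)%:R.
  have -> : Z = \sum_(i < k0.+1) (psicnt m (J + i.+1)%N)%:R / qr ^+ (J + i.+1)%N.
    rewrite /Z /psicnt; under [RHS]eq_bigr do rewrite natr_sum mulr_suml big_mkcond.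
    rewrite exchange_big /= [LHS]big_mkcond; apply: eq_bigr => ij _.
    case: ifP => [H|H].
      have lt : (dgp ij - J.+1 < k0.+1)%N by lia.
      rewrite (bigD1 (Ordinal lt)) //= big1 ?addr0.
        have -> : (J + (dgp ij - J.+1).+1 = dgp ij)%N by lia.
        by rewrite eqxx.
      move=> i /eqP ni; case: eqP => // E; case: ni; apply: val_inj => /=; lia.
    rewrite big1 // => i _; case: eqP => // E; have := ltn_ord i; lia.
  rewrite mulr_suml -[leRHS]mulr_natl.
  apply: le_trans (_ : \sum_(i < k0.+1) (1 : rat) <= _); last by rewrite sumr_const card_ord mulr1.
  apply: ler_sum => i _; rewrite mulrAC ler_pdivrMr ?exprn_gt0 ?qr_gt0 // mul1r.
  rewrite -natrX -natrM ler_nat mulnC ltnW // Hl //.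
  by have := ltn_ord i; lia.
have H1 : kappa <= B * Z.
  have -> : kappa = m%:R * kappa - (J + k0)%:R * kappa.
    by rewrite -mulrBl /m natrD addrAC subrr add0r mul1r.
  rewrite lerBlDr addrC; apply: le_trans HM _; by rewrite lerD2r.
have H2 : kappa * C%:R <= B * (k0.+1)%:R.
  apply: le_trans (_ : B * Z * C%:R <= _); first by rewrite ler_wpM2r.
  by rewrite -mulrA ler_pM2l.
have : x < x; last by rewrite ltxx.
apply: lt_le_trans Cx _; rewrite /x ler_pdivlMr // mulrC //.
Qed.

(** Each prime power of degree [l] has a balanced representative in one of [rho] shapes around the
    middle, so one of these shapes carries at least the fraction [1 / rho] of the weight. *)
Lemma mang_window : exists2 C : nat, (0 < C)%N & forall J u, (u <= J)%N -> exists (l : nat) (s : int),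
  [/\ (J < l <= J + k0 + 1)%N, 0 <= 2 * s - l%:Z < (rho.*2)%:Z &
   (q ^ l)%N%:Z <= C%:Z * \sum_(n <- fsv (Ex (Q := Q) s (l%:Z - s))) mang (J + k0 + 1) u n].
Proof.
have [C C0 HC] := psicnt_window; exists (C * rho)%N; first by rewrite muln_gt0 C0 rho_gt0.
move=> J u uJ; have [l [Jl Hl]] := HC J; set m := (J + k0 + 1)%N in Jl Hl *.
pose s (i : nat) : int := (uphalf l)%:Z + i%:Z.
pose X (i : 'I_rho) := \sum_(n <- fsv (Ex (Q := Q) (s i) (l%:Z - s i))) mang m u n.
have HX : (psicnt m l)%:Z <= \sum_i X i.
  rewrite /psicnt (big_morph Posz PoszD (erefl _)) /X /mang.
  under [leRHS]eq_bigr do rewrite exchange_big /=.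
  rewrite [leRHS]exchange_big /= big_mkcond [leRHS]big_mkcond /=.
  apply: ler_sum => ij _; case: eqP => [E|_]; last first.
    case: ifP => // _; apply: sumr_ge0 => i _; apply: sumr_ge0 => n _.
    by rewrite mulr_ge0 // /ind; case: ifP.
  rewrite E; have -> : (u < l)%N by lia.
  have c0 := cpow_neq0 ij; set c := cpow ij in c0 *.
  have [ac] := rep_spec c0; rewrite /balanced => bc.
  have r0 := rep_neq0 c0; have V := v12 r0; rewrite dg_rep // dg_cpow E in V.
  have il : (`|v1 (rep c) - (uphalf l)%:Z|%N < rho)%N.
    by move: bc V; have := odd_double_half l; rewrite uphalf_half; case: odd; lia.
  have sE : s `|v1 (rep c) - (uphalf l)%:Z|%N = v1 (rep c).
    by rewrite /s; move: bc V; have := odd_double_half l; rewrite uphalf_half; case: odd; lia.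
  have rin : rep c \in fsv (Ex (Q := Q) (s (Ordinal il)) (l%:Z - s (Ordinal il))).
    by apply/(mem_fsv _ (@Ex_bdd Q _ _)); rewrite /= sE; split; [exact: r0|reflexivity|lia].
  rewrite (bigD1 (Ordinal il)) //= (bigD1_seq _ rin (fsv_uniq _)) /=.
  rewrite ind1 ?mulr1; last exact: assoc_sym.
  rewrite -addrA lerDl addr_ge0 //; first by apply: sumr_ge0 => n _; rewrite mulr_ge0 // /ind; case: ifP.
  by apply: sumr_ge0 => i _; apply: sumr_ge0 => n _; rewrite mulr_ge0 // /ind; case: ifP.
have [i Hi] : exists i : 'I_rho, (psicnt m l)%:Z <= rho%:Z * X i.
  apply: contrapT => /forallNP Hno.
  have : rho%:Z * \sum_i X i < rho%:Z * (psicnt m l)%:Z.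
    rewrite mulr_sumr.
    apply: lt_le_trans (_ : \sum_(i < rho) (psicnt m l)%:Z <= _).
      apply: ltr_sum; first by apply/hasP; exists (Ordinal (rho_gt0 Q)); rewrite ?mem_index_enum.
      by move=> i _; rewrite ltNge; apply/negP/Hno.
    by rewrite sumr_const card_ord -[leLHS]mulr_natl natz.
  by rewrite ltr_pM2l ?ltz_nat ?rho_gt0 // ltNge HX.
exists l, (s i); split=> //.
  rewrite /s; have := ltn_ord i; have := odd_double_half l; rewrite uphalf_half; case: odd; lia.
apply: le_trans (_ : (C * psicnt m l)%N%:Z <= _); first by rewrite lez_nat.
by rewrite !PoszM -mulrA ler_wpM2l.
Qed.

End PNT.
#[global] Opaque k0.

Lemma cauchy_schwarz_seq (T : Type) (s : seq T) (f g : T -> int) :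
  (\sum_(x <- s) f x * g x) ^+ 2 <= (\sum_(x <- s) f x ^+ 2) * (\sum_(x <- s) g x ^+ 2).
Proof.
elim: s => [|x s IH]; first by rewrite !big_nil expr0n mulr0.
rewrite !big_cons; move: IH.
set a := f x; set b := g x; set S := \sum_(_ <- _) _; set U := \sum_(_ <- _) f _ ^+ 2.
set V := \sum_(_ <- _) g _ ^+ 2 => IH.
have U0 : 0 <= U by apply: sumr_ge0 => i _; exact: sqr_ge0.
have V0 : 0 <= V by apply: sumr_ge0 => i _; exact: sqr_ge0.
(* The cross term is bounded by multiplying with [V] and completing a square, since the sums are
   integers. *)
have H : 2 * (a * b * S) <= a ^+ 2 * V + U * b ^+ 2.
  have [V00|Vn] := eqVneq V 0.
    have S0 : S = 0.
      by apply/eqP; rewrite -sqrf_eq0 eq_le sqr_ge0 andbT (le_trans IH) // V00 mulr0.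
    by rewrite S0 !mulr0 V00 mulr0 add0r mulr_ge0 ?sqr_ge0.
  have Vp : 0 < V by rewrite lt_def Vn.
  rewrite -(ler_pM2l Vp) -subr_ge0.
  have -> : V * (a ^+ 2 * V + U * b ^+ 2) - V * (2 * (a * b * S)) =
     (a * V - b * S) ^+ 2 + b ^+ 2 * (U * V - S ^+ 2) by ring.
  by rewrite addr_ge0 ?sqr_ge0 // mulr_ge0 ?sqr_ge0 // subr_ge0.
rewrite -subr_ge0.
have -> : (a ^+ 2 + U) * (b ^+ 2 + V) - (a * b + S) ^+ 2 =
  (a ^+ 2 * V + U * b ^+ 2 - 2 * (a * b * S)) + (U * V - S ^+ 2) by ring.
by rewrite addr_ge0 // subr_ge0.
Qed.

(** * Type I and type II sums *)

Section Analytic.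
Variable Q : realquad.
Local Notation F := (rqF Q).
Local Notation d := (rqd Q).
Local Notation D := (rqD Q).
Local Notation A := (quad d).
Local Notation q := #|F|.
Local Notation rho := (rho Q).
Implicit Types n : A.

(* A real-valued substitute for additive characters: the sum over the nontrivial scalars of psi(c v). *)
Definition eps (v : F) : int := if v == 0 then q%:Z - 1 else -1.

Lemma sum_eps0 : \sum_(c : F) eps c = 0.
Proof.
rewrite (bigD1 0) //= /eps eqxx (eq_bigr (fun=> -1)); last by move=> c /negPf ->.
rewrite sumr_const -mulr_natl natz.
have -> : #|(fun c : F => c != 0)| = q.-1 by rewrite -(cardC1 (0 : F)); apply: eq_card.
have := q_gt1 Q; case: q => // p _; lia.
Qed.

Lemma eps_norm v : `|eps v| <= q%:Z.
Proof. by rewrite /eps; have := q_gt1 Q; case: eqP => _; lia. Qed.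

(** Translation by an element of [P] at which [l] takes the value [c] shows that the sum of
    [eps (l n + c)] does not depend on [c]; over all [c] the values of [eps] cancel. *)
Lemma esum_zero (P : A -> Prop) (l : A -> F) : bdd P -> subsp P -> lin l ->
  (exists2 n, P n & l n != 0) -> \sum_(n <- fsv P) eps (l n) = 0.
Proof.
move=> bP sP ll [w Pw lw].
have shift c : \sum_(n <- fsv P) eps (l n + c) = \sum_(n <- fsv P) eps (l n).
  pose z := qC d (c / l w) * w; have Pz : P z by apply: subspC.
  rewrite [RHS](@sum_fsv_map _ _ P P (fun n => n + z) (fun n => eps (l n)) bP bP).
  - by apply: eq_bigr => n _; rewrite linD // linC // divfK.
  - by move=> x y _ _ /addIr.
  move=> y; split=> [Py|[x Px ->]]; last exact: subspD.
  by exists (y - z); [exact: subspB|rewrite subrK].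
have : \sum_(c : F) \sum_(n <- fsv P) eps (l n + c) = 0.
  rewrite exchange_big big1 // => n _; apply: etrans sum_eps0.
  by rewrite (reindex_inj (addrI (- l n))) /=; apply: eq_bigr => c _; rewrite addrA subrr add0r.
under eq_bigr do rewrite shift.
rewrite sumr_const => /eqP; rewrite mulrn_eq0 => /orP[/eqP c0|/eqP //].
by have := q_gt0 Q; rewrite -c0; rewrite (eq_card (_ : _ =i F)) // ltnn.
Qed.

Lemma esum_full (P : A -> Prop) (l : A -> F) : bdd P ->
  (forall n, P n -> l n = 0) -> \sum_(n <- fsv P) eps (l n) = (q%:Z - 1) * (size (fsv P))%:Z.
Proof.
move=> bP H; rewrite big_seq (eq_bigr (fun=> q%:Z - 1)); last first.
  by move=> n /(mem_fsv _ bP)/H ->; rewrite /eps eqxx.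
by rewrite -big_seq big_const_seq count_predT iter_addr_0 -mulr_natr natz.
Qed.

Lemma esum_le (P : A -> Prop) (l : A -> F) :
  `|\sum_(n <- fsv P) eps (l n)| <= q%:Z * (size (fsv P))%:Z.
Proof.
apply: le_trans (ler_norm_sum _ _ _) _.
apply: le_trans (ler_sum _ (fun n _ => eps_norm (l n))) _.
by rewrite big_const_seq count_predT iter_addr_0 -mulr_natr natz.
Qed.

(** [eps (l2 n)] is [q] times the indicator of the kernel of [l2], minus 1, and a form vanishing on
    that kernel is a multiple of [l2]; so [esum_zero] applies to [l1] on the kernel and on [P]. *)
Lemma esum_pair (P : A -> Prop) (l1 l2 : A -> F) : bdd P -> subsp P -> lin l1 -> lin l2 ->
  ~ (exists c, forall n, P n -> l1 n = c * l2 n) ->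
  \sum_(n <- fsv P) eps (l1 n) * eps (l2 n) = 0.
Proof.
move=> bP sP L1 L2 H; pose P' n := P n /\ l2 n = 0.
have bP' : bdd P' by apply: bdd_sub bP => x [].
have sP' : subsp P'.
  split; first by split; [case: sP|exact: lin0].
  move=> c x y [Px lx] [Py ly]; split; first by case: sP => _; apply.
  by rewrite L2 lx ly mulr0 addr0.
have [w [Pw lw] l1w] : exists2 w, P' w & l1 w != 0.
  apply: contrapT => Hn; apply: H.
  have H0 w : P' w -> l1 w = 0.
    by move=> Pw; apply: contrapT => /eqP lw; apply: Hn; exists w.
  have [[w Pw lw]|Hz] := pselect (exists2 w, P w & l2 w != 0); last first.
    exists 0 => n Pn; rewrite mul0r; apply: H0; split=> //.
    by apply: contrapT => /eqP ln; apply: Hz; exists n.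
  exists (l1 w / l2 w) => n Pn.
  have := H0 (n - qC d (l2 n / l2 w) * w); rewrite !linB // !linC // => Hl.
  apply/eqP; rewrite -subr_eq0; apply/eqP; rewrite -Hl; first by ring.
  by split; [apply: subspB => //; apply: subspC|rewrite linB // linC // divfK // subrr].
have -> : \sum_(n <- fsv P) eps (l1 n) * eps (l2 n) =
   q%:Z * \sum_(n <- fsv P') eps (l1 n) - \sum_(n <- fsv P) eps (l1 n).
  rewrite (@sum_fsv_sub _ _ P P') // ?mulr_sumr -?sumrB; last by move=> x [].
  apply: eq_big_seq => n /(mem_fsv _ bP) Pn; rewrite /P' {2}/eps.
  case: (eqVneq (l2 n) 0) => E; first by rewrite asboolT //; ring.
  rewrite asboolF; last by case=> _ /eqP; rewrite (negPf E).
  by ring.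
rewrite !esum_zero ?mulr0 ?subrr //; last by exists w.
by exists w.
Qed.

(** * Sums twisted by a linear form *)

Variable B : A -> F.
Hypothesis B_lin : lin B.

Lemma B_mull k : lin (fun e => B (k * e)).
Proof. by move=> c x y /=; rewrite mulrDr mulrCA B_lin. Qed.
Lemma B_mulr k : lin (fun e => B (e * k)).
Proof. by move=> c x y /=; rewrite mulrDl -mulrA B_lin. Qed.

(** For [B = resB] these are the denominators of good approximations to [(x1, x2)], by
    [resB_near]. *)
Definition KK (X Y : nat) k := inV X k /\ forall e, inV Y e -> B (k * e) = 0.

Lemma KK_bdd X Y : bdd (KK X Y). Proof. by exists X => n []. Qed.
Lemma KK_subsp X Y : subsp (KK X Y).
Proof.
split; first by split=> [|e _]; [exact: inV0|rewrite mul0r; exact: lin0].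
move=> c x y [Hx Bx] [Hy By]; split; first by apply: inVD => //; apply: inVC.
by move=> e He; rewrite (B_mulr e) Bx // By // mulr0 addr0.
Qed.

Lemma B_monomials (k : A) (R2 : nat) :
  (forall i, (i < R2)%N -> B (k * ('X^i, 0)) = 0) ->
  (forall i, (i < R2 - D)%N -> B (k * (0, 'X^i)) = 0) ->
  forall e, inV R2 e -> B (k * e) = 0.
Proof.
move=> H1 H2 e /andP[s1 s2].
have lsum (I : Type) (r : seq I) (f : I -> A) : B (k * \sum_(i <- r) f i) = \sum_(i <- r) B (k * f i).
  elim: r => [|i r IH]; first by rewrite !big_nil mulr0 lin0.
  by rewrite !big_cons mulrDr linD // IH.
have -> : e = \sum_(i <- iota 0 R2) qC d (e.1)`_i * (('X^i, 0) : A) +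
              \sum_(i <- iota 0 (R2 - D)) qC d (e.2)`_i * ((0, 'X^i) : A).
  have fst_sum (r : seq nat) (f : nat -> A) : (\sum_(i <- r) f i).1 = \sum_(i <- r) (f i).1.
    by elim: r => [|i r IH]; rewrite ?big_nil // !big_cons /= IH.
  have snd_sum (r : seq nat) (f : nat -> A) : (\sum_(i <- r) f i).2 = \sum_(i <- r) (f i).2.
    by elim: r => [|i r IH]; rewrite ?big_nil // !big_cons /= IH.
  have pol (p : {poly F}) N : (size p <= N)%N -> p = \sum_(i <- iota 0 N) p`_i *: 'X^i.
    move=> pN.
    have -> : iota 0 N = index_iota 0 N by rewrite /index_iota subn0.
    rewrite big_mkord -poly_def; apply/polyP => i; rewrite coef_poly.
    by case: ltnP => // Ni; rewrite nth_default // (leq_trans pN).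
  apply: quad_eqP.
    rewrite -[(_ + _).1]/(_.1 + _.1) !fst_sum [X in _ + X]big1 ?addr0; last first.
      by move=> i _; rewrite qCM /= scaler0.
    by rewrite {1}(pol _ _ s1); apply: eq_bigr => i _; rewrite qCM.
  rewrite -[(_ + _).2]/(_.2 + _.2) !snd_sum [X in X + _]big1 ?add0r; last first.
    by move=> i _; rewrite qCM /= scaler0.
  by rewrite {1}(pol _ _ s2); apply: eq_bigr => i _; rewrite qCM.
rewrite mulrDr linD // !lsum !big1_seq ?addr0 //.
  move=> i /=; rewrite mem_iota => /andP[_ i2].
  by rewrite mulrCA linC // H2 ?mulr0.
move=> i /=; rewrite mem_iota => /andP[_ i2].
by rewrite mulrCA linC // H1 ?mulr0.
Qed.

Lemma sum_eq_le (x : A) (Hs : seq A) n (b : int) : 0 <= b -> uniq Hs -> x != 0 ->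
  \sum_(h <- Hs) (if x * h == n then b else 0) <= (if `[< dvdq x n >] then b else 0).
Proof.
move=> b0 uH x0; have [[h hin /eqP hE]|Hn] := pselect (exists2 h, h \in Hs & x * h == n).
  rewrite (bigD1_seq h) //= hE eqxx asboolT; last by exists h.
  rewrite big1 ?addr0 // => h' h'h; case: eqP => // E.
  by rewrite -hE in E; rewrite (quad_mulfI x0 E) eqxx in h'h.
rewrite big1_seq; first by case: ifP.
by move=> h /= hin; case: ifP => // E; case: Hn; exists h.
Qed.

Lemma sum_KK_shift (I : finType) (P : pred I) (c : I -> A) (x : A) X Z :
  (forall i j, P i -> P j -> c i = c j -> i = j) ->
  \sum_(i | P i) ind (KK X Z (c i - x)) <= (size (fsv (KK X Z)))%:Z.
Proof.
move=> ci; pose s := [seq c i - x | i <- enum [pred i | P i && `[< KK X Z (c i - x) >]]].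
have us : uniq s.
  rewrite map_inj_in_uniq ?enum_uniq // => i j; rewrite !mem_enum !inE.
  by move=> /andP[Pi _] /andP[Pj _] /addIr; apply: ci.
have -> : \sum_(i | P i) ind (KK X Z (c i - x)) = (size s)%:Z.
  rewrite size_map -cardE -sum1_card (big_morph Posz PoszD (erefl _)) big_mkcondr /=.
  by apply: eq_bigr => i _; rewrite /ind; case: ifP.
rewrite lez_nat; apply: uniq_leq_size => // y /mapP[i].
rewrite mem_enum inE => /andP[_ /asboolP Hk] ->; apply/mem_fsv => //; exact: KK_bdd.
Qed.

(** The sum is nonzero only if [B (c1 n) = l B (c2 n)] on the box for some scalar [l], that is, if
    [c1 - l c2] lies in [KK X Z]. *)
Lemma pair_sum_le (c1 c2 : A) X Z : inV X c1 -> inV X c2 ->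
  `|\sum_(n <- fsv (inV (Q := Q) Z)) eps (B (c1 * n)) * eps (B (c2 * n))| <=
  q%:Z ^+ 2 * (size (fsv (inV (Q := Q) Z)))%:Z * \sum_(l : F) ind (KK X Z (c1 - qC d l * c2)).
Proof.
move=> X1 X2; have bZ := inV_bdd Q Z.
have [[l Hl]|Hn] := pselect (exists l, forall n, inV Z n -> B (c1 * n) = l * B (c2 * n)).
  apply: le_trans (_ : q%:Z ^+ 2 * (size (fsv (inV (Q := Q) Z)))%:Z * 1 <= _).
    rewrite mulr1; apply: le_trans (ler_norm_sum _ _ _) _.
    apply: le_trans (_ : \sum_(n <- fsv (inV (Q := Q) Z)) q%:Z ^+ 2 <= _).
      by apply: ler_sum => n _; rewrite normrM expr2 ler_pM // eps_norm.
    by rewrite big_const_seq count_predT iter_addr_0 -mulr_natr natz.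
  rewrite ler_wpM2l ?mulr_ge0 ?exprn_ge0 // (bigD1 l) //= ind1.
    by rewrite lerDl sumr_ge0 // => i _; rewrite /ind; case: ifP.
  split; first by apply: inVB => //; apply: inVC.
  move=> e He; have -> : (c1 - qC d l * c2) * e = c1 * e - qC d l * (c2 * e) by ring.
  by rewrite linB // linC // Hl // subrr.
rewrite esum_pair ?normr0 //.
- apply: mulr_ge0; first by rewrite mulr_ge0 ?exprn_ge0.
  by apply: sumr_ge0 => i _; rewrite /ind; case: ifP.
- exact: inV_subsp.
- exact: B_mull.
exact: B_mull.
Qed.

(** The products [e h] are collected into one variable [n], with coefficients bounded by [Gam].
    Cauchy-Schwarz in [n] removes these, and the square expands into pairs [(i, j)], of which only
    those with some [c i - l c j] in [KK X Z] survive. *)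
Lemma bilinear_bound (I : finType) (P : pred I) (c : I -> A) (al : I -> int) (A0 : int)
    (X Z : nat) (E Hs : seq A) (be : A -> int) (Gam : int) :
  (forall i, P i -> inV X (c i)) -> (forall i j, P i -> P j -> c i = c j -> i = j) ->
  0 <= A0 -> (forall i, P i -> `|al i| <= A0) ->
  uniq Hs -> (forall h, h \in Hs -> h != 0) -> (forall e, e \in E -> e != 0) ->
  (forall h e, h \in Hs -> e \in E -> inV Z (e * h)) ->
  0 <= Gam -> (forall n, n != 0 -> inV Z n ->
     \sum_(e <- E) (if `[< dvdq e n >] then `|be e| else 0) <= Gam) ->
  (\sum_(i | P i) \sum_(e <- E) \sum_(h <- Hs) al i * be e * eps (B (c i * e * h))) ^+ 2 <=
  Gam ^+ 2 * A0 ^+ 2 * q%:Z ^+ 3 * (size (fsv (inV (Q := Q) Z)))%:Z ^+ 2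
   * #|P|%:Z * (size (fsv (KK X Z)))%:Z.
Proof.
move=> cX ci A00 alA uH H0 E0 HEZ G0 HG.
have bZ := inV_bdd Q Z; set VZ := fsv (inV (Q := Q) Z).
pose cn n := \sum_(e <- E) \sum_(h <- Hs) (if e * h == n then be e else 0).
pose T n := \sum_(i | P i) al i * eps (B (c i * n)).
have -> : \sum_(i | P i) \sum_(e <- E) \sum_(h <- Hs) al i * be e * eps (B (c i * e * h)) =
    \sum_(n <- VZ) cn n * T n.
  under [RHS]eq_bigr do rewrite mulr_suml.
  rewrite exchange_big [RHS]exchange_big /=; apply: eq_big_seq => e eE.
  under [RHS]eq_bigr do rewrite mulr_suml.
  rewrite exchange_big [RHS]exchange_big /=; apply: eq_big_seq => h hH.
  have eh : e * h \in VZ by apply/mem_fsv => //; exact: HEZ.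
  rewrite (bigD1_seq _ eh (fsv_uniq _)) /= eqxx [X in _ + X]big1 ?addr0; last first.
    by move=> n /negPf nE; rewrite [_ == n]eq_sym nE mul0r.
  by rewrite /T mulr_sumr; apply: eq_bigr => i _; rewrite -[c i * e * h]mulrA [RHS]mulrA [be e * al i]mulrC.
apply: le_trans (cauchy_schwarz_seq _ _ _) _.
have Hcn : \sum_(n <- VZ) cn n ^+ 2 <= Gam ^+ 2 * (size VZ)%:Z.
  apply: le_trans (_ : \sum_(n <- VZ) Gam ^+ 2 <= _); last first.
    by rewrite big_const_seq count_predT iter_addr_0 -mulr_natr natz.
  rewrite big_seq [leRHS]big_seq; apply: ler_sum => n /(mem_fsv _ bZ) nZ.
  rewrite -[leLHS]real_normK ?num_real // lerXn2r ?nnegrE //.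
  have [n0|n0] := eqVneq n 0.
    rewrite /cn big1_seq ?normr0 // => e /= eE; rewrite big1_seq // => h /= hH.
    by rewrite n0 (negPf (quad_mulf_neq0 (E0 _ eE) (H0 _ hH))).
  apply: le_trans (HG n n0 nZ); apply: le_trans (ler_norm_sum _ _ _) _.
  rewrite big_seq [leRHS]big_seq; apply: ler_sum => e eE.
  apply: le_trans (ler_norm_sum _ _ _) _.
  apply: le_trans (sum_eq_le n (normr_ge0 (be e)) uH (E0 _ eE)).
  by apply: ler_sum => h _; case: eqP => _; rewrite ?normr0.
have HT : \sum_(n <- VZ) T n ^+ 2 <=
    A0 ^+ 2 * q%:Z ^+ 3 * (size VZ)%:Z * #|P|%:Z * (size (fsv (KK X Z)))%:Z.
  have -> : \sum_(n <- VZ) T n ^+ 2 = \sum_(j | P j) \sum_(i | P i)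
      al i * al j * \sum_(n <- VZ) eps (B (c i * n)) * eps (B (c j * n)).
    under eq_bigr do rewrite expr2 /T mulr_sumr.
    rewrite exchange_big; apply: eq_bigr => j _ /=.
    under eq_bigr do rewrite mulr_suml.
    rewrite exchange_big; apply: eq_bigr => i _ /=.
    by rewrite mulr_sumr; apply: eq_bigr => n _; rewrite mulrACA.
  apply: le_trans (_ : \sum_(j | P j) A0 ^+ 2 * q%:Z ^+ 3 * (size VZ)%:Z * (size (fsv (KK X Z)))%:Z <= _); last first.
    by rewrite sumr_const -mulr_natr natz mulrAC.
  apply: ler_sum => j Pj.
  apply: le_trans (_ : \sum_(i | P i) A0 ^+ 2 * (q%:Z ^+ 2 * (size VZ)%:Z *
      \sum_(l : F) ind (KK X Z (c i - qC d l * c j))) <= _).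
    apply: ler_sum => i Pi; apply: le_trans (ler_norm _) _.
    rewrite !normrM expr2; apply: ler_pM; rewrite ?mulr_ge0 //.
      by apply: ler_pM => //; exact: alA.
    by apply: pair_sum_le; apply: cX.
  rewrite -!mulr_sumr exchange_big /=.
  apply: le_trans (_ : A0 ^+ 2 * (q%:Z ^+ 2 * (size VZ)%:Z * \sum_(l : F) (size (fsv (KK X Z)))%:Z) <= _).
    do 2 (rewrite ler_wpM2l ?mulr_ge0 ?exprn_ge0 //).
    by apply: ler_sum => l _; exact: sum_KK_shift.
  rewrite sumr_const -[_ *+ _]mulr_natl natz le_eqVlt; apply/orP; left; apply/eqP.
  rewrite (eq_card (_ : _ =i F)) // !exprS; ring.
apply: le_trans (ler_pM _ _ Hcn HT) _; try by apply: sumr_ge0 => n _; exact: sqr_ge0.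
rewrite le_eqVlt; apply/orP; left; apply/eqP; ring.
Qed.

(** Either the form vanishes on the box [Y] and the four terms of [sum_Ex] are bounded trivially, or
    it is nonzero on all four boxes and each sum is 0. The second case needs the box [Y] inside the
    smallest of them; for [Y = 0] it cannot occur. *)
Lemma box_sum_le (s t : int) (k Y : nat) (x : A) : s + t < k%:Z ->
  (Y = 0%N) \/ (Y%:Z <= s /\ Y%:Z <= t) ->
  `|\sum_(e <- fsv (Ex (Q := Q) s t)) eps (B (x * e))| <=
  (4 * q ^ k.+1)%N%:Z * ind (forall e, inV Y e -> B (x * e) = 0).
Proof.
move=> stk HY; have [Hx|Hx] := pselect (forall e, inV Y e -> B (x * e) = 0).
  rewrite ind1 // mulr1 sum_Ex.
  have bd s' t' : s' + t' <= s + t ->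
      `|\sum_(n <- fsv (Bx s' t')) eps (B (x * n))| <= (q ^ k.+1)%N%:Z.
    move=> st'; apply: le_trans (esum_le _ _) _; rewrite -PoszM lez_nat expnS leq_mul2l.
    by rewrite size_Bx ?orbT //; lia.
  have := bd s t (lexx _); have := bd (s - 1) t _; have := bd s (t - 1) _.
  have := bd (s - 1) (t - 1) _; lia.
have [e0 Ve0 Be0] : exists2 e, inV Y e & B (x * e) != 0.
  apply: contrapT => Hn; apply: Hx => e Ve; apply: contrapT => /eqP Be.
  by apply: Hn; exists e.
have Bxe : Bx (s - 1) (t - 1) e0.
  case: HY => [Y0|[Ys Yt]]; last by apply: inV_Bx Ve0; lia.
  by rewrite Y0 in Ve0; rewrite (inV_0 Ve0); case: (Bx_subsp Q (s - 1) (t - 1)).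
have z s' t' : s - 1 <= s' -> t - 1 <= t' -> \sum_(n <- fsv (Bx s' t')) eps (B (x * n)) = 0.
  move=> ss tt; apply: esum_zero; [exact: Bx_bdd|exact: Bx_subsp|exact: B_mull|].
  exists e0 => //; case: Bxe => h1 h2; split; [apply: kdle_le h1|apply: kdle_le h2]; lia.
by rewrite ind0 // mulr0 sum_Ex !z ?subr0 ?addr0 ?normr0 //; lia.
Qed.

Definition wt (Hs : seq A) n : int := \sum_(h <- Hs) eps (B (n * h)).
Definition Gsum Hs s t x : int :=
  \sum_(n <- fsv (fun n => Ex (Q := Q) s t n /\ dvdq x n)) wt Hs n.

(** A term survives only if [x i * h] lies in [KK X Y]. This product is nonzero, hence the [- 1],
    which makes the bound vanish when the lattice is trivial; and a lattice element arises at most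
    once from each of its at most [T] divisors [x i]. *)
Lemma typeI (I : finType) (P : pred I) (x : I -> A) (s t : int) (k X Y T : nat) (Hs : seq A) :
  uniq Hs -> (forall h, h \in Hs -> h != 0) ->
  (forall i, P i -> x i != 0) ->
  (forall h i, P i -> h \in Hs -> inV X (x i * h)) ->
  (forall i, P i -> s - v1 (x i) + (t - v2 (x i)) < k%:Z) ->
  (forall i, P i -> (Y = 0%N) \/ (Y%:Z <= s - v1 (x i) /\ Y%:Z <= t - v2 (x i))) ->
  (forall n, n != 0 -> inV X n -> (#|[set i | P i && `[< dvdq (x i) n >]]| <= T)%N) ->
  \sum_(i | P i) `|Gsum Hs s t (x i)| <=
    (4 * q ^ k.+1 * T * (size (fsv (KK X Y)) - 1))%N%:Z.
Proof.
move=> uH H0 x0 HX Hk HY HT.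
have step1 i : P i -> `|Gsum Hs s t (x i)| <=
    (4 * q ^ k.+1)%N%:Z * \sum_(h <- Hs) ind (KK X Y (x i * h)).
  move=> Pi; rewrite /Gsum (sum_Ex_dvd _ s t (x0 i Pi)) /wt exchange_big /=.
  apply: le_trans (ler_norm_sum _ _ _) _; rewrite mulr_sumr.
  rewrite big_seq [leRHS]big_seq; apply: ler_sum => h hH.
  under eq_bigr do rewrite mulrAC.
  apply: le_trans (box_sum_le (x i * h) (Hk i Pi) (HY i Pi)) _.
  rewrite ler_wpM2l // le_eqVlt; apply/orP; left; apply/eqP/ind_eq.
  by split=> [H|[]//]; split=> //; exact: HX.
apply: le_trans (ler_sum _ step1) _; rewrite -mulr_sumr -mulnA [leRHS]PoszM ler_wpM2l //.
have bK := KK_bdd X Y; set L := [seq n <- fsv (KK X Y) | n != 0].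
have sL : (size L <= size (fsv (KK X Y)) - 1)%N.
  have : 0 \in fsv (KK X Y) by apply/mem_fsv => //; case: (KK_subsp X Y).
  rewrite size_filter => h0; rewrite -(count_predC (pred1 0) (fsv (KK X Y))).
  rewrite count_uniq_mem ?fsv_uniq // h0 add1n subn1 /=; apply: sub_count => n //=.
apply: le_trans (_ : \sum_(n <- L) T%:Z <= _); last first.
  rewrite big_const_seq count_predT iter_addr_0 -mulr_natr natz -PoszM lez_nat.
  by rewrite leq_mul2l sL orbT.
apply: le_trans (_ : \sum_(i | P i) \sum_(h <- Hs) \sum_(n <- L) (if x i * h == n then 1 else 0) <= _).
  apply: ler_sum => i Pi; rewrite big_seq [leRHS]big_seq; apply: ler_sum => h hH.
  have sge0 : 0 <= \sum_(n <- L) (if x i * h == n then 1 else 0 : int).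
    by apply: sumr_ge0 => n _; case: ifP.
  rewrite /ind; case: ifP => // /asboolP HK.
  have xin : x i * h \in L.
    by rewrite mem_filter quad_mulf_neq0 ?x0 ?H0 //=; apply/mem_fsv.
  rewrite (bigD1_seq _ xin) ?filter_uniq ?fsv_uniq //= eqxx lerDl.
  by apply: sumr_ge0 => n _; case: ifP.
under eq_bigr do rewrite exchange_big /=.
rewrite exchange_big /= big_seq [leRHS]big_seq; apply: ler_sum => n.
rewrite mem_filter => /andP[n0 /(mem_fsv _ bK)[nX _]].
apply: le_trans (_ : \sum_(i | P i) (if `[< dvdq (x i) n >] then 1 else 0) <= _).
  by apply: ler_sum => i Pi; apply: sum_eq_le => //; exact: x0.
have := HT n n0 nX; rewrite -lez_nat; apply: le_trans.
rewrite -sum1_card (big_morph Posz PoszD (erefl _)) -big_mkcondr /=.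
by rewrite le_eqVlt; apply/orP; left; apply/eqP/eq_bigl => i; rewrite inE.
Qed.

Variables (R1 R2 : nat).
Hypothesis star : forall k, KK R1 R2 k -> k = 0.

Lemma inV_X1 i Y : (i < Y)%N -> inV (Q := Q) Y ('X^i, 0).
Proof. by move=> iY; rewrite /inV /= size_polyXn size_poly0 iY. Qed.
Lemma inV_X2 i Y : (i < Y - D)%N -> inV (Q := Q) Y (0, 'X^i).
Proof. by move=> iY; rewrite /inV /= size_polyXn size_poly0 iY. Qed.

(* The lattice of approximations at level (X, Y) is cut down to the trivial one at level (R1, R2)
   by at most 2 (X - R1) + 2 (R2 - Y) linear conditions. *)
Lemma card_KK X Y : (size (fsv (KK X Y)) <= q ^ (2 * (X - R1) + 2 * (R2 - Y)))%N.
Proof.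
pose J : finType := (('I_(X - R1) + 'I_(X - R1)) + ('I_(R2 - Y) + 'I_(R2 - Y)))%type.
have -> : (2 * (X - R1) + 2 * (R2 - Y) = #|J|)%N by rewrite !card_sum !card_ord; lia.
pose l (j : J) (k : A) : F := match j with
  | inl (inl i) => (k.1)`_(R1 + i) | inl (inr i) => (k.2)`_(R1 - D + i)
  | inr (inl i) => B (k * ('X^(Y + i), 0)) | inr (inr i) => B (k * (0, 'X^(Y - D + i))) end.
apply: (@subsp_card _ _ J l); [exact: KK_bdd|exact: KK_subsp| |].
  move=> [[i|i]|[i|i]] c x y; rewrite /l.
  - by rewrite qCM /= coefD coefZ.
  - by rewrite qCM /= coefD coefZ.
  - exact: B_mulr.
  - exact: B_mulr.
move=> k [/andP[k1 k2] Hk] Hl; apply: star; split.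
  apply/andP; split; apply/leq_sizeP => j Hj.
    case: (ltnP j X) => jX; last by rewrite nth_default // (leq_trans k1).
    have lt : (j - R1 < X - R1)%N by lia.
    by have := Hl (inl (inl (Ordinal lt))); rewrite /l /= subnKC.
  case: (ltnP j (X - D)) => jX; last by rewrite nth_default // (leq_trans k2).
  have lt : (j - (R1 - D) < X - R1)%N by lia.
  by have := Hl (inl (inr (Ordinal lt))); rewrite /l /= subnKC.
apply: B_monomials => i iR.
  case: (ltnP i Y) => iY; first exact/Hk/inV_X1.
  have lt : (i - Y < R2 - Y)%N by lia.
  by have := Hl (inr (inl (Ordinal lt))); rewrite /l /= subnKC.
case: (ltnP i (Y - D)) => iY; first exact/Hk/inV_X2.
have lt : (i - (Y - D) < R2 - Y)%N by lia.
by have := Hl (inr (inr (Ordinal lt))); rewrite /l /= subnKC.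
Qed.

End Analytic.

Lemma regroup_squares (x T M a b c : nat) :
  ((x * T ^ 2) ^ 2 * M ^ 2 * x ^ 3 * a ^ 2 * b * c =
   (T ^ 2 * M) ^ 2 * (x ^ 2 * (x ^ 3 * a ^ 2 * b * c)))%N.
Proof.
rewrite !expnMn -!mulnA; move: (x ^ 2)%N (x ^ 3)%N (T ^ 2)%N (M ^ 2)%N (a ^ 2)%N => *.
by lia.
Qed.

(** * The sum over primes *)

Section Core.
Variable Q : realquad.
Local Notation F := (rqF Q).
Local Notation d := (rqd Q).
Local Notation D := (rqD Q).
Local Notation A := (quad d).
Local Notation q := #|F|.
Local Notation rho := (rho Q).
Local Notation k0 := (k0 Q).
Implicit Types n : A.

Variable B : A -> F.
Hypothesis B_lin : lin B.
(* The level is R = 3L + r, the primes have degree l in (8L, M] and the boxes to be annihilated have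
   length L - sL, where q^sL beats all subexponential losses; Vaughan's cutoffs are u = 4L, v = 2L. *)
Variables (C L sL r l M tb : nat) (s t : int).
Hypothesis EM : M = (8 * L + k0 + 1)%N.
Hypothesis r2 : (r <= 2)%N.
Hypothesis sL_le : (sL <= L)%N.
Hypothesis L_big : (C + k0 + 10 <= L)%N.
Hypothesis star : forall k, KK B (3 * L + r - C) (3 * L + r + C) k -> k = 0.
Hypothesis lM : (8 * L < l <= M)%N.
Hypothesis s_bal : 0 <= 2 * s - l%:Z < (rho.*2)%:Z.
Hypothesis Et : t = l%:Z - s.
Hypothesis tau_le : forall n, n != 0 -> (dg n <= M)%N -> (tau M n <= tb)%N.

Definition Hseq : seq A := [seq h <- fsv (inV (Q := Q) (L - sL)) | h != 0].
(** One constant absorbing the bounded losses in the exponents of [q]. *)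
Definition cc : nat := (20 * (C + k0 + 10))%N.
Local Notation G := (Gsum B Hseq s t).

Lemma Hseq_uniq : uniq Hseq. Proof. by rewrite filter_uniq // fsv_uniq. Qed.
Lemma Hseq_neq0 h : h \in Hseq -> h != 0.
Proof. by rewrite mem_filter => /andP[]. Qed.
Lemma Hseq_inV h : h \in Hseq -> inV (L - sL) h.
Proof. by rewrite mem_filter => /andP[_ /(mem_fsv _ (inV_bdd Q _))]. Qed.

Lemma Gsum_assoc x y : assoc x y -> G x = G y.
Proof.
move=> xy; rewrite /Gsum; congr (\sum_(n <- _) _); apply: eq_fsv => n.
by split=> -[H1 H2]; split=> //; apply: dvdq_trans H2; apply: assoc_dvd => //; exact: assoc_sym.
Qed.

Lemma inV_dg n X : n != 0 -> inV X n -> (dg n < 2 * X)%N.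
Proof. by move=> n0 /(inV_v _ n0)[h1 h2]; have := v12 n0; lia. Qed.

Lemma partition_deg (I : finType) (P : pred I) (f : I -> nat) (g : I -> int) N :
  (forall i, P i -> (f i <= N)%N) ->
  \sum_(i | P i) g i = \sum_(j < N.+1) \sum_(i | P i && (f i == j)) g i.
Proof.
move=> fN; rewrite (partition_big (fun i => inord (f i) : 'I_N.+1) xpredT) //=.
apply: eq_bigr => j _; apply: eq_bigl => i; case Pi: (P i) => //=.
by rewrite -val_eqE /= inordK // ltnS fN.
Qed.

(** For [j] below about [2L] the lattice is trivial. Beyond that the exponent is about the larger of
    [6L] and [2L + j - 2 sL], so the extreme degree is [j = 6L], the sum of the two cutoffs. *)
Lemma typeI_exp (j : nat) : (j <= 6 * L)%N -> forall h, j = (h + (j./2).*2)%N -> (h <= 1)%N ->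
  let X := (L - sL + (j./2 + rho + 1))%N in let Y := ((l - j)./2 - 2 * rho - 1)%N in
  ((X <= 3 * L + r - C) && (3 * L + r + C <= Y))%N \/
  ((l - j).+2 + (2 * (X - (3 * L + r - C)) + 2 * ((3 * L + r + C) - Y)) <= 8 * L - sL + cc)%N.
Proof.
move=> j6 h Eh h1; have := odd_double_half (l - j); have := (k0_ge Q); rewrite /cc /=.
by case: odd; lia.
Qed.

(** [Gsum] depends on [x i] only up to units, so balanced representatives may be used; each degree
    [j] is then one application of [typeI] and [card_KK]. *)
Lemma typeI_total (I : finType) (P : pred I) (x : I -> A) (T : nat) :
  (forall i, P i -> x i != 0) -> (forall i, P i -> (dg (x i) <= 6 * L)%N) ->
  (forall n, n != 0 -> (dg n <= M)%N -> (#|[set i | P i && `[< dvdq (x i) n >]]| <= T)%N) ->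
  \sum_(i | P i) `|G (x i)| <= ((6 * L).+1 * (4 * T * q ^ (8 * L - sL + cc)))%N%:Z.
Proof.
move=> x0 x6 HT; rewrite (@partition_deg I P (fun i => dg (x i)) _ _ x6).
apply: le_trans (_ : \sum_(j < (6 * L).+1) (4 * T * q ^ (8 * L - sL + cc))%N%:Z <= _); last first.
  by rewrite sumr_const card_ord -mulr_natl natz.
apply: ler_sum => j _; have j6 : (j <= 6 * L)%N by rewrite -ltnS.
have Eh : (j : nat) = (odd j + (j./2).*2)%N by rewrite odd_double_half.
have := typeI_exp j6 Eh (leq_b1 _); set X := (L - sL + _)%N; set Y := (_ - 1)%N => /= HXY.
have PE i : P i && (dg (x i) == j) -> P i /\ dg (x i) = j by move=> /andP[? /eqP].
rewrite (eq_bigr (fun i => `|G (rep (x i))|)); last first.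
  by move=> i /PE[Pi _]; rewrite (Gsum_assoc (rep_assoc (x0 i Pi))).
have bal i : P i && (dg (x i) == j) -> [/\ rep (x i) != 0, v1 (rep (x i)) + v2 (rep (x i)) = j :> int
    & balanced (rep (x i))].
  move=> /PE[Pi E]; have [xr br] := rep_spec (x0 i Pi); have r0 := rep_neq0 (x0 i Pi).
  by split; [exact: r0|rewrite v12 // (assoc_dg xr (x0 i Pi)) E|exact: br].
apply: le_trans (@typeI Q B B_lin I _ _ s t (l - j).+1 X Y T Hseq Hseq_uniq Hseq_neq0 _ _ _ _ _) _.
- by move=> i /bal[].
- move=> h i /bal[r0 E1 E2] hH; rewrite /X addnC; apply: inVM (Hseq_inV hH).
  apply/(inV_v _ r0); move: E2; rewrite /balanced => E2.
  by have := odd_double_half j; case: odd; lia.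
- by move=> i /bal[r0 E1 E2]; rewrite Et; move: E1; lia.
- move=> i /bal[r0 E1 E2]; case: (posnP Y) => [Y0|Y0]; [left; exact: Y0|right].
  move: E2 Y0; rewrite /balanced /Y => E2 Y0; have := odd_double_half (l - j).
  by move: s_bal E1; rewrite Et; case: odd; lia.
- move=> n n0 nX; apply: leq_trans (HT n n0 _).
    apply: subset_leq_card; apply/fintype.subsetP => i; rewrite !inE => /andP[/PE[Pi E] /asboolP Hd].
    rewrite Pi /=; apply/asboolP; apply: dvdq_trans Hd; exact/assoc_dvd/rep_assoc/x0.
  by have := inV_dg n0 nX; rewrite /X; have := (k0_ge Q); have := odd_double_half j; lia.
rewrite lez_nat; have := @card_KK Q B B_lin _ _ star X Y; set N := size _ => HN.
case: HXY => [/andP[h1 h2]|HXY].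
  have -> : (N - 1 = 0)%N; last by rewrite muln0.
  move: HN; have -> : (X - (3 * L + r - C) = 0)%N by apply/eqP; rewrite subn_eq0.
  have -> : (3 * L + r + C - Y = 0)%N by apply/eqP; rewrite subn_eq0.
  by rewrite !muln0 expn0; case: (N) => [|[]].
apply: leq_trans (_ : 4 * q ^ (l - j).+2 * T * q ^ (2 * (X - (3 * L + r - C)) + 2 * (3 * L + r + C - Y)) <= _)%N.
  by rewrite leq_mul2l (leq_trans _ HN) ?orbT // leq_subr.
rewrite [leqLHS](_ : _ = 4 * T * (q ^ (l - j).+2 * q ^ (2 * (X - (3 * L + r - C)) + 2 * (3 * L + r + C - Y))))%N.
  by rewrite leq_mul2l -expnD leq_exp2l ?(q_gt1 Q) // HXY orbT.
by move: (q ^ _)%N (q ^ _)%N => a b; lia.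
Qed.

Local Notation r' := (size (PR Q M)).
Local Notation pr := (@pr Q M).
Local Notation u := (4 * L)%N.
Local Notation v := (2 * L)%N.

Lemma cpow_inj (ij kl : 'I_r' * 'I_M) : assoc (cpow ij) (cpow kl) -> ij = kl.
Proof.
move: ij kl => [i j] [k o] H.
have E p : prep p -> vp p (cpow (i, j)) = vp p (cpow (k, o)).
  by move=> [pp _]; rewrite (vp_assoc pp _ H) ?cpow_neq0.
have V p i' (j' : 'I_M) : prep p -> vp p (cpow (i', j')) = ((p == pr i') * j'.+1)%N.
  by move=> pp; rewrite /cpow vpX ?pr_neq0 ?(vp_prep pp) //; [exact: pr_prep|case: pp].
have ik : i = k.
  have := E _ (pr_prep i); rewrite !V; try exact: pr_prep.
  by rewrite eqxx; case: eqP => [/pr_inj//|].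
rewrite -ik in E *; congr (_, _); apply: val_inj.
have := E _ (pr_prep i); rewrite !V; try exact: pr_prep.
by rewrite eqxx !mul1n => -[].
Qed.

(** The tail of the Moebius sum over the divisors of [e]: the type II coefficient of Vaughan's
    identity. *)
Definition beta e : int :=
  \sum_(S : {set 'I_r'} | (v < dg (bS S))%N) (-1) ^+ #|S| * ind (dvdq (bS S) e).

Lemma beta_norm e : e != 0 -> `|beta e| <= (tau M e)%:Z.
Proof.
move=> e0; apply: le_trans (ler_norm_sum _ _ _) _.
apply: le_trans (_ : \sum_(S : {set 'I_r'}) ind (dvdq (bS S) e) <= _).
  rewrite big_mkcond; apply: ler_sum => S _; rewrite normrM normrX normrN1 expr1n mul1r.
  by rewrite /ind; case: ifP => _; case: ifP.
apply: le_trans (_ : (#|[set X : {set 'I_r'} | `[< dvdq (bS X) e >]]|)%:Z <= _); last first.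
  by rewrite lez_nat; apply: card_bS_dvd.
rewrite -sum1_card (big_morph Posz PoszD (erefl _)) [leRHS]big_mkcond /=.
by apply: ler_sum => S _; rewrite inE /ind; case: ifP.
Qed.

Lemma Gsum_II (ij : 'I_r' * 'I_M) :
  \sum_(S : {set 'I_r'} | (v < dg (bS S))%N) (-1) ^+ #|S| * G (cpow ij * bS S) =
  \sum_(e <- fsv (Ex (Q := Q) (s - v1 (rep (cpow ij))) (t - v2 (rep (cpow ij)))))
    beta e * wt B Hseq (rep (cpow ij) * e).
Proof.
have c0 := cpow_neq0 ij; set c := cpow ij in c0 *.
have rc := rep_assoc c0; have r0 := rep_neq0 c0.
pose P n := Ex (Q := Q) s t n /\ dvdq (rep c) n.
have bP : bdd P by apply: bdd_sub (@Ex_bdd Q s t) => x [].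
transitivity (\sum_(n <- fsv P) \sum_(S : {set 'I_r'} | (v < dg (bS S))%N)
    (-1) ^+ #|S| * ind (dvdq (c * bS S) n) * wt B Hseq n).
  rewrite exchange_big; apply: eq_bigr => S _ /=.
  under [RHS]eq_bigr do rewrite -mulrA.
  rewrite -mulr_sumr; congr (_ * _); rewrite /Gsum (@sum_fsv_sub _ _ P).
  - apply: eq_big_seq => n /(mem_fsv _ bP)[H1 H2].
    rewrite /ind; case: (pselect (dvdq (c * bS S) n)) => H.
      by rewrite !asboolT // mul1r.
    by rewrite !asboolF ?mul0r // => -[].
  - move=> x [H1 [z Hz]]; split=> //; apply: dvdq_trans (assoc_dvd (assoc_sym rc)) _.
    by exists (bS S * z); rewrite mulrA.
  exact: bP.
rewrite /P (sum_Ex_dvd _ s t r0); apply: eq_bigr => e _.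
rewrite -mulr_suml; congr (_ * _); apply: eq_bigr => S _; congr (_ * _).
apply: ind_eq; rewrite -(dvdq_mulI (bS S) e r0).
have ca : assoc (c * bS S) (rep c * bS S) by apply: assocM => //; exact: assoc_refl.
by split=> H; apply: dvdq_trans H; apply: assoc_dvd => //; exact: assoc_sym.
Qed.

(** With [R = 3L] and up to constants, [4Z + a + 2 (R - Z) = 16L - 2 sL] whatever [a] is, and the
    term in [X] is negligible because [a] is at most about [6L]. Only the shortening [sL] of the box
    yields a gain. *)
Lemma typeII_exp (a ha hb : nat) : (4 * L < a)%N -> (a + 2 * L < l)%N ->
  a = (ha + (a./2).*2)%N -> (ha <= 1)%N -> (l - a)%N = (hb + ((l - a)./2).*2)%N -> (hb <= 1)%N ->
  let X := (a./2 + rho + 1)%N in let Z := (L - sL + ((l - a)./2 + rho + 1))%N in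
  (3 + (Z + (Z - D)) * 2 + a.+1 + (2 * (X - (3 * L + r - C)) + 2 * ((3 * L + r + C) - Z)) <=
    2 * (8 * L - sL + cc))%N.
Proof. by have := (k0_ge Q); rewrite /cc /=; lia. Qed.

(** [bilinear_bound] needs one box for all prime powers and one for all products [e h], so the
    degree [a] and the first degree [s'] are fixed. *)
Lemma typeII_class (P : pred ('I_r' * 'I_M)) (a : nat) (s' : int) :
  (4 * L < a)%N -> (a + 2 * L < l)%N -> 0 <= 2 * s' - a%:Z < (rho.*2)%:Z ->
  (forall ij, P ij -> dgp ij = a /\ v1 (rep (cpow ij)) = s') ->
  `|\sum_(ij | P ij) (dg (pr ij.1))%:Z *
    \sum_(e <- fsv (Ex (Q := Q) (s - v1 (rep (cpow ij))) (t - v2 (rep (cpow ij)))))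
      beta e * wt B Hseq (rep (cpow ij) * e)| <= (tb ^ 2 * M * q ^ (8 * L - sL + cc + 1))%N%:Z.
Proof.
move=> a1 a2 s'b PE; set Sum := \sum_(ij | _) _.
pose t' : int := a%:Z - s'.
have PE2 ij : P ij -> v2 (rep (cpow ij)) = t'.
  move=> /PE[E1 E2]; have := v12 (rep_neq0 (cpow_neq0 ij)).
  by rewrite dg_rep ?cpow_neq0 // dg_cpow E1 E2 /t'; lia.
pose E := fsv (Ex (Q := Q) (s - s') (t - t')).
pose X := (a./2 + rho + 1)%N; pose Z := (L - sL + ((l - a)./2 + rho + 1))%N.
have -> : Sum = \sum_(ij | P ij) \sum_(e <- E) \sum_(h <- Hseq)
    (dg (pr ij.1))%:Z * beta e * eps (B (rep (cpow ij) * e * h)).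
  apply: eq_bigr => ij Pij; have [_ ->] := PE _ Pij; rewrite (PE2 _ Pij) mulr_sumr.
  by apply: eq_bigr => e _; rewrite mulrA /wt mulr_sumr.
have Ha : a = (odd a + (a./2).*2)%N by rewrite odd_double_half.
have Hb : (l - a)%N = (odd (l - a) + ((l - a)./2).*2)%N by rewrite odd_double_half.
have HE := typeII_exp a1 a2 Ha (leq_b1 _) Hb (leq_b1 _).
have E0 e : e \in E -> [/\ e != 0, v1 e = s - s' & v2 e = t - t'].
  by move=> /(mem_fsv _ (@Ex_bdd Q _ _)).
have HZ h e : h \in Hseq -> e \in E -> inV Z (e * h).
  move=> hH /E0[e0 e1 e2]; rewrite /Z addnC; apply: inVM (Hseq_inV hH).
  apply/(inV_v _ e0); rewrite e1 e2 /t'; move: s_bal s'b Hb; rewrite Et; have := leq_b1 (odd (l - a)).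
  lia.
have HX ij : P ij -> inV X (rep (cpow ij)).
  move=> Pij; have [E1 E2] := PE _ Pij; apply/(inV_v _ (rep_neq0 (cpow_neq0 ij))).
  rewrite E2 (PE2 _ Pij) /t' /X; move: s'b Ha; have := leq_b1 (odd a); lia.
have rinj i j : P i -> P j -> rep (cpow i) = rep (cpow j) -> i = j.
  move=> _ _ E'; apply: cpow_inj; apply: assoc_trans (rep_assoc (cpow_neq0 i)) _.
  by rewrite E'; apply/assoc_sym/rep_assoc/cpow_neq0.
have dM ij : P ij -> `|(dg (pr ij.1))%:Z : int| <= M%:Z.
  by move=> _; rewrite ger0_norm // lez_nat; case/andP: (pr_dg ij.1).
have E00 e : e \in E -> e != 0 by move=> /E0[].
have HG n : n != 0 -> inV Z n ->
    \sum_(e <- E) (if `[< dvdq e n >] then `|beta e| else 0) <= (q * tb ^ 2)%N%:Z.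
  move=> n0 nZ; have nM : (dg n <= M)%N.
    by have := inV_dg n0 nZ; rewrite /Z; have := (k0_ge Q); move: Hb; have := leq_b1 (odd (l - a)); lia.
  have tn := tau_le n0 nM.
  apply: le_trans (_ : \sum_(e <- E) (if `[< Ex (s - s') (t - t') e /\ dvdq e n >] then tb%:Z else 0) <= _).
    rewrite big_seq [leRHS]big_seq; apply: ler_sum => e eE; have e0 := E00 _ eE.
    case: ifP => [/asboolP en|_]; last by case: ifP.
    rewrite asboolT; last by split=> //; exact: E0.
    apply: le_trans (beta_norm e0) _; rewrite lez_nat; apply: leq_trans (tau_dvd _ n0 en) tn.
  rewrite /E -(@sum_fsv_sub _ _ (Ex (s - s') (t - t')) (fun e => Ex (s - s') (t - t') e /\ dvdq e n) (fun=> tb%:Z)); last first.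
  - exact: Ex_bdd.
  - by move=> x [].
  rewrite big_const_seq count_predT iter_addr_0 -mulr_natl natz -PoszM lez_nat expnS expn1 mulnA.
  rewrite leq_mul2r; apply/orP; right.
  by apply: leq_trans (size_div_shape _ _ n0 nM) _; rewrite leq_mul2l tn orbT.
have BL := @bilinear_bound Q B B_lin _ P (fun ij => rep (cpow ij)) (fun ij => (dg (pr ij.1))%:Z) M%:Z X Z E Hseq
  beta (q * tb ^ 2)%N%:Z HX rinj isT dM Hseq_uniq Hseq_neq0 E00 HZ isT HG.
rewrite -(@ler_pXn2r int 2) ?nnegrE // real_normK ?num_real //.
apply: le_trans BL _; rewrite size_fsv_inV -!PoszM.
have HP : (#|P| <= q ^ a.+1)%N.
  have Hs : (size (fsv (Ex (Q := Q) s' t')) <= q ^ a.+1)%N.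
    apply: leq_trans (size_fsv_le (@Ex_Bx Q s' t') (@Bx_bdd Q s' t')) _.
    by apply: size_Bx; rewrite /t'; lia.
  apply: leq_trans Hs; rewrite cardE -(size_map (fun ij => rep (cpow ij))).
  apply: uniq_leq_size.
    rewrite map_inj_in_uniq ?enum_uniq // => i j; rewrite !mem_enum => Pi Pj; exact: rinj.
  move=> y /mapP[ij]; rewrite mem_enum => Pij ->; apply/(mem_fsv _ (@Ex_bdd Q _ _)).
  by split; [exact/rep_neq0/cpow_neq0|exact: (PE _ Pij).2|exact: PE2].
have HK := @card_KK Q B B_lin _ _ star X Z.
rewrite -!natz -!natrX ler_nat.
set w := size (fsv _) in HK *; set e1 := (Z + (Z - D))%N in HE *.
set e2 := (2 * _ + 2 * _)%N in HE HK.
apply: leq_trans (_ : (q * tb ^ 2) ^ 2 * M ^ 2 * q ^ 3 * (q ^ e1) ^ 2 * q ^ a.+1 * q ^ e2 <= _)%N.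
  by apply: leq_mul; [apply: leq_mul; [exact: leqnn|exact: HP]|exact: HK].
rewrite [leqLHS](_ : _ = (tb ^ 2 * M) ^ 2 * q ^ (2 + (3 + e1 * 2 + a.+1 + e2)))%N; last first.
  move: (e1) (e2) (a.+1) => f1 f2 f3; rewrite !expnD [(q ^ (f1 * 2))%N]expnM.
  exact: regroup_squares.
rewrite [leqRHS]expnMn leq_mul2l -expnM leq_exp2l ?(q_gt1 Q) //; apply/orP; right.
rewrite -/X -/Z -/e1 -/e2 in HE; lia.
Qed.

(** * Vaughan's decomposition of the weighted sum *)

Local Notation Eq := (8 * L - sL + cc)%N.
Local Notation BB := (fsv (Ex (Q := Q) s t)).
Local Notation w := (wt B Hseq).

Lemma BB_spec n : n \in BB -> [/\ n != 0, dg n = l & (dg n <= M)%N].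
Proof.
move=> /(mem_fsv _ (@Ex_bdd Q _ _)) Hn; have [n0 _ _] := Hn.
move: Hn; rewrite Et => /Ex_dg [E]; split=> //; rewrite E.
by case/andP: lM.
Qed.

Lemma Gsum_ind x : G x = \sum_(n <- BB) ind (dvdq x n) * w n.
Proof.
rewrite /Gsum (@sum_fsv_sub Q int (Ex s t) _ w (fun x H => proj1 H) (@Ex_bdd Q s t)).
apply: eq_big_seq => n /(mem_fsv _ (@Ex_bdd Q s t)) Hn.
rewrite /ind; case: (pselect (dvdq x n)) => H; first by rewrite !asboolT // mul1r.
by rewrite !asboolF ?mul0r // => -[].
Qed.

(** [T1] and [T2] are type I sums over products of degree at most [6L]; [T3] is the type II sum. *)
Definition T1 : int := \sum_(S : {set 'I_r'} | (dg (bS S) <= v)%N)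
  (-1) ^+ #|S| * (l%:Z - (dg (bS S))%:Z) * G (bS S).
Definition T2 : int := \sum_(S : {set 'I_r'} | (dg (bS S) <= v)%N) \sum_(ij | (dgp ij <= u)%N)
  (-1) ^+ #|S| * (dg (pr ij.1))%:Z * G (cpow ij * bS S).
Definition T3 : int := \sum_(S : {set 'I_r'} | (v < dg (bS S))%N) \sum_(ij | (u < dgp ij)%N)
  (-1) ^+ #|S| * (dg (pr ij.1))%:Z * G (cpow ij * bS S).

Lemma vaughan_sum : \sum_(n <- BB) mang M u n * w n = T1 - T2 + T3.
Proof.
transitivity (\sum_(n <- BB) (
  \sum_(S : {set 'I_r'} | (dg (bS S) <= v)%N)
     (-1) ^+ #|S| * (l%:Z - (dg (bS S))%:Z) * (ind (dvdq (bS S) n) * w n)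
  - \sum_(S : {set 'I_r'} | (dg (bS S) <= v)%N) \sum_(ij | (dgp ij <= u)%N)
     (-1) ^+ #|S| * (dg (pr ij.1))%:Z * (ind (dvdq (cpow ij * bS S) n) * w n)
  + \sum_(S : {set 'I_r'} | (v < dg (bS S))%N) \sum_(ij | (u < dgp ij)%N)
     (-1) ^+ #|S| * (dg (pr ij.1))%:Z * (ind (dvdq (cpow ij * bS S) n) * w n))).
  apply: eq_big_seq => n /BB_spec[n0 dn nM].
  rewrite (vaughan_pt u v n0 nM) dn mulrDl mulrBl; congr (_ - _ + _).
  - by rewrite mulr_suml; apply: eq_bigr => S _; rewrite -!mulrA.
  - rewrite mulr_suml; apply: eq_bigr => S _; rewrite mulr_suml.
    by apply: eq_bigr => ij _; rewrite -!mulrA.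
  rewrite mulr_suml; apply: eq_bigr => S _; rewrite mulr_suml.
  by apply: eq_bigr => ij _; rewrite -!mulrA.
rewrite big_split sumrB /=; congr (_ - _ + _).
- by rewrite exchange_big; apply: eq_bigr => S _ /=; rewrite -mulr_sumr -Gsum_ind.
- rewrite exchange_big; apply: eq_bigr => S _ /=; rewrite exchange_big.
  by apply: eq_bigr => ij _ /=; rewrite -mulr_sumr -Gsum_ind.
rewrite exchange_big; apply: eq_bigr => S _ /=; rewrite exchange_big.
by apply: eq_bigr => ij _ /=; rewrite -mulr_sumr -Gsum_ind.
Qed.

Lemma T1_le : `|T1| <= (M * ((6 * L).+1 * (4 * tb * q ^ Eq)))%N%:Z.
Proof.
apply: le_trans (ler_norm_sum _ _ _) _.
apply: le_trans (_ : \sum_(S : {set 'I_r'} | (dg (bS S) <= v)%N) M%:Z * `|G (bS S)| <= _).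
  apply: ler_sum => S Sv; rewrite !normrM normrX normrN1 expr1n mul1r ler_wpM2r //.
  by have := lM; lia.
rewrite -mulr_sumr [leRHS]PoszM ler_wpM2l //; apply: typeI_total.
- by move=> S _; exact: bS_neq0.
- by move=> S Sv; lia.
move=> n n0 nM; apply: leq_trans (tau_le n0 nM); apply: leq_trans (@card_bS_dvd Q M n n0).
by apply: subset_leq_card; apply/fintype.subsetP => S; rewrite !inE => /andP[].
Qed.

Lemma T2_le : `|T2| <= (M * ((6 * L).+1 * (4 * (tb * M) * q ^ Eq)))%N%:Z.
Proof.
rewrite /T2 pair_big /=.
apply: le_trans (ler_norm_sum _ _ _) _.
apply: le_trans (_ : \sum_(p : {set 'I_r'} * ('I_r' * 'I_M) | (dg (bS p.1) <= v)%N && (dgp p.2 <= u)%N)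
    M%:Z * `|G (cpow p.2 * bS p.1)| <= _).
  apply: ler_sum => p _; rewrite !normrM normrX normrN1 expr1n mul1r ler_wpM2r //.
  by rewrite ger0_norm // lez_nat; case/andP: (pr_dg p.2.1).
rewrite -mulr_sumr [leRHS]PoszM ler_wpM2l //; apply: typeI_total.
- by move=> p _; apply: quad_mulf_neq0; [exact: cpow_neq0|exact: bS_neq0].
- by move=> p /andP[h1 h2]; rewrite dgM ?cpow_neq0 ?bS_neq0 // dg_cpow; lia.
move=> n n0 nM.
apply: leq_trans (_ : #|setX [set X : {set 'I_r'} | `[< dvdq (bS X) n >]]
    [set ij : 'I_r' * 'I_M | `[< dvdq (cpow ij) n >]]| <= _)%N.
  apply: subset_leq_card; apply/fintype.subsetP => -[S ij]; rewrite !inE => /andP[_ /asboolP Hd].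
  apply/andP; split; apply/asboolP; apply: dvdq_trans Hd; first by exists (cpow ij); rewrite mulrC.
  by exists (bS S).
rewrite cardsX leq_mul ?card_cpow_dvd //.
by apply: leq_trans (@card_bS_dvd Q M n n0) (tau_le n0 nM).
Qed.

(** The cofactor of a prime power [c] has degree [l - dg c], and [beta] vanishes on it unless this
    exceeds [v]; hence [dg c] lies between [4L] and [l - 2L]. The prime powers are then sorted by
    degree and by the shape of their balanced representative. *)
Lemma T3_le : `|T3| <= (M.+1 * (rho.+1 * (tb ^ 2 * M * q ^ (Eq + 1))))%N%:Z.
Proof.
pose U (ij : 'I_r' * 'I_M) : int := (dg (pr ij.1))%:Z *
  \sum_(e <- fsv (Ex (Q := Q) (s - v1 (rep (cpow ij))) (t - v2 (rep (cpow ij)))))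
      beta e * w (rep (cpow ij) * e).
pose P (ij : 'I_r' * 'I_M) := (u < dgp ij)%N && (dgp ij + v < l)%N.
have -> : T3 = \sum_(ij | P ij) U ij.
  rewrite /T3 exchange_big /= [RHS]big_mkcondr /=; apply: eq_bigr => ij uij.
  transitivity (U ij).
    by rewrite /U -Gsum_II mulr_sumr; apply: eq_bigr => S _; rewrite mulrCA mulrA.
  case: ltnP => // lv; rewrite /U big1_seq ?mulr0 // => e /= /(mem_fsv _ (@Ex_bdd Q _ _)) [e0 h1 h2].
  rewrite /beta big1 ?mul0r // => S vS; rewrite ind0 ?mulr0 // => /(dvdq_dg e0).
  have := v12 e0; have := v12 (rep_neq0 (cpow_neq0 ij)); rewrite dg_rep ?cpow_neq0 // dg_cpow h1 h2 Et.
  lia.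
have bal (ij : 'I_r' * 'I_M) : [/\ rep (cpow ij) != 0, v1 (rep (cpow ij)) + v2 (rep (cpow ij)) = dgp ij :> int
    & balanced (rep (cpow ij))].
  have [xr br] := rep_spec (cpow_neq0 ij); have r0 := rep_neq0 (cpow_neq0 ij).
  by split; [exact: r0|rewrite v12 // dg_rep ?cpow_neq0 // dg_cpow|exact: br].
pose g (ij : 'I_r' * 'I_M) := absz (v1 (rep (cpow ij)) - (uphalf (dgp ij))%:Z).
have gE ij : (g ij < rho)%N /\ v1 (rep (cpow ij)) = (uphalf (dgp ij))%:Z + (g ij)%:Z.
  have [_ E1 E2] := bal ij; move: E2; rewrite /balanced /g => E2.
  have := odd_double_half (dgp ij); rewrite uphalf_half; case: odd; split; lia.
rewrite (@partition_deg _ P (fun ij => dgp ij) U M); last first.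
  by move=> ij /andP[_ h]; case/andP: lM => _; lia.
apply: le_trans (ler_norm_sum _ _ _) _.
apply: le_trans (_ : \sum_(a < M.+1) (rho.+1 * (tb ^ 2 * M * q ^ (Eq + 1)))%N%:Z <= _); last first.
  by rewrite sumr_const card_ord -mulr_natl natz -PoszM.
apply: ler_sum => a _; rewrite (@partition_deg _ _ g U rho); last first.
  by move=> ij _; have [h _] := gE ij; exact: ltnW.
apply: le_trans (ler_norm_sum _ _ _) _.
apply: le_trans (_ : \sum_(b < rho.+1) (tb ^ 2 * M * q ^ (Eq + 1))%N%:Z <= _); last first.
  by rewrite sumr_const card_ord -mulr_natl natz -PoszM.
apply: ler_sum => b _.
pose P' : pred ('I_r' * 'I_M) := fun ij => (P ij && (dgp ij == a)) && (g ij == b).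
change (`|\sum_(ij | P' ij) U ij| <= (tb ^ 2 * M * q ^ (Eq + 1))%N%:Z).
have P'E ij : P' ij -> [/\ (u < dgp ij)%N, (dgp ij + v < l)%N, dgp ij = a & g ij = b].
  by move=> /andP[/andP[/andP[h1 h2] /eqP h3] /eqP h4].
case: (pickP P') => [ij0 Pij0|P0]; last by rewrite big_pred0.
have [h1 h2 h3 h4] := P'E _ Pij0; have [_ b1 b2] := bal ij0; have [g1 g2] := gE ij0.
apply: (@typeII_class P' a (v1 (rep (cpow ij0)))).
- by rewrite -h3.
- by rewrite -h3.
- by move: b2; rewrite /balanced -h3; lia.
move=> ij /P'E[_ _ E3 E4]; split; [exact: E3|].
by have [_ ->] := gE ij; rewrite g2 E3 E4 h3 h4.
Qed.

(** * Detecting a prime that annihilates the box *)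

Definition annih n := forall h, inV (L - sL) h -> B (n * h) = 0.

(** The term [h = 0], left out of [Hseq], is [q - 1] and completes the sum over the box, which is
    then full or zero. *)
Lemma wt_annih n : q%:Z - 1 + w n =
  (q%:Z - 1) * (size (fsv (inV (Q := Q) (L - sL))))%:Z * ind (annih n).
Proof.
have bH := inV_bdd Q (L - sL).
have -> : q%:Z - 1 + w n = \sum_(h <- fsv (inV (Q := Q) (L - sL))) eps (B (n * h)).
  have h0 : 0 \in fsv (inV (Q := Q) (L - sL)) by apply/(mem_fsv _ bH)/inV0.
  rewrite (bigD1_seq _ h0 (fsv_uniq _)) /= mulr0 lin0 // {1}/eps eqxx.
  by rewrite /wt /Hseq big_filter.
have [Hn|Hn] := pselect (annih n); first by rewrite ind1 // mulr1; apply: esum_full.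
rewrite ind0 // mulr0; apply: esum_zero => //; [exact: inV_subsp|exact: B_mull|].
apply: contrapT => H; apply: Hn => h Hh; apply: contrapT => /eqP Hb; apply: H.
by exists h.
Qed.

(** A power of degree [l] with exponent at least 2 comes from a prime of degree at most [l / 2],
    about [4L], and is determined by that prime. *)
Lemma card_prime_powers :
  (#|[set ij : 'I_r' * 'I_M | (0 < ij.2)%N && (dgp ij == l)]| <= q ^ (4 * L + cc))%N.
Proof.
pose Y := ((l./2)./2 + rho + 1)%N.
apply: leq_trans (_ : size (fsv (inV (Q := Q) Y)) <= _)%N; last first.
  rewrite size_fsv_inV leq_exp2l ?(q_gt1 Q) // /Y /cc.
  have := odd_double_half (l./2); have := odd_double_half l; have := (k0_ge Q); move: lM; lia.
rewrite cardE -(size_map (fun ij => pr ij.1)); apply: uniq_leq_size.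
  rewrite map_inj_in_uniq ?enum_uniq // => -[i j] [i' j'].
  rewrite !mem_enum !inE /dgp /= => /andP[_ /eqP E1] /andP[_ /eqP E2] /pr_inj E.
  rewrite -E in E2 *; congr (_, _); apply: val_inj; apply/eqP; rewrite -eqSS.
  by rewrite -(eqn_pmul2r (m := dg (pr i))) ?E1 ?E2 //; case/andP: (pr_dg i).
move=> y /mapP[[i j]]; rewrite mem_enum inE /dgp /= => /andP[j0 /eqP E] ->.
apply/(mem_fsv _ (inV_bdd Q Y)); apply: balanced_inV; first exact: pr_neq0.
  exact/prep_balanced/pr_prep.
rewrite geq_half_double -E -mul2n leq_mul2r; apply/orP; right; exact: j0.
Qed.

(** Without an annihilating prime only proper powers remain. Even multiplied by the size of the box,
    at most [q^(2L)], their total is of order [q^(6L)] up to subexponential factors. *)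
Lemma mang_no_prime : (forall n, Ex s t n -> primeq n -> ~ annih n) ->
  \sum_(n <- BB) mang M u n * ind (annih n) <= (M * q ^ (4 * L + cc) * (q * tb))%N%:Z.
Proof.
move=> Hp.
apply: le_trans (_ : \sum_(n <- BB) \sum_(ij in [set ij : 'I_r' * 'I_M | (0 < ij.2)%N && (dgp ij == l)])
    M%:Z * ind (assoc n (cpow ij)) <= _).
  rewrite big_seq [leRHS]big_seq; apply: ler_sum => n nB; have [n0 dn nM] := BB_spec nB.
  have Hn := (mem_fsv _ (@Ex_bdd Q s t)).1 nB.
  rewrite /mang mulr_suml big_mkcond [leRHS]big_mkcond /=; apply: ler_sum => ij _.
  rewrite inE; have [[Ha An]|H] := pselect (assoc n (cpow ij) /\ annih n); last first.
    have -> : (if (u < dgp ij)%N then (dg (pr ij.1))%:Z * ind (assoc n (cpow ij)) * ind (annih n) else 0) = 0.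
      case: ifP => // _; apply/eqP; rewrite /ind.
      case: (pselect (assoc n (cpow ij))) => h1; last by rewrite (asboolF h1) mulr0 mul0r.
      by rewrite [`[< annih n >]]asboolF ?mulr0 // => h2; apply: H.
    by case: ifP => // _; rewrite mulr_ge0 // /ind; case: ifP.
  have E : dgp ij = l by rewrite -dg_cpow (assoc_dg Ha n0).
  rewrite E eqxx !ind1 // !mulr1; case: (posnP ij.2) => j0 /=.
    case: (Hp n Hn); last exact: An.
    apply: prime_assoc (assoc_sym Ha); rewrite /cpow j0 expr1; exact: pr_prime.
  by case: ifP => // _; rewrite lez_nat; case/andP: (pr_dg ij.1).
rewrite exchange_big /=.
apply: le_trans (_ : \sum_(ij in [set ij : 'I_r' * 'I_M | (0 < ij.2)%N && (dgp ij == l)])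
    M%:Z * (q * tb)%N%:Z <= _).
  apply: ler_sum => ij; rewrite inE => /andP[_ /eqP E]; rewrite -mulr_sumr ler_wpM2l //.
  have c0 := cpow_neq0 ij; have cM : (dg (cpow ij) <= M)%N by rewrite dg_cpow E; case/andP: lM.
  apply: le_trans (_ : (size (fsv (fun e => Ex (Q := Q) s t e /\ dvdq e (cpow ij))))%:Z <= _); last first.
    by rewrite lez_nat; apply: leq_trans (size_div_shape _ _ c0 cM) _; rewrite leq_mul2l tau_le ?orbT.
  rewrite size_fsv_sum (big_morph Posz PoszD (erefl _)).
  rewrite (@sum_fsv_sub Q int (Ex s t) _ (fun=> 1) (fun x H => proj1 H) (@Ex_bdd Q s t)).
  rewrite big_seq [leRHS]big_seq; apply: ler_sum => n /(mem_fsv _ (@Ex_bdd Q s t)) Hn.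
  rewrite /ind; case: (pselect (assoc n (cpow ij))) => h; last by rewrite asboolF //; case: ifP.
  by rewrite !asboolT //; split=> //; exact: assoc_dvd.
rewrite sumr_const -mulr_natl natz -!PoszM lez_nat mulnA leq_mul2r; apply/orP; right.
rewrite mulnC leq_mul2l; apply/orP; right; exact: card_prime_powers.
Qed.

(** Summing [wt_annih] against [mang] expresses [q - 1] times the full sum as the part on
    annihilators minus the Vaughan sum. If no prime annihilates, both are small, while [mang_window]
    will provide order [q^(8L)]. *)
Lemma core_bound : (forall n, Ex s t n -> primeq n -> ~ annih n) ->
  \sum_(n <- BB) mang M u n <= (20 * rho.+1 * M.+1 ^ 3 * tb ^ 2 * q ^ (Eq + 2))%N%:Z.
Proof.
move=> Hp; set Sm := \sum_(n <- BB) mang M u n.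
have tb1 : (0 < tb)%N.
  by apply: leq_trans (tau_le (oner_neq0 _) _); [exact: tau_gt0|rewrite dg1].
have E : (q%:Z - 1) * Sm = (q%:Z - 1) * (size (fsv (inV (Q := Q) (L - sL))))%:Z *
    (\sum_(n <- BB) mang M u n * ind (annih n)) - (T1 - T2 + T3).
  rewrite -vaughan_sum mulr_sumr -sumrB /Sm mulr_sumr; apply: eq_bigr => n _.
  have := wt_annih n; set c := _ * _ * ind _ => Ec.
  have -> : (q%:Z - 1) * (size (fsv (inV (Q := Q) (L - sL))))%:Z * (mang M u n * ind (annih n)) = mang M u n * c.
    by rewrite /c mulrCA.
  by rewrite -Ec; ring.
have := mang_no_prime Hp; set Y := \sum_(n <- BB) _ => HY.
have := T1_le; have := T2_le; have := T3_le => H3 H2 H1.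
have q1 : 1 <= q%:Z - 1 by have := q_gt1 Q; lia.
have [W EW] : exists W : nat, W = (M.+1 ^ 3 * tb ^ 2 * q ^ (Eq + 2))%N by eexists.
have mono (x y e : nat) : (x <= M.+1 ^ 3)%N -> (y <= tb ^ 2)%N -> (e <= Eq + 2)%N ->
    (x * y * q ^ e <= W)%N.
  by move=> hx hy he; rewrite EW !leq_mul // leq_exp2l ?(q_gt1 Q).
have ML : ((6 * L).+1 <= M.+1)%N by rewrite EM; lia.
have tb2 : (tb <= tb ^ 2)%N by rewrite -[leqLHS]expn1 leq_pexp2l.
have tb0 : (1 <= tb ^ 2)%N by rewrite expn_gt0 tb1.
have M1 : (M <= M.+1 ^ 3)%N by apply: leq_trans (leqnSn M) _; rewrite -[leqLHS]expn1 leq_pexp2l.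
have M2 : (M * (6 * L).+1 <= M.+1 ^ 3)%N.
  apply: leq_trans (_ : M.+1 * M.+1 <= _)%N; first by rewrite leq_mul.
  by rewrite mulnn leq_pexp2l.
have M3 : (M * (6 * L).+1 * M <= M.+1 ^ 3)%N.
  apply: leq_trans (_ : M.+1 * M.+1 * M.+1 <= _)%N; first by rewrite !leq_mul.
  by rewrite !expnS expn0 muln1 mulnA.
have M4 : (M.+1 * M <= M.+1 ^ 3)%N.
  apply: leq_trans (_ : M.+1 * M.+1 <= _)%N; first by rewrite leq_mul.
  by rewrite mulnn leq_pexp2l.
have b1 : `|T1| <= 4 * W%:Z.
  apply: le_trans H1 _; rewrite -[4]/(4%:Z) -PoszM lez_nat.
  have := mono _ _ Eq M2 tb2 (leq_addr _ _); move: (q ^ _)%N => x; lia.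
have b2 : `|T2| <= 4 * W%:Z.
  apply: le_trans H2 _; rewrite -[4]/(4%:Z) -PoszM lez_nat.
  have := mono _ _ Eq M3 tb2 (leq_addr _ _); move: (q ^ _)%N => x; lia.
have b3 : `|T3| <= (rho.+1)%:Z * W%:Z.
  apply: le_trans H3 _; rewrite -PoszM lez_nat mulnCA leq_mul2l; apply/orP; right.
  have he : (Eq + 1 <= Eq + 2)%N by lia.
  have := mono _ _ (Eq + 1)%N M4 (leqnn _) he; move: (q ^ _)%N => x; lia.
have b4 : (size (fsv (inV (Q := Q) (L - sL))))%:Z * Y <= W%:Z.
  have Y0 : 0 <= Y.
    apply: sumr_ge0 => n _; rewrite mulr_ge0 //; last by rewrite /ind; case: ifP.
    by apply: sumr_ge0 => ij _; rewrite mulr_ge0 // /ind; case: ifP.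
  apply: le_trans (ler_wpM2l _ HY) _ => //; rewrite -PoszM lez_nat size_fsv_inV.
  apply: leq_trans (_ : M * tb * q ^ (L - sL + (L - sL - D) + (4 * L + cc) + 1) <= _)%N.
    rewrite !expnD expn1; move: (q ^ _)%N (q ^ _)%N (q ^ _)%N (q ^ _)%N => x1 x2 x3 x4; lia.
  by apply: mono => //; lia.
have Sle : (q%:Z - 1) * Sm <= (q%:Z - 1) * (20 * rho.+1 * M.+1 ^ 3 * tb ^ 2 * q ^ (Eq + 2))%N%:Z.
  have -> : (20 * rho.+1 * M.+1 ^ 3 * tb ^ 2 * q ^ (Eq + 2))%N%:Z = 20 * (rho.+1)%:Z * W%:Z.
    by rewrite EW -[20]/(20%:Z) -!PoszM !mulnA.
  have W0 : 0 <= W%:Z :> int by [].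
  have e1 : (q%:Z - 1) * ((size (fsv (inV (Q := Q) (L - sL))))%:Z * Y) <= (q%:Z - 1) * W%:Z.
    by rewrite ler_wpM2l // (le_trans _ q1).
  have e2 : `|T1 - T2 + T3| <= (9 + rho%:Z) * W%:Z.
    apply: le_trans (ler_normD _ _) _; apply: le_trans (lerD (ler_normB _ _) (lexx _)) _.
    have := lerD (lerD b1 b2) b3.
    have -> : 4 * W%:Z + 4 * W%:Z + rho.+1%:Z * W%:Z = (9 + rho%:Z) * W%:Z by rewrite -!mulrDl; congr (_ * _); lia.
    by [].
  have e3 : (9 + rho%:Z) * W%:Z <= (q%:Z - 1) * ((9 + rho%:Z) * W%:Z).
    by rewrite ler_peMl // mulr_ge0 // addr_ge0.
  rewrite E -mulrA; apply: le_trans (_ : (q%:Z - 1) * W%:Z + (q%:Z - 1) * ((9 + rho%:Z) * W%:Z) <= _).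
    apply: lerD e1 _; apply: le_trans e3; apply: le_trans e2.
    by rewrite -normrN ler_norm.
  rewrite -mulrDr ler_wpM2l ?(le_trans _ q1) // -{1}[W%:Z]mul1r -mulrDl.
  by rewrite ler_wpM2r //; lia.
by move: Sle; rewrite ler_pM2l // (lt_le_trans _ q1).
Qed.

End Core.

(** [L %/ K] is the saving [sL], and [M %/ (64 * K)] the exponent of each of three subexponential
    losses: one from the polynomial factor, two from the square of the divisor bound. *)
Lemma div_scale_lt (L K M : nat) : (0 < K)%N -> (K <= L)%N -> (M <= 16 * L)%N ->
  (3 * (M %/ (64 * K)) < L %/ K)%N.
Proof.
move=> K0 KL ML; set y := (M %/ _)%N; set x := (L %/ K)%N.
have h1 : (y * (64 * K) <= M)%N by apply: leq_trunc_div.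
have h2 : (L < x.+1 * K)%N by rewrite /x ltn_ceil.
have h3 : (0 < x)%N by rewrite divn_gt0.
have h4 : (4 * y < x.+1)%N.
  rewrite -(ltn_pmul2r (m := 16 * K)) ?muln_gt0 //.
  apply: leq_ltn_trans (_ : 16 * L < _)%N; last by rewrite mulnCA ltn_pmul2l.
  by apply: leq_trans ML; apply: leq_trans h1; rewrite mulnAC [(y * _)%N]mulnC; lia.
by lia.
Qed.

(** * Approximation *)

(** Without such a prime, [mang_window] and [core_bound] would bound [q^sL] by [2^(3y)] with
    [y = M %/ (64 * K)], which is impossible for large [L]. *)
Lemma prime_approx (Q : realquad) (C K : nat) : (0 < K)%N -> exists R0, forall R, (R0 <= R)%N ->
  forall B : quad (rqd Q) -> rqF Q, lin B -> (forall k, KK B (R - C) (R + C) k -> k = 0) ->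
  exists p : quad (rqd Q), [/\ primeq p, balanced p,
    (8 * (R %/ 3) < dg p <= 8 * (R %/ 3) + k0 Q + 1)%N &
    forall h, inV (R %/ 3 - R %/ 3 %/ K) h -> B (p * h) = 0].
Proof.
move=> K0; have [C0 C00 HC] := mang_window Q.
have kk0 : (0 < 64 * K)%N by rewrite muln_gt0.
have [m0 Htau] := tau_bound Q kk0.
pose BB := (C0 * (20 * (rho Q).+1) * #|rqF Q| ^ (cc Q C + 2))%N.
have [m1 Hpoly] := poly_le_exp BB 3 kk0.
exists (3 * (C + k0 Q + 10 + K + m0 + m1))%N => R HR B Bl star.
set L := (R %/ 3)%N; set sL := (L %/ K)%N; set M := (8 * L + k0 Q + 1)%N.
have HL : (C + k0 Q + 10 + K + m0 + m1 <= L)%N by rewrite leq_divRL // mulnC.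
have [l [s [Hl Hs Hmang]]] := HC (8 * L)%N (4 * L)%N (leq_mul (isT : (4 <= 8)%N) (leqnn L)).
apply: contrapT => Hno.
have star' k : KK B (3 * L + R %% 3 - C) (3 * L + R %% 3 + C) k -> k = 0.
  by rewrite mulnC -divn_eq; exact: star.
have sL_le : (sL <= L)%N by apply: leq_div.
have r2 : (R %% 3 <= 2)%N by rewrite -ltnS ltn_pmod.
have Lb : (C + k0 Q + 10 <= L)%N by lia.
have tl (n : quad (rqd Q)) : n != 0 -> (dg n <= M)%N -> (tau M n <= 2 ^ (M %/ (64 * K)))%N.
  by move=> n0 nM; apply: Htau nM => //; rewrite /M; move: HL; clear; lia.
have := @core_bound Q B Bl C L sL (R %% 3) l M _ s (l%:Z - s) (erefl _) r2 sL_le Lb star' Hl Hs (erefl _) tl.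
have Hp (n : quad (rqd Q)) : Ex s (l%:Z - s) n -> primeq n -> ~ annih B L sL n.
  move=> Hn pn An; apply: Hno; exists n; split=> //.
    by have [_ h1 h2] := Hn; rewrite /balanced h1 h2; move: Hs; lia.
  have := Ex_dg Hn => -[->]; exact: Hl.
move=> /(_ Hp) => H; set y := (M %/ (64 * K))%N in H tl.
have E : (#|rqF Q| ^ l <= C0 * (20 * (rho Q).+1 * M.+1 ^ 3 * (2 ^ y) ^ 2 * #|rqF Q| ^ (8 * L - sL + cc Q C + 2)))%N.
  by rewrite -lez_nat; apply: le_trans Hmang _; rewrite PoszM ler_wpM2l.
have q1 := q_gt1 Q; have q0 := q_gt0 Q.
have E2 : (#|rqF Q| ^ (8 * L - sL) * #|rqF Q| ^ sL <= #|rqF Q| ^ (8 * L - sL) * (BB * M.+1 ^ 3 * (2 ^ y) ^ 2))%N.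
  rewrite -expnD subnK; last by lia.
  apply: leq_trans (_ : #|rqF Q| ^ l <= _)%N; first by rewrite leq_exp2l //; case/andP: Hl => /ltnW.
  apply: leq_trans E _; rewrite -[(8 * L - sL + _ + 2)%N]addnA expnD /BB.
  by move: (_ ^ (8 * L - sL))%N (_ ^ (cc Q C + 2))%N ((2 ^ y) ^ 2)%N (M.+1 ^ 3)%N => a b c e; lia.
move: E2; rewrite leq_pmul2l ?expn_gt0 ?q0 // leqNgt => /negP; apply.
have h1 : (BB * M.+1 ^ 3 <= 2 ^ y)%N by apply: Hpoly; rewrite /M; lia.
apply: leq_ltn_trans (_ : 2 ^ (3 * y) < _)%N.
  by rewrite (_ : 3 * y = y + y * 2)%N ?expnD -?expnM ?leq_mul2r ?h1 ?orbT //; clear; lia.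
apply: leq_trans (_ : 2 ^ sL <= _)%N; last by case: (sL) => // j; rewrite leq_exp2r.
rewrite ltn_exp2l //; apply: (div_scale_lt K0); rewrite /M; move: HL; clear; lia.
Qed.

Lemma half_sumE (K : fieldType) (a b s : K) : (2%:R : K) != 0 -> s != 0 ->
  a = (a + b) / 2%:R + (a - b) / (2%:R * s) * s /\ b = (a + b) / 2%:R - (a - b) / (2%:R * s) * s.
Proof. by move=> h1 h2; split; field; rewrite h1 h2. Qed.

Lemma mul_sub_cross (K : comNzRingType) (x a b a' b' : K) : b * a' = a * b' ->
  (x * a - b) * a' = a * (x * a' - b').
Proof. by move=> E; rewrite mulrBl mulrBr E [x * a]mulrC mulrA. Qed.

Section Approx.
Variable Q : realquad.
Local Notation F := (rqF Q).
Local Notation d := (rqd Q).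
Local Notation D := (rqD Q).
Local Notation A := (quad d).
Local Notation K := (kinf F).
Local Notation S := (rqS Q).
Variables x1 x2 : K.

Lemma twoK_neq0 : (2%:R : K) != 0.
Proof.
have E : (2%:R : K) = kconst (2%:R : F) by symmetry; exact: rmorph_nat (@kconst F) 2.
rewrite E; exact: (kdeq_neq0 (kdeq_const (twoF_neq0 Q))).
Qed.

Let u : K := (x1 + x2) / 2%:R.
Let v : K := (x1 - x2) / (2%:R * S).

Lemma S_neq0 : S != 0. Proof. exact: kdeq_neq0 (qS_deq Q). Qed.

Lemma x1E : x1 = u + v * S.
Proof. exact: (half_sumE x1 x2 twoK_neq0 S_neq0).1. Qed.
Lemma x2E : x2 = u - v * S.
Proof. exact: (half_sumE x1 x2 twoK_neq0 S_neq0).2. Qed.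

(** The residue of the [sqrt d]-coordinate of the formal product [e (u + v sqrt d)]. *)
Definition resB (e : A) : F := kres (p2k e.1 * v + p2k e.2 * u).

Lemma resB_lin : lin resB.
Proof.
move=> c x y; rewrite /resB qCM /= !rmorphD /= -!mul_polyC !rmorphM /= !p2kC.
have -> : (kconst c * p2k x.1 + p2k y.1) * v + (kconst c * p2k x.2 + p2k y.2) * u =
   kconst c * (p2k x.1 * v + p2k x.2 * u) + (p2k y.1 * v + p2k y.2 * u) by ring.
by rewrite /kres kcoefD kcoef_constM.
Qed.

(** Testing against [T^i] controls the [sqrt d]-coordinate [vk] of [k (u + v sqrt d)], and testing
    against [T^i sqrt d] the other coordinate [uk]. The conjugates then lose only the degree [D] of
    [sqrt d]. *)
Lemma resB_near (k : A) (Y : nat) : (forall e, inV Y e -> resB (k * e) = 0) ->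
  exists l : A, kdle (x1 * sg1 k - sg1 l) (D%:Z - 1 - Y%:Z) /\
                kdle (x2 * sg2 k - sg2 l) (D%:Z - 1 - Y%:Z).
Proof.
move=> H.
pose uk := p2k k.1 * u + p2k k.2 * v * p2k d; pose vk := p2k k.1 * v + p2k k.2 * u.
have BE e : resB (k * e) = kres (p2k e.1 * vk + p2k e.2 * uk).
  by rewrite /resB quadM /= !rmorphD !rmorphM /= /uk /vk; congr kres; ring.
have Hv : kdle (vk - p2k (kfloor vk)) (- Y%:Z - 1).
  apply: kdle_res => i iY; have := H _ (inV_X1 Q iY).
  by rewrite BE /= rmorph0 mul0r addr0.
have Hu : kdle (uk - p2k (kfloor uk)) (- (Y - D)%N%:Z - 1).
  apply: kdle_res => i iY; have := H _ (inV_X2 iY).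
  by rewrite BE /= rmorph0 mul0r add0r.
exists (kfloor uk, kfloor vk).
have HvS : kdle ((vk - p2k (kfloor vk)) * S) (D%:Z - 1 - Y%:Z).
  by apply: kdle_le (kdleM Hv (qS_deq Q).1).1; lia.
have Hu' : kdle (uk - p2k (kfloor uk)) (D%:Z - 1 - Y%:Z) by apply: kdle_le Hu; lia.
have dS := rq_sq Q.
split.
  have -> : x1 * sg1 k - sg1 (kfloor uk, kfloor vk) =
      (uk - p2k (kfloor uk)) + (vk - p2k (kfloor vk)) * S.
    by rewrite {1}x1E /sg1 /= /uk /vk -dS; ring.
  exact: kdleD.
have -> : x2 * sg2 k - sg2 (kfloor uk, kfloor vk) =
    (uk - p2k (kfloor uk)) - (vk - p2k (kfloor vk)) * S.
  by rewrite {1}x2E /sg2 /= /uk /vk -dS; ring.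
exact: kdleB.
Qed.

Hypothesis x_irr : forall k l : A, k != 0 -> ~ (x1 * sg1 k = sg1 l /\ x2 * sg2 k = sg2 l).

Definition near (C R : nat) (k l : A) := [/\ k != 0, inV (R - C) k,
  kdle (x1 * sg1 k - sg1 l) (D%:Z - 1 - (R + C)%N%:Z) &
  kdle (x2 * sg2 k - sg2 l) (D%:Z - 1 - (R + C)%N%:Z)].

Lemma near_CR C R k l : near C R k l -> (C <= R)%N.
Proof.
move=> [k0 kV _ _]; rewrite leqNgt; apply/negP => RC.
have E : (R - C = 0)%N by lia.
by rewrite E in kV; rewrite (inV_0 kV) eqxx in k0.
Qed.

(* The determinant k l' - k' l is an integer of absolute value < 1 at both places. *)
Lemma near_prop C C' R R' k l k' l' : (D <= C)%N -> (D <= C')%N -> (R <= R' <= R.+1)%N ->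
  near C R k l -> near C' R' k' l' -> k * l' = k' * l.
Proof.
move=> CD C'D /andP[RR' R'R] H H'; have CR := near_CR H; have CR' := near_CR H'.
have [_ /inV_dle[a1 a2] b1 b2] := H; have [_ /inV_dle[a1' a2'] b1' b2'] := H'.
apply/eqP; rewrite -subr_eq0; apply/eqP; have D0 := rqD_gt0 Q.
apply: (@kdle_small _ _ (-1) (-1)); last by [].
  have -> : sg1 (k * l' - k' * l) =
      sg1 k' * (x1 * sg1 k - sg1 l) - sg1 k * (x1 * sg1 k' - sg1 l').
    by rewrite sg1B !sg1M; ring.
  by apply: kdleB; [apply: kdle_le (kdleM a1' b1).1|apply: kdle_le (kdleM a1 b1').1]; lia.
have -> : sg2 (k * l' - k' * l) =
    sg2 k' * (x2 * sg2 k - sg2 l) - sg2 k * (x2 * sg2 k' - sg2 l').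
  by rewrite sg2B !sg2M; ring.
by apply: kdleB; [apply: kdle_le (kdleM a2' b2).1|apply: kdle_le (kdleM a2 b2').1]; lia.
Qed.

Lemma star_ex : exists C : nat, forall R0, exists2 R, (R0 <= R)%N &
  forall k, KK resB (R - C) (R + C) k -> k = 0.
Proof.
apply: contrapT => Hno.
have HC C : exists RC, forall R, (RC <= R)%N -> exists k l, near C R k l.
  apply: contrapT => Hn; apply: Hno; exists C => R0; apply: contrapT => Hn2; apply: Hn.
  exists R0 => R RR; apply: contrapT => Hn3; apply: Hn2; exists R => // k [kV Hk].
  apply: contrapT => /eqP k0; apply: Hn3.
  by have [l [h1 h2]] := resB_near Hk; exists k, l; split.
(* [C = D] suffices to chain consecutive levels; larger [C] will sharpen the error of the fixed
   ratio [l0 / k0]. *)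
have [Rs HRs] := HC D; have [k0 [l0 N0]] := HRs Rs (leqnn _).
have prop R k l : (Rs <= R)%N -> near D R k l -> k * l0 = k0 * l.
  move=> RR; rewrite -(subnKC RR); move: (R - Rs)%N => j {RR}.
  elim: j k l => [|j IH] k l Hk.
    rewrite addn0 in Hk; apply: (near_prop (leqnn D) (leqnn D) _ Hk N0).
    by rewrite leqnn leqnSn.
  have [k' [l' Hk']] := HRs (Rs + j)%N (leq_addr _ _).
  have E1 := IH _ _ Hk'; have E2 : k' * l = k * l'.
    by apply: (near_prop (leqnn D) (leqnn D) _ Hk' Hk); rewrite addnS leqnSn leqnn.
  have [k'0 _ _ _] := Hk'; apply: (quad_mulfI k'0).
  by rewrite mulrCA E1 mulrCA -E2 mulrCA.
have [k00 _ _ _] := N0.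
(* The norm of [k] has degree at least 0, so the bound on one conjugate makes the other at least
   [q^(1 + C - R)]; dividing the error by it cancels [R] and leaves a factor [q^(-2C)]. *)
have small C : (D <= C)%N -> kdle (x1 * sg1 k0 - sg1 l0) (v1 k0 + D%:Z - 2 - 2 * C%:Z) /\
    kdle (x2 * sg2 k0 - sg2 l0) (v2 k0 + D%:Z - 2 - 2 * C%:Z).
  move=> CD; have [RC HRC] := HC C.
  have [k [l Hk]] := HRC (maxn RC Rs) (leq_maxl _ _).
  set R := maxn RC Rs in Hk; have CR := near_CR Hk.
  have [kn0 kV b1 b2] := Hk.
  have HkD : near D R k l.
    split=> //; first by apply: inV_le kV; lia.
      by apply: kdle_le b1; lia.
    by apply: kdle_le b2; lia.
  have E := prop R k l (leq_maxr _ _) HkD.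
  have [va vb] := (inV_v _ kn0).1 kV; have vd := v12 kn0.
  split.
    apply: (@kdle_mulI _ _ (sg1 k) _ (v1 k)); first exact: v1P.
    have -> : (x1 * sg1 k0 - sg1 l0) * sg1 k = sg1 k0 * (x1 * sg1 k - sg1 l).
      by apply: mul_sub_cross; rewrite -!sg1M mulrC E.
    by apply: kdle_le (kdleM (v1P k00).1 b1).1; lia.
  apply: (@kdle_mulI _ _ (sg2 k) _ (v2 k)); first exact: v2P.
  have -> : (x2 * sg2 k0 - sg2 l0) * sg2 k = sg2 k0 * (x2 * sg2 k - sg2 l).
    by apply: mul_sub_cross; rewrite -!sg2M mulrC E.
  by apply: kdle_le (kdleM (v2P k00).1 b2).1; lia.
apply: (x_irr k00 (l := l0)); split; apply/eqP; rewrite -subr_eq0; apply/eqP.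
  apply: kdle_all0 => N; have [h _] := small (D + N + absz (v1 k0))%N (leq_trans (leq_addr _ _) (leq_addr _ _)).
  by apply: kdle_le h; lia.
apply: kdle_all0 => N; have [_ h] := small (D + N + absz (v2 k0))%N (leq_trans (leq_addr _ _) (leq_addr _ _)).
by apply: kdle_le h; lia.
Qed.

End Approx.

(** * From approximating primes to infinitely many solutions *)

Section Ratio.
Variable Q : realquad.
Local Notation A := (quad (rqd Q)).

(** Rationalizes the denominator: elements of [sigma(K)] are given with a polynomial denominator. *)
Lemma sg1_ratio (l k : A) : k != 0 -> sg1 (l * qconj k) / p2k (nrm k) = sg1 l / sg1 k.
Proof.
move=> k0; apply/eqP; rewrite eqr_div ?sg1_neq0 //; last first.
  by rewrite -sg12 mulf_neq0 ?sg1_neq0 ?sg2_neq0.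
by rewrite sg1M sg1_conj -sg12 -mulrA [sg2 k * _]mulrC.
Qed.
Lemma sg2_ratio (l k : A) : k != 0 -> sg2 (l * qconj k) / p2k (nrm k) = sg2 l / sg2 k.
Proof.
move=> k0; apply/eqP; rewrite eqr_div ?sg2_neq0 //; last first.
  by rewrite -sg12 mulf_neq0 ?sg1_neq0 ?sg2_neq0.
by rewrite sg2M sg2_conj -sg12 -mulrA.
Qed.
End Ratio.

Section Solutions.
Variable Q : realquad.
Local Notation F := (rqF Q).
Local Notation d := (rqd Q).
Local Notation D := (rqD Q).
Local Notation A := (quad d).
Local Notation K := (kinf F).
Variables x1 x2 : K.
Hypothesis x_irr : forall k l : A, k != 0 -> ~ (x1 * sg1 k = sg1 l /\ x2 * sg2 k = sg2 l).

Lemma kdle_div (z w y : K) (N M : int) : kdeq w M -> kdle (z * w - y) (N + M) -> kdle (z - y / w) N.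
Proof.
move=> Hw H; apply: (kdle_mulI Hw).
by rewrite mulrBl divfK // (kdeq_neq0 Hw).
Qed.

Definition err1 (f : A * A) : K := x1 - sg1 f.1 / sg1 f.2.
Definition err2 (f : A * A) : K := x2 - sg2 f.1 / sg2 f.2.

(** The annihilated box gives [x_i sigma_i(pi)] up to about [q^(-L)]; dividing by a balanced
    conjugate, of size about [q^(4L)], leaves [q^(-5L)]. *)
Lemma prime_solutions (N : nat) : (0 < N)%N -> exists c : nat, forall E : nat,
  exists (f : A * A) (L : nat), [/\ primeq f.2, (E <= L)%N, (8 * L < dg f.2 <= 8 * L + c)%N,
    kdle (err1 f) ((c + L %/ N)%N%:Z - (5 * L)%N%:Z) &
    kdle (err2 f) ((c + L %/ N)%N%:Z - (5 * L)%N%:Z)].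
Proof.
move=> N0; have [C HC] := star_ex x_irr; have [R0 HR] := prime_approx Q C N0.
exists (D + rho Q + k0 Q + 1)%N => E.
have [R RR star] := HC (maxn R0 (3 * E)).
have R0R : (R0 <= R)%N by apply: leq_trans (leq_maxl _ _) RR.
have [p [pp bal dgp H]] := HR R R0R _ (resB_lin x1 x2) star.
have EL : (E <= R %/ 3)%N by rewrite leq_divRL // mulnC; apply: leq_trans (leq_maxr _ _) RR.
have [l [h1 h2]] := resB_near H.
move: {H star} (R %/ 3)%N dgp EL h1 h2 => L dgp EL h1 h2.
exists (l, p), L; have [p0 _ _] := pp.
have yL : (L %/ N <= L)%N by apply: leq_div.
have v := v12 p0; move: bal; rewrite /balanced => bal.
split; [exact: pp | exact: EL | | |].
- by case/andP: dgp => -> /= h; apply: leq_trans h _; rewrite -addnA leq_add2l leq_add2r leq_addl.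
- apply: (kdle_div (v1P p0)); apply: kdle_le h1.
  move: (L %/ N)%N (v1 p) (v2 p) (dg p) yL v bal dgp => y a b m; clear; lia.
- apply: (kdle_div (v2P p0)); apply: kdle_le h2.
  move: (L %/ N)%N (v1 p) (v2 p) (dg p) yL v bal dgp => y a b m; clear; lia.
Qed.

Lemma err_bounded_below (f : A * A) : f.2 != 0 ->
  exists E : nat, ~ (kdle (err1 f) (- E%:Z) /\ kdle (err2 f) (- E%:Z)).
Proof.
move=> f0; apply: contrapT => H.
have HE E : kdle (err1 f) (- E%:Z) /\ kdle (err2 f) (- E%:Z).
  by apply: contrapT => h; apply: H; exists E.
have e1 : err1 f = 0 by apply: kdle_all0 => E; exact: (HE E).1.
have e2 : err2 f = 0 by apply: kdle_all0 => E; exact: (HE E).2.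
apply: (x_irr f0 (l := f.1)); split.
  by move/eqP: e1; rewrite subr_eq0 => /eqP ->; rewrite divfK ?sg1_neq0.
by move/eqP: e2; rewrite subr_eq0 => /eqP ->; rewrite divfK ?sg2_neq0.
Qed.

Lemma errs_bounded_below (s : seq (A * A)) : (forall f, f \in s -> f.2 != 0) ->
  exists E : nat, forall f, f \in s -> ~ (kdle (err1 f) (- E%:Z) /\ kdle (err2 f) (- E%:Z)).
Proof.
elim: s => [|f s IH] Hs; first by exists 0%N.
have [E HE] := IH (fun g gs => Hs g (mem_behead (s := f :: s) gs)).
have [E' HE'] := err_bounded_below (Hs f (mem_head _ _)).
exists (maxn E E') => g; rewrite in_cons => /predU1P[->|gs] [h1 h2].
  by apply: HE'; split; [apply: kdle_le h1|apply: kdle_le h2]; rewrite lerN2 lez_nat leq_maxr.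
by apply: (HE g gs); split; [apply: kdle_le h1|apply: kdle_le h2]; rewrite lerN2 lez_nat leq_maxl.
Qed.

Lemma err_Keq (f g : A * A) : f.2 != 0 -> g.2 != 0 -> f.1 * g.2 = g.1 * f.2 ->
  err1 f = err1 g /\ err2 f = err2 g.
Proof.
move=> f0 g0 E; split; congr (_ - _); apply/eqP.
  by rewrite eqr_div ?sg1_neq0 // -!sg1M E.
by rewrite eqr_div ?sg2_neq0 // -!sg2M E.
Qed.

(** Equal elements of [K] have equal errors, and the errors of finitely many elements are bounded
    away from 0 because [(x1, x2)] is not in [sigma(K)]; so a sufficiently good solution is new. *)
Lemma distinct_solutions (G : A * A -> Prop) :
  (forall E : nat, exists f, [/\ f.2 != 0, G f, kdle (err1 f) (- E%:Z) & kdle (err2 f) (- E%:Z)]) ->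
  forall n : nat, exists s : seq (A * A), [/\ size s = n,
    forall i j, (i < n)%N -> (j < n)%N -> i <> j ->
      (nth (0, 0) s i).1 * (nth (0, 0) s j).2 <> (nth (0, 0) s j).1 * (nth (0, 0) s i).2 &
    forall f, f \in s -> f.2 != 0 /\ G f].
Proof.
move=> H; elim=> [|n [s [sn Hs GS]]]; first by exists [::].
have [E HE] := @errs_bounded_below s (fun f fs => (GS f fs).1).
have [f [f0 Gf h1 h2]] := H E.
have Hf j : (j < n)%N -> f.1 * (nth (0, 0) s j).2 <> (nth (0, 0) s j).1 * f.2.
  move=> jn Ef; have js : nth (0, 0) s j \in s by rewrite mem_nth ?sn.
  have [e1 e2] := err_Keq f0 (GS _ js).1 Ef.
  by apply: (HE _ js); rewrite -e1 -e2.
exists (f :: s); split.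
- by rewrite /= sn.
- move=> [|i] [|j] //= ii jj ij; first exact: Hf.
    by move=> e; apply: (Hf _ ii); rewrite e.
  by apply: Hs => // e; apply: ij; rewrite e.
- by move=> g; rewrite in_cons => /predU1P[->|/GS].
Qed.

End Solutions.

(** The surplus [m eps >= 8 L eps] pays for the shortening [y <= L / K <= L eps] and for the
    constants, among them [5 c / 8] from the spread of [m]. *)
Lemma exponent_le (R : realFieldType) (e eps : R) (N c y L K m : R) :
  0 < K -> 0 <= c -> 0 <= L -> 0 < eps -> - (5 / 8) + eps <= e -> 1 <= K * eps ->
  N <= c + y - 5 * L -> y * K <= L -> 2 * c * K <= L -> 8 * L <= m -> m <= 8 * L + c ->
  N <= m * e.
Proof.
move=> K0 c0 L0 eps0 He HK HN Hy Hc m1 m2.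
have h : L <= L * eps * K by rewrite -mulrA [eps * K]mulrC ler_peMr.
have h1 : y <= L * eps by rewrite -(ler_pM2r K0); apply: le_trans h.
have h2 : 2 * c <= L * eps by rewrite -(ler_pM2r K0); apply: le_trans h.
have m0 : 0 <= m by apply: le_trans m1; rewrite mulr_ge0.
have h3 : m * (- (5 / 8) + eps) <= m * e by apply: ler_wpM2l.
have h4 : 8 * L * eps <= m * eps by rewrite ler_pM2r.
move: h3; rewrite mulrDr; lra.
Qed.

Theorem mainTheorem1 (R : realType) (F : finFieldType) (d : {poly F})
    (sd : laurent F) :
  odd #|F| -> (2 ^ 12 < #|F|)%N ->
  d \is monic -> squarefree d -> (1 < size d)%N -> ~~ odd (size d).-1 ->
  lequiv (lmul sd sd) (lpoly d) ->
  AUFD d ->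
  forall x1 x2 : laurent F, ~ inSigmaK sd x1 x2 ->
  forall eps : R, 0 < eps ->
  forall n : nat, exists s : seq (Aelt F * Aelt F),
    size s = n /\
    (forall i j, (i < n)%N -> (j < n)%N -> i <> j ->
       ~ Keq d (nth (Azero F, Azero F) s i) (nth (Azero F, Azero F) s j)) /\
    (forall f, f \in s ->
       Aprime d f.2 /\
       (let e := - 1 / 2 - 1 / 8 + ln (Num.sqrt 2) / ln (#|F|%:R) + eps in
        absv R (lsub x1 (ldiv (sigma1 sd f.1) (sigma1 sd f.2)))
          <= Anorm R d f.2 `^ e /\
        absv R (lsub x2 (ldiv (sigma2 sd f.1) (sigma2 sd f.2)))
          <= Anorm R d f.2 `^ e)).
Proof.
move=> oddF _ _ sqf size_d even_d sq_sd ufd x1 x2 notK eps eps0 n.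
have D0 : (0 < (size d).-1./2)%N by case: (size d) size_d even_d => [|[|[|?]]].
have size_dE : size d = (size d).-1./2.*2.+1.
  by rewrite even_halfK // prednK // ltnW.
have sqS : l2k sd * l2k sd = p2k d by rewrite -l2kM -l2k_lpoly; apply/l2kP.
pose Q := RealQuad oddF D0 size_dE sqf sqS ufd.
pose S1 := @sg1 Q; pose S2 := @sg2 Q.
have s1E x : l2k (sigma1 sd x) = S1 x by rewrite l2kD l2kM !l2k_lpoly.
have s2E x : l2k (sigma2 sd x) = S2 x by rewrite l2kB l2kM !l2k_lpoly.
have x_irr (k l : quad (rqd Q)) : k != 0 ->
    ~ (l2k x1 * sg1 k = sg1 l /\ l2k x2 * sg2 k = sg2 l).
  move=> k0 [E1 E2]; apply: notK.
  exists ((l : quad (rqd Q)) * qconj k).1, ((l : quad (rqd Q)) * qconj k).2, (nrm (Q := Q) k); split.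
    exact: (@nrm_neq0 Q k k0).
    apply/l2kP; rewrite l2k_div s1E l2k_lpoly -surjective_pairing.
    rewrite [RHS](@sg1_ratio Q l k k0); apply/eqP.
    by rewrite -[X in _ == X / _]E1 mulfK ?(@sg1_neq0 Q k k0).
  apply/l2kP; rewrite l2k_div s2E l2k_lpoly -surjective_pairing.
  rewrite [RHS](@sg2_ratio Q l k k0); apply/eqP.
  by rewrite -[X in _ == X / _]E2 mulfK ?(@sg2_neq0 Q k k0).
set e := - 1 / 2 - 1 / 8 + _ + eps.
have q1 : 1 <= (#|F|%:R : R) by rewrite ler1n ltnW // (q_gt1 Q).
(* The logarithmic term is nonnegative, so [e] is at least [-5/8 + eps], the exponent reached
   through [prime_solutions]. *)
have eE : - (5 / 8) + eps <= e.
  rewrite /e lerD2r; have : 0 <= ln (Num.sqrt 2 : R) / ln (#|F|%:R : R).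
    by rewrite divr_ge0 // ln_ge0 // -[X in X <= _]sqrtr1 ler_sqrt // ler1n.
  by move: (_ / ln _) => z; lra.
pose G (f : quad (rqd Q) * quad (rqd Q)) := Aprime d f.2 /\
  (absv R (lsub x1 (ldiv (sigma1 sd f.1) (sigma1 sd f.2))) <= Anorm R d f.2 `^ e /\
   absv R (lsub x2 (ldiv (sigma2 sd f.1) (sigma2 sd f.2))) <= Anorm R d f.2 `^ e).
have [s [sn Hs GS]] : exists s : seq (quad (rqd Q) * quad (rqd Q)), [/\ size s = n,
    forall i j, (i < n)%N -> (j < n)%N -> i <> j ->
      (nth (0, 0) s i).1 * (nth (0, 0) s j).2 <> (nth (0, 0) s j).1 * (nth (0, 0) s i).2 &
    forall f, f \in s -> f.2 != 0 /\ G f].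
  apply: (distinct_solutions x_irr) => E.
  (* Since [N0] exceeds [1 / eps], shortening the box by [L %/ N0] costs at most [L eps]. *)
  have [N0 HN0] : exists N0 : nat, eps^-1 < N0%:R by exists (Num.bound eps^-1); apply: archi_boundP; rewrite invr_ge0 ltW.
  have N00 : (0 < N0)%N by rewrite -(ltr0n R); apply: lt_trans HN0; rewrite invr_gt0.
  have [c Hc] := prime_solutions x_irr N00.
  (* [E + c] brings the errors below [q^(-E)], and [2 * c * N0] is what [exponent_le] asks of
     [L]. *)
  have [f [L [pf EL dgf e1 e2]]] := Hc (E + c + 2 * c * N0)%N.
  have [f0 _ _] := pf.
  have yL : (L %/ N0 <= L)%N by apply: leq_div.
  have nE : Anorm R d f.2 = (#|F|%:R : R) `^ (dg f.2)%:R.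
    rewrite /Anorm; apply: (@absv_deq R F _ (dg f.2)%:Z); rewrite l2k_lpoly.
    have := kdeq_p2k (nrm_neq0 f0); rewrite (nrm_size f0); exact.
  have Hb (z : laurent F) : kdle (l2k z) ((c + L %/ N0)%N%:Z - (5 * L)%N%:Z) -> absv R z <= Anorm R d f.2 `^ e.
    move=> /(@absv_le R F) Hz; apply: le_trans Hz _; rewrite nE -powRrM ler_powR //.
    apply: (@exponent_le _ e eps _ c%:R (L %/ N0)%:R L%:R N0%:R) => //; rewrite ?ltr0n ?ler0n //.
    - by rewrite -ler_pdivrMr // div1r ltW.
    - by rewrite rmorphB /= -!pmulrn natrD natrM.
    - by rewrite -natrM ler_nat leq_trunc_div.
    - by rewrite -!natrM ler_nat; apply: leq_trans EL; rewrite leq_addl.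
    - by rewrite -natrM ler_nat; case/andP: dgf => /ltnW.
    - by rewrite -natrM -natrD ler_nat; case/andP: dgf.
  exists f; split; [exact: f0 | | |].
  - split; first exact: (primeq_Aprime pf).
    by split; apply: Hb; rewrite l2kB l2k_div ?s1E ?s2E.
  - by apply: kdle_le e1; move: (L %/ N0)%N yL EL => y; clear; lia.
  - by apply: kdle_le e2; move: (L %/ N0)%N yL EL => y; clear; lia.
exists s; split; [exact: sn | split].
  by move=> i j ii jj ij; exact: (Hs i j ii jj ij).
by move=> f fs; exact: (GS f fs).2.
Qed.
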